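(* The set $\{e_4^{\,i}e_6^{\,j}\delta^{k}\mid i,j,k\in\mathbb{Z}_{\ge0}\}$ is a $\mathbb{C}$-basis of $\mathcal{R}$.
   Context: Let $\mathrm{Hol}$ be the space of holomorphic functions on the upper half plane, $q=e^{2\pi iz}$, $f'=\frac{1}{2\pi i}\frac{df}{dz}$, and $E_2,E_4,E_6$ the Eisenstein series with constant term $1$. For $k\in\mathbb{R}$ let $D_kf=f'-\frac{k}{12}E_2f$. Let $H=\bigoplus_{n\in\mathbb{R}}H_n$ where each $H_n$ is a copy of $\mathrm{Hol}$, elements of $H_n$ being written $(f,n)$; $H$ is a graded commutative $\mathbb{C}$-algebra via $(f,n)(g,m)=(fg,n+m)$. Let $\mathrm{End}(H)=\bigoplus_{i\in\mathbb{R}}\mathrm{End}^i(H)$, where $\mathrm{End}^i(H)$ consists of the $\mathbb{C}$-linear maps $H\to H$ sending $H_n$ into $H_{n+i}$ for all $n$. Define $\delta,e_4,e_6\in\mathrm{End}(H)$ by $\delta(f,n)=(D_nf,n+2)$, $e_4(f,n)=(E_4f,n+4)$, $e_6(f,n)=(E_6f,n+6)$. $\mathcal{R}$ is the $\mathbb{C}$-subalgebra of $\mathrm{End}(H)$ generated by $\delta,e_4,e_6$. *)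

(* Defs.v *)
From Stdlib Require Import Reals List.
From Coquelicot Require Import Coquelicot.
Open Scope R_scope.

(** Upper half plane and holomorphic functions on it (the space Hol).
    A function C -> C represents an element of Hol through its restriction
    to the upper half plane. *)
Definition UHP (z : C) : Prop := 0 < Im z.

Definition holo (f : C -> C) : Prop := forall z : C, UHP z -> ex_derive f z.

(** q^n = e^{2 pi i n z} *)
Definition qpow (n : nat) (z : C) : C :=
  (exp (- (2 * PI * INR n * Im z)) * cos (2 * PI * INR n * Re z),
   exp (- (2 * PI * INR n * Im z)) * sin (2 * PI * INR n * Re z)).

Definition sigma (k n : nat) : R :=
  fold_right Rplus 0
    (map (fun d => if Nat.eqb (n mod d) 0 then INR d ^ k else 0) (seq 1 n)).

Definition CSeries (a : nat -> C) : C :=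
  (Series (fun n => Re (a n)), Series (fun n => Im (a n))).

Definition Eis (c : R) (km1 : nat) (z : C) : C :=
  (1 + RtoC c * CSeries (fun n => RtoC (sigma km1 (S n)) * qpow (S n) z))%C.

Definition E2 : C -> C := Eis (-24) 1.
Definition E4 : C -> C := Eis 240 3.
Definition E6 : C -> C := Eis (-504) 5.

Definition qderiv (f : C -> C) (z : C) : C :=
  (C_derive f z / (RtoC (2 * PI) * Ci))%C.

Definition Dk (k : R) (f : C -> C) (z : C) : C :=
  (qderiv f z - RtoC (k / 12) * E2 z * f z)%C.

(** Elements of H = (+)_{n in R} H_n are represented by their families of
    components F : R -> Hol; membership in H requires finite support
    (on the upper half plane) and holomorphic components. *)
Definition Hx := R -> C -> C.

Definition inH (F : Hx) : Prop :=
  (exists l : list R, forall m, ~ In m l -> forall z, UHP z -> F m z = 0%C)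
  /\ (forall m, holo (F m)).

Definition eqH (F G : Hx) : Prop := forall m z, UHP z -> F m z = G m z.

Definition Op := Hx -> Hx.

Definition opid : Op := fun F => F.
Definition opzero : Op := fun _ _ _ => 0%C.
Definition opadd (T S : Op) : Op := fun F m z => (T F m z + S F m z)%C.
Definition opscale (a : C) (T : Op) : Op := fun F m z => (a * T F m z)%C.
Definition opcomp (T S : Op) : Op := fun F => T (S F).

(** delta (f,n) = (D_n f, n+2); e4 (f,n) = (E4 f, n+4); e6 (f,n) = (E6 f, n+6) *)
Definition delta : Op := fun F m z => Dk (m - 2) (F (m - 2)) z.
Definition e4 : Op := fun F m z => (E4 z * F (m - 4)%R z)%C.
Definition e6 : Op := fun F m z => (E6 z * F (m - 6)%R z)%C.

Definition opeq (T S : Op) : Prop := forall F, inH F -> eqH (T F) (S F).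

Inductive inR : Op -> Prop :=
  | inR_id : inR opid
  | inR_delta : inR delta
  | inR_e4 : inR e4
  | inR_e6 : inR e6
  | inR_add : forall T S, inR T -> inR S -> inR (opadd T S)
  | inR_scale : forall a T, inR T -> inR (opscale a T)
  | inR_comp : forall T S, inR T -> inR S -> inR (opcomp T S).

Definition oppow (T : Op) (n : nat) : Op := Nat.iter n (opcomp T) opid.

Definition basis_el (i j k : nat) : Op :=
  opcomp (oppow e4 i) (opcomp (oppow e6 j) (oppow delta k)).

Definition opsum (l : list Op) : Op := fold_right opadd opzero l.

Definition lincomb (N : nat) (c : nat -> nat -> nat -> C) : Op :=
  opsum (flat_map (fun i => flat_map (fun j => map (fun k =>
     opscale (c i j k) (basis_el i j k)) (seq 0 N)) (seq 0 N)) (seq 0 N)).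

(* Main.v *)
(* Spanning: Ramanujan's identities 3 E4' = E2 E4 - E6 and 2 E6' = E2 E6 - E4^2
   say that [delta, e4] = - e6 / 3 and [delta, e6] = - e4^2 / 2, so delta can be
   moved to the right of e4 and e6. On Fourier coefficients the identities
   express the convolutions of sigma_1 with sigma_3, of sigma_1 with sigma_5 and
   of sigma_3 with itself through divisor functions; these follow from Liouville's
   substitution (a, b, x, y) -> (a - b, b, x, x + y) on the solutions of
   a x + b y = n. That delta preserves holomorphy requires that the derivative
   of a complex differentiable function is again differentiable; this is obtained
   from Goursat's theorem and Cauchy's formula on squares.

   Independence: applying a relation to ((z - z0)^K, 0), with K the largest
   exponent of delta that occurs, and evaluating at z0 isolates the terms with
   delta^K, since delta^k with k < K leaves a zero at z0. What remains is a
   relation between the E4^i E6^j with 4 i + 6 j fixed, that is, a polynomial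
   equation for E4 E6^(-2/3); along the imaginary axis this function is strictly
   monotone near infinity, hence takes infinitely many values. *)

(* Ramanujan's identities and the independence of E4 and E6 are usually drawn from modularity. Here
   the identities are checked coefficient by coefficient, and independence rests on the signs of the
   Fourier coefficients beyond the constant term, positive for E4 and negative for E6. Since [holo]
   asks only for differentiability at each point, regularity of derivatives has to start from
   Goursat; squares serve as contours because their sides reduce to real Riemann integrals. A second
   constraint comes from the encoding: operators act on arbitrary families, while [delta] is
   additive only on differentiable ones and equality is meant on the half plane. Relations between
   operators are therefore stated up to [opeq], and rewriting under [delta] requires its argument to
   satisfy [inH]. In the independence argument z0 is arbitrary, so that a relation at one point
   becomes a relation between functions. The exponents of [delta] are treated from the top down,
   because a power of [delta] above K need not vanish at z0 on the probe. *)
Require Import Defs.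
From Stdlib Require Import Reals List Lra Lia Classical ClassicalEpsilon Permutation.
From Coquelicot Require Import Coquelicot.
Open Scope R_scope.

(** * Complex derivatives *)

(* Coquelicot has two normed-module structures on C over itself,
   [C_NormedModule] (used by [holo] and [C_derive]) and the one of the ring C
   (used by the product and chain rules); this epsilon-delta notion is
   equivalent to both. *)
Definition cderiv (f : C -> C) (z l : C) : Prop :=
  forall eps, 0 < eps -> exists d, 0 < d /\
    forall w, Cmod (w - z) < d ->
      Cmod (f w - f z - l * (w - z)) <= eps * Cmod (w - z).

Definition cdiff (f : C -> C) (z : C) : Prop := exists l, cderiv f z l.

Lemma cderiv_is_derive_ring (f : C -> C) (z l : C) :
  cderiv f z l <->
  @is_derive C_AbsRing (AbsRing_NormedModule C_AbsRing) f z l.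
Proof.
  split.
  - intros H; split; [apply is_linear_scal_l|].
    intros x Hx.
    assert (z = x) as <- by exact (@is_filter_lim_locally_unique C_AbsRing (AbsRing_NormedModule C_AbsRing) z x Hx).
    intros eps; destruct (H eps (cond_pos eps)) as [d [Hd H']].
    exists (mkposreal d Hd); intros y Hy.
    specialize (H' y Hy).
    change (Cmod (f y - f z - (y - z) * l) <= eps * Cmod (y - z)).
    now replace (f y - f z - (y - z) * l)%C with (f y - f z - l * (y - z))%C by ring.
  - intros [_ H] eps Heps.
    destruct (H z (fun P HP => HP) (mkposreal eps Heps)) as [d Hd].
    exists d; split; [apply cond_pos|]; intros w Hw.
    specialize (Hd w Hw).
    change (Cmod (f w - f z - (w - z) * l) <= eps * Cmod (w - z)) in Hd.
    now replace (f w - f z - l * (w - z))%C with (f w - f z - (w - z) * l)%C by ring.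
Qed.

Lemma cderiv_is_derive (f : C -> C) (z l : C) :
  cderiv f z l <-> @is_derive C_AbsRing C_NormedModule f z l.
Proof.
  rewrite cderiv_is_derive_ring; split.
  - intros [_ H]; split; [apply is_linear_scal_l|exact H].
  - intros [_ H]; split; [apply is_linear_scal_l|exact H].
Qed.

Lemma cdiff_ex_derive (f : C -> C) (z : C) :
  cdiff f z <-> @ex_derive C_AbsRing C_NormedModule f z.
Proof.
  split; intros [l Hl]; exists l; now apply cderiv_is_derive.
Qed.

Lemma cderiv_unique (f : C -> C) (z l : C) : cderiv f z l -> C_derive f z = l.
Proof. intros H; now apply is_C_derive_unique, cderiv_is_derive. Qed.

Lemma cdiff_correct (f : C -> C) (z : C) :
  cdiff f z -> cderiv f z (C_derive f z).
Proof. intros [l Hl]; now rewrite (cderiv_unique _ _ _ Hl). Qed.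

Lemma cderiv_const (a z : C) : cderiv (fun _ => a) z 0.
Proof.
  apply cderiv_is_derive_ring. exact (is_derive_const (K:=C_AbsRing) (V:=AbsRing_NormedModule C_AbsRing) a z).
Qed.

Lemma cderiv_id (z : C) : cderiv (fun w => w) z 1.
Proof. apply cderiv_is_derive_ring. exact (is_derive_id (K:=C_AbsRing) z). Qed.

Lemma cderiv_plus (f g : C -> C) (z l m : C) :
  cderiv f z l -> cderiv g z m -> cderiv (fun w => f w + g w)%C z (l + m)%C.
Proof.
  rewrite !cderiv_is_derive_ring; intros Hf Hg.
  exact (is_derive_plus (K:=C_AbsRing) (V:=AbsRing_NormedModule C_AbsRing) f g z l m Hf Hg).
Qed.

Lemma cderiv_mult (f g : C -> C) (z l m : C) :
  cderiv f z l -> cderiv g z m ->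
  cderiv (fun w => f w * g w)%C z (l * g z + f z * m)%C.
Proof.
  rewrite !cderiv_is_derive_ring; intros Hf Hg.
  exact (is_derive_mult (K:=C_AbsRing) f g z l m Hf Hg Cmult_comm).
Qed.

Lemma cderiv_comp (f g : C -> C) (z l m : C) :
  cderiv f (g z) l -> cderiv g z m -> cderiv (fun w => f (g w)) z (m * l)%C.
Proof.
  rewrite !cderiv_is_derive_ring; intros Hf Hg.
  exact (is_derive_comp (K:=C_AbsRing) (V:=AbsRing_NormedModule C_AbsRing) f g z l m Hf Hg).
Qed.

Lemma cderiv_eq (f : C -> C) (z l m : C) : cderiv f z l -> l = m -> cderiv f z m.
Proof. now intros H <-. Qed.

Lemma cderiv_scal (a : C) (f : C -> C) (z l : C) :
  cderiv f z l -> cderiv (fun w => a * f w)%C z (a * l)%C.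
Proof.
  intros H; eapply cderiv_eq; [apply cderiv_mult; [apply cderiv_const|exact H]|].
  simpl; ring.
Qed.

Lemma cderiv_minus (f g : C -> C) (z l m : C) :
  cderiv f z l -> cderiv g z m -> cderiv (fun w => f w - g w)%C z (l - m)%C.
Proof.
  rewrite !cderiv_is_derive_ring; intros Hf Hg.
  exact (is_derive_minus (K:=C_AbsRing) (V:=AbsRing_NormedModule C_AbsRing) f g z l m Hf Hg).
Qed.

Lemma cderiv_ext_loc (f g : C -> C) (z l : C) (d : R) :
  0 < d -> (forall w, Cmod (w - z) < d -> f w = g w) ->
  cderiv f z l -> cderiv g z l.
Proof.
  intros Hd E H eps Heps; destruct (H eps Heps) as [d' [Hd' H']].
  exists (Rmin d d'); split; [now apply Rmin_glb_lt|].
  intros w Hw; rewrite <- !E.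
  - apply H'; eapply Rlt_le_trans; [exact Hw|apply Rmin_r].
  - replace (z - z)%C with (RtoC 0) by ring; now rewrite Cmod_0.
  - eapply Rlt_le_trans; [exact Hw|apply Rmin_l].
Qed.

Lemma cderiv_ext (f g : C -> C) (z l : C) :
  (forall w, f w = g w) -> cderiv f z l -> cderiv g z l.
Proof. intros E; apply (cderiv_ext_loc f g z l 1 Rlt_0_1); auto. Qed.

Lemma Cmod_minus_sym (a b : C) : Cmod (a - b) = Cmod (b - a).
Proof. rewrite <- Cmod_opp; f_equal; ring. Qed.

Lemma Cmod_triangle_rev (a b : C) : Cmod a - Cmod (a - b) <= Cmod b.
Proof.
  assert (Cmod a <= Cmod b + Cmod (a - b)); [|lra].
  replace a with (b + (a - b))%C at 1 by ring; apply Cmod_triangle.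
Qed.

(** The derivatives of the inverse, of power series and of the Cauchy integrals all come with an
    explicit quadratic remainder. The sign of [M] is left open, hence [Rabs M + 1] in the radius. *)
Lemma cderiv_quadratic (f : C -> C) (z l : C) (d M : R) :
  0 < d -> (forall w, Cmod (w - z) < d ->
    Cmod (f w - f z - l * (w - z)) <= M * (Cmod (w - z) * Cmod (w - z))) ->
  cderiv f z l.
Proof.
  intros Hd H eps Heps.
  pose proof (Rabs_pos M) as HM.
  exists (Rmin d (eps / (Rabs M + 1))); split.
  - apply Rmin_glb_lt; [exact Hd|]; apply Rdiv_lt_0_compat; lra.
  - intros w Hw.
    pose proof (Rmin_l d (eps / (Rabs M + 1))); pose proof (Rmin_r d (eps / (Rabs M + 1))).
    eapply Rle_trans; [apply H; lra|].
    pose proof (Cmod_ge_0 (w - z)).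
    assert (Cmod (w - z) * (Rabs M + 1) <= eps).
    { apply Rle_trans with (eps / (Rabs M + 1) * (Rabs M + 1)).
      - apply Rmult_le_compat_r; lra.
      - right; field; lra. }
    pose proof (Rle_abs M). nra.
Qed.

Lemma cderiv_inv (z : C) : z <> 0%C -> cderiv (fun w => / w)%C z (- / (z * z))%C.
Proof.
  intros Hz.
  assert (Hm : 0 < Cmod z) by now apply Cmod_gt_0.
  (* On this disc |w| > |z| / 2, so the remainder (w - z)^2 / (z^2 w) is at most 2 |w - z|^2 /
     |z|^3. *)
  apply cderiv_quadratic with (d := Cmod z / 2) (M := 2 / (Cmod z * Cmod z * Cmod z)); [lra|].
  intros w Hw.
  pose proof (Cmod_triangle_rev z w) as Ht.
  rewrite (Cmod_minus_sym z w) in Ht.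
  assert (Hw0 : Cmod z / 2 < Cmod w) by lra.
  assert (w <> 0%C) by (apply Cmod_gt_0; lra).
  replace (/ w - / z - - / (z * z) * (w - z))%C
    with ((w - z) * (w - z) / (z * z * w))%C by (field; auto).
  rewrite Cmod_div by (repeat apply Cmult_neq_0; auto).
  rewrite !Cmod_mult.
  pose proof (Cmod_ge_0 (w - z)) as H0; set (h := Cmod (w - z)) in *.
  unfold Rdiv; rewrite Rmult_comm; apply Rmult_le_compat_r; [nra|].
  replace (2 * / (Cmod z * Cmod z * Cmod z)) with (/ (Cmod z * Cmod z * (Cmod z / 2))) by (field; lra).
  apply Rinv_le_contravar.
  - repeat apply Rmult_lt_0_compat; lra.
  - apply Rmult_le_compat_l; [nra|lra].
Qed.

Lemma cderiv_pow (n : nat) (z : C) :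
  cderiv (fun w => w ^ S n)%C z (RtoC (INR (S n)) * z ^ n)%C.
Proof.
  induction n as [|n IH].
  - apply cderiv_ext with (fun w => w); [intros w; simpl; ring|].
    eapply cderiv_eq; [apply cderiv_id|]; simpl; ring.
  - apply cderiv_ext with (fun w => w * w ^ S n)%C; [intros w; now rewrite <- Cpow_S|].
    eapply cderiv_eq; [apply cderiv_mult; [apply cderiv_id|exact IH]|].
    rewrite (S_INR (S n)), RtoC_plus, !Cpow_S; ring.
Qed.

Lemma cdiff_const (a z : C) : cdiff (fun _ => a) z.
Proof. eexists; apply cderiv_const. Qed.

Lemma cdiff_id (z : C) : cdiff (fun w => w) z.
Proof. eexists; apply cderiv_id. Qed.

Lemma cdiff_plus (f g : C -> C) (z : C) :
  cdiff f z -> cdiff g z -> cdiff (fun w => f w + g w)%C z.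
Proof. intros [l Hl] [m Hm]; eexists; now apply cderiv_plus; eauto. Qed.

Lemma cdiff_minus (f g : C -> C) (z : C) :
  cdiff f z -> cdiff g z -> cdiff (fun w => f w - g w)%C z.
Proof. intros [l Hl] [m Hm]; eexists; now apply cderiv_minus; eauto. Qed.

Lemma cdiff_mult (f g : C -> C) (z : C) :
  cdiff f z -> cdiff g z -> cdiff (fun w => f w * g w)%C z.
Proof. intros [l Hl] [m Hm]; eexists; now apply cderiv_mult; eauto. Qed.

Lemma cdiff_inv (f : C -> C) (z : C) :
  cdiff f z -> f z <> 0%C -> cdiff (fun w => / f w)%C z.
Proof.
  intros [l Hl] H0; eexists.
  apply (cderiv_comp (fun w => / w)%C f); [now apply cderiv_inv|exact Hl].
Qed.

Lemma cdiff_pow (n : nat) (f : C -> C) (z : C) :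
  cdiff f z -> cdiff (fun w => f w ^ n)%C z.
Proof.
  intros H; destruct n as [|n]; [exact (cdiff_const 1 z)|].
  destruct H as [l Hl]; eexists.
  apply (cderiv_comp (fun w => w ^ S n)%C f); [apply cderiv_pow|exact Hl].
Qed.

Lemma cdiff_ext_loc (f g : C -> C) (z : C) (d : R) :
  0 < d -> (forall w, Cmod (w - z) < d -> f w = g w) -> cdiff f z -> cdiff g z.
Proof. intros Hd E [l Hl]; exists l; now apply (cderiv_ext_loc f g z l d). Qed.

Lemma cdiff_continuous (f : C -> C) (z : C) : cdiff f z ->
  forall eps, 0 < eps -> exists d, 0 < d /\
    forall w, Cmod (w - z) < d -> Cmod (f w - f z) < eps.
Proof.
  intros [l Hl] eps Heps.
  destruct (Hl 1 Rlt_0_1) as [d [Hd H]].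
  pose proof (Cmod_ge_0 l) as H0.
  exists (Rmin d (eps / (Cmod l + 2))); split.
  - apply Rmin_glb_lt; [exact Hd|]; apply Rdiv_lt_0_compat; lra.
  - intros w Hw.
    pose proof (Rmin_l d (eps / (Cmod l + 2))); pose proof (Rmin_r d (eps / (Cmod l + 2))).
    replace (f w - f z)%C with ((f w - f z - l * (w - z)) + l * (w - z))%C by ring.
    eapply Rle_lt_trans; [apply Cmod_triangle|].
    rewrite Cmod_mult.
    assert (Hb : Cmod (f w - f z - l * (w - z)) <= 1 * Cmod (w - z)) by (apply H; lra).
    pose proof (Cmod_ge_0 (w - z)).
    assert (Cmod (w - z) * (Cmod l + 2) < eps).
    { apply Rlt_le_trans with (eps / (Cmod l + 2) * (Cmod l + 2)).
      - apply Rmult_lt_compat_r; lra.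
      - right; field; lra. }
    nra.
Qed.

(** * Integrals over rectangle boundaries *)

Definition is_CInt (g : R -> C) (a b : R) (l : C) : Prop :=
  is_RInt (fun t => fst (g t)) a b (fst l) /\ is_RInt (fun t => snd (g t)) a b (snd l).

Definition ex_CInt (g : R -> C) (a b : R) : Prop := exists l, is_CInt g a b l.

Definition CInt (g : R -> C) (a b : R) : C :=
  (RInt (fun t => fst (g t)) a b, RInt (fun t => snd (g t)) a b).

Lemma is_CInt_unique g a b l : is_CInt g a b l -> CInt g a b = l.
Proof.
  intros [H1 H2]; unfold CInt.
  apply injective_projections; simpl; now apply (is_RInt_unique (V:=R_CompleteNormedModule)).
Qed.

Lemma CInt_correct g a b : ex_CInt g a b -> is_CInt g a b (CInt g a b).
Proof. intros [l Hl]; now rewrite (is_CInt_unique _ _ _ _ Hl). Qed.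

Lemma is_CInt_plus f g a b l m : is_CInt f a b l -> is_CInt g a b m ->
  is_CInt (fun t => f t + g t)%C a b (l + m)%C.
Proof.
  intros [H1 H2] [H3 H4]; split.
  - exact (is_RInt_plus (V:=R_NormedModule) _ _ _ _ _ _ H1 H3).
  - exact (is_RInt_plus (V:=R_NormedModule) _ _ _ _ _ _ H2 H4).
Qed.

Lemma is_CInt_scal (k : C) g a b l : is_CInt g a b l ->
  is_CInt (fun t => k * g t)%C a b (k * l)%C.
Proof.
  intros [H1 H2]; split; simpl.
  - apply (is_RInt_minus (V:=R_NormedModule) (fun t => fst k * fst (g t))
      (fun t => snd k * snd (g t)));
      now apply (is_RInt_scal (V:=R_NormedModule)).
  - apply (is_RInt_plus (V:=R_NormedModule) (fun t => fst k * snd (g t))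
      (fun t => snd k * fst (g t)));
      now apply (is_RInt_scal (V:=R_NormedModule)).
Qed.

Lemma is_CInt_ext f g a b l : a <= b -> (forall t, a <= t <= b -> f t = g t) ->
  is_CInt f a b l -> is_CInt g a b l.
Proof.
  intros Hab E [H1 H2]; split; (eapply is_RInt_ext; [|eassumption]);
    rewrite Rmin_left, Rmax_right by lra; intros t Ht; simpl; rewrite E; auto; lra.
Qed.

Lemma is_CInt_Chasles f a b c l m : is_CInt f a b l -> is_CInt f b c m ->
  is_CInt f a c (l + m)%C.
Proof.
  intros [H1 H2] [H3 H4]; split.
  - exact (is_RInt_Chasles (V:=R_NormedModule) _ _ _ _ _ _ H1 H3).
  - exact (is_RInt_Chasles (V:=R_NormedModule) _ _ _ _ _ _ H2 H4).
Qed.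

Lemma is_CInt_const (k : C) a b : is_CInt (fun _ => k) a b (RtoC (b - a) * k)%C.
Proof.
  split; simpl.
  - replace ((b - a) * fst k - 0 * snd k) with ((b - a) * fst k) by ring.
    apply (is_RInt_const (V:=R_NormedModule)).
  - replace ((b - a) * snd k + 0 * fst k) with ((b - a) * snd k) by ring.
    apply (is_RInt_const (V:=R_NormedModule)).
Qed.

Lemma Cmod_le_abs (z : C) : Cmod z <= Rabs (fst z) + Rabs (snd z).
Proof.
  replace z with (RtoC (fst z) + Ci * RtoC (snd z))%C at 1.
  - eapply Rle_trans; [apply Cmod_triangle|].
    rewrite Cmod_mult, Cmod_Ci, !Cmod_R; lra.
  - apply injective_projections; simpl; ring.
Qed.

Lemma fst_le_Cmod (z : C) : Rabs (fst z) <= Cmod z.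
Proof. eapply Rle_trans; [|apply Rmax_Cmod]; apply Rmax_l. Qed.

Lemma snd_le_Cmod (z : C) : Rabs (snd z) <= Cmod z.
Proof. eapply Rle_trans; [|apply Rmax_Cmod]; apply Rmax_r. Qed.

(* The factor 2 comes from bounding real and imaginary parts separately. *)
Lemma Cmod_CInt_le g a b l M : a <= b -> is_CInt g a b l ->
  (forall t, a <= t <= b -> Cmod (g t) <= M) -> Cmod l <= 2 * M * (b - a).
Proof.
  intros Hab [H1 H2] HM.
  eapply Rle_trans; [apply Cmod_le_abs|].
  assert (Rabs (fst l) <= (b - a) * M).
  { rewrite <- (is_RInt_unique (V:=R_CompleteNormedModule) _ _ _ _ H1).
    apply abs_RInt_le_const; [exact Hab|now exists (fst l)|].
    intros t Ht; eapply Rle_trans; [apply fst_le_Cmod|now apply HM]. }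
  assert (Rabs (snd l) <= (b - a) * M).
  { rewrite <- (is_RInt_unique (V:=R_CompleteNormedModule) _ _ _ _ H2).
    apply abs_RInt_le_const; [exact Hab|now exists (snd l)|].
    intros t Ht; eapply Rle_trans; [apply snd_le_Cmod|now apply HM]. }
  lra.
Qed.

(** Both components are continuous along the path. A 1-Lipschitz [p] covers horizontal and vertical
    segments at once. *)
Lemma ex_CInt_cdiff (f : C -> C) (p : R -> C) a b : a <= b ->
  (forall s t, Cmod (p s - p t) <= Rabs (s - t)) ->
  (forall t, a <= t <= b -> cdiff f (p t)) ->
  ex_CInt (fun t => f (p t)) a b.
Proof.
  intros Hab Hp Hf.
  assert (Hc : forall t, a <= t <= b -> forall eps : posreal, exists d : posreal,
     forall s, Rabs (s - t) < d -> Cmod (f (p s) - f (p t)) < eps).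
  { intros t Ht eps.
    destruct (cdiff_continuous f (p t) (Hf t Ht) eps (cond_pos eps)) as [d [Hd H]].
    exists (mkposreal d Hd); intros s Hs; apply H.
    eapply Rle_lt_trans; [apply Hp|exact Hs]. }
  assert (ex_RInt (fun t => fst (f (p t))) a b) as [l1 H1].
  { apply (ex_RInt_continuous (V:=R_CompleteNormedModule)).
    rewrite Rmin_left, Rmax_right by lra; intros t Ht.
    apply continuity_pt_filterlim, continuity_pt_locally; intros eps.
    destruct (Hc t Ht eps) as [d Hd]; exists d; intros s Hs.
    eapply Rle_lt_trans; [|apply (Hd s Hs)]; apply (fst_le_Cmod (f (p s) - f (p t))%C). }
  assert (ex_RInt (fun t => snd (f (p t))) a b) as [l2 H2].
  { apply (ex_RInt_continuous (V:=R_CompleteNormedModule)).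
    rewrite Rmin_left, Rmax_right by lra; intros t Ht.
    apply continuity_pt_filterlim, continuity_pt_locally; intros eps.
    destruct (Hc t Ht eps) as [d Hd]; exists d; intros s Hs.
    eapply Rle_lt_trans; [|apply (Hd s Hs)]; apply (snd_le_Cmod (f (p s) - f (p t))%C). }
  now exists (l1, l2).
Qed.

Lemma horizontal_lip (y s t : R) : Cmod ((s, y) - (t, y)) <= Rabs (s - t).
Proof.
  replace ((s, y) - (t, y))%C with (RtoC (s - t)); [rewrite Cmod_R; lra|].
  apply injective_projections; simpl; ring.
Qed.

Lemma vertical_lip (x s t : R) : Cmod ((x, s) - (x, t)) <= Rabs (s - t).
Proof.
  replace ((x, s) - (x, t))%C with (Ci * RtoC (s - t))%C.
  - rewrite Cmod_mult, Cmod_Ci, Cmod_R; lra.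
  - apply injective_projections; simpl; ring.
Qed.

Definition hint (f : C -> C) (y a b : R) : C := CInt (fun x => f (x, y)) a b.
Definition vint (f : C -> C) (x c d : R) : C := CInt (fun y => f (x, y)) c d.

Lemma hint_correct f y a b : a <= b -> (forall x, a <= x <= b -> cdiff f (x, y)) ->
  is_CInt (fun x => f (x, y)) a b (hint f y a b).
Proof.
  intros Hab Hf; apply CInt_correct.
  apply (ex_CInt_cdiff f (fun x => (x, y))); auto using horizontal_lip.
Qed.

Lemma vint_correct f x c d : c <= d -> (forall y, c <= y <= d -> cdiff f (x, y)) ->
  is_CInt (fun y => f (x, y)) c d (vint f x c d).
Proof.
  intros Hab Hf; apply CInt_correct.
  apply (ex_CInt_cdiff f (fun y => (x, y))); auto using vertical_lip.
Qed.

(** The contour integral of f dw, counterclockwise around [a,b] x [c,d]; [Ci] stems from dw = i dy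
    on the vertical sides. *)
Definition rint (f : C -> C) (a b c d : R) : C :=
  (hint f c a b + Ci * vint f b c d - hint f d a b - Ci * vint f a c d)%C.

Lemma rint_split_x f a m b c d : a <= m <= b ->
  (forall x, a <= x <= b -> cdiff f (x, c)) ->
  (forall x, a <= x <= b -> cdiff f (x, d)) ->
  rint f a b c d = (rint f a m c d + rint f m b c d)%C.
Proof.
  intros Hm Hc Hd.
  assert (E : forall y, (forall x, a <= x <= b -> cdiff f (x, y)) ->
     hint f y a b = (hint f y a m + hint f y m b)%C).
  { intros y Hy; apply is_CInt_unique, is_CInt_Chasles with m;
      apply hint_correct; try lra; intros x Hx; apply Hy; lra. }
  unfold rint; rewrite (E c Hc), (E d Hd); ring.
Qed.

Lemma rint_split_y f a b c m d : c <= m <= d ->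
  (forall y, c <= y <= d -> cdiff f (a, y)) ->
  (forall y, c <= y <= d -> cdiff f (b, y)) ->
  rint f a b c d = (rint f a b c m + rint f a b m d)%C.
Proof.
  intros Hm Ha Hb.
  assert (E : forall x, (forall y, c <= y <= d -> cdiff f (x, y)) ->
     vint f x c d = (vint f x c m + vint f x m d)%C).
  { intros x Hx; apply is_CInt_unique, is_CInt_Chasles with m;
      apply vint_correct; try lra; intros y Hy; apply Hx; lra. }
  unfold rint; rewrite (E a Ha), (E b Hb); ring.
Qed.

(** Hypotheses on integrands are restricted to the boundary because the Cauchy kernels have a pole
    inside the rectangle. *)
Definition on_bd (a b c d : R) (w : C) : Prop :=
  a <= fst w <= b /\ c <= snd w <= d /\
  (fst w = a \/ fst w = b \/ snd w = c \/ snd w = d).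

Lemma rint_linear f g (k : C) a b c d : a <= b -> c <= d ->
  (forall w, on_bd a b c d w -> cdiff f w) ->
  (forall w, on_bd a b c d w -> cdiff g w) ->
  rint (fun w => f w + k * g w)%C a b c d = (rint f a b c d + k * rint g a b c d)%C.
Proof.
  intros Hab Hcd Hf Hg; unfold rint.
  assert (Eh : forall y, y = c \/ y = d ->
     hint (fun w => f w + k * g w)%C y a b = (hint f y a b + k * hint g y a b)%C).
  { intros y Hy; apply is_CInt_unique, is_CInt_plus; [|apply is_CInt_scal];
      apply hint_correct; auto; intros x Hx; [apply Hf|apply Hg];
      unfold on_bd; simpl; destruct Hy; subst; intuition lra. }
  assert (Ev : forall x, x = a \/ x = b ->
     vint (fun w => f w + k * g w)%C x c d = (vint f x c d + k * vint g x c d)%C).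
  { intros y Hy; apply is_CInt_unique, is_CInt_plus; [|apply is_CInt_scal];
      apply vint_correct; auto; intros x Hx; [apply Hf|apply Hg];
      unfold on_bd; simpl; destruct Hy; subst; intuition lra. }
  rewrite !Eh, !Ev by tauto; ring.
Qed.

Lemma rint_ext f g a b c d : a <= b -> c <= d ->
  (forall w, on_bd a b c d w -> cdiff f w) ->
  (forall w, on_bd a b c d w -> f w = g w) -> rint f a b c d = rint g a b c d.
Proof.
  intros Hab Hcd Hf E; unfold rint.
  assert (Eh : forall y, y = c \/ y = d -> hint f y a b = hint g y a b).
  { intros y Hy; symmetry; apply is_CInt_unique; apply is_CInt_ext with (fun x => f (x, y)); auto.
    - intros x Hx; apply E; unfold on_bd; simpl; destruct Hy; subst; intuition lra.
    - apply hint_correct; auto; intros x Hx; apply Hf; unfold on_bd; simpl;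
        destruct Hy; subst; intuition lra. }
  assert (Ev : forall x, x = a \/ x = b -> vint f x c d = vint g x c d).
  { intros y Hy; symmetry; apply is_CInt_unique; apply is_CInt_ext with (fun x => f (y, x)); auto.
    - intros x Hx; apply E; unfold on_bd; simpl; destruct Hy; subst; intuition lra.
    - apply vint_correct; auto; intros x Hx; apply Hf; unfold on_bd; simpl;
        destruct Hy; subst; intuition lra. }
  rewrite !Eh, !Ev by tauto; ring.
Qed.

(** The perimeter accounts for one factor 2, the constant of [Cmod_CInt_le] for the other. *)
Lemma Cmod_rint_le f a b c d M : a <= b -> c <= d ->
  (forall w, on_bd a b c d w -> cdiff f w) ->
  (forall w, on_bd a b c d w -> Cmod (f w) <= M) ->
  Cmod (rint f a b c d) <= 4 * M * ((b - a) + (d - c)).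
Proof.
  intros Hab Hcd Hf HM.
  assert (Eh : forall y, y = c \/ y = d -> Cmod (hint f y a b) <= 2 * M * (b - a)).
  { intros y Hy; eapply Cmod_CInt_le; [exact Hab| |].
    - apply hint_correct; auto; intros x Hx; apply Hf; unfold on_bd; simpl;
        destruct Hy; subst; intuition lra.
    - intros x Hx; apply HM; unfold on_bd; simpl; destruct Hy; subst; intuition lra. }
  assert (Ev : forall y, y = a \/ y = b -> Cmod (vint f y c d) <= 2 * M * (d - c)).
  { intros y Hy; eapply Cmod_CInt_le; [exact Hcd| |].
    - apply vint_correct; auto; intros x Hx; apply Hf; unfold on_bd; simpl;
        destruct Hy; subst; intuition lra.
    - intros x Hx; apply HM; unfold on_bd; simpl; destruct Hy; subst; intuition lra. }
  unfold rint, Cminus.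
  eapply Rle_trans; [apply Cmod_triangle|].
  eapply Rle_trans; [apply Rplus_le_compat_r, Cmod_triangle|].
  eapply Rle_trans; [apply Rplus_le_compat_r, Rplus_le_compat_r, Cmod_triangle|].
  rewrite !Cmod_opp, !Cmod_mult, Cmod_Ci.
  pose proof (Eh c (or_introl eq_refl)); pose proof (Eh d (or_intror eq_refl)).
  pose proof (Ev a (or_introl eq_refl)); pose proof (Ev b (or_intror eq_refl)).
  lra.
Qed.

(** The four sides are computed explicitly. Goursat's theorem compares f locally with such an affine
    function. *)
Lemma rint_affine (al be : C) a b c d : rint (fun w => al + be * w)%C a b c d = 0%C.
Proof.
  assert (Hid : forall u v, is_RInt (fun x => x) u v ((v * v - u * u) / 2)).
  { intros u v.
    replace ((v * v - u * u) / 2) with (minus (v * v / 2) (u * u / 2))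
      by (unfold minus, plus, opp; simpl; field).
    apply (is_RInt_derive (V:=R_CompleteNormedModule) (fun x => x * x / 2)).
    - intros x _; auto_derive; auto; field.
    - intros x _; apply continuous_id. }
  assert (Hh : forall y, hint (fun w => al + be * w)%C y a b =
    (RtoC (b - a) * al + be * (((b * b - a * a) / 2)%R, ((b - a) * y)%R))%C).
  { intros y; apply is_CInt_unique, is_CInt_plus; [apply is_CInt_const|].
    apply is_CInt_scal; split; simpl; [apply Hid|].
    apply (is_RInt_const (V:=R_NormedModule)). }
  assert (Hv : forall x, vint (fun w => al + be * w)%C x c d =
    (RtoC (d - c) * al + be * (((d - c) * x)%R, ((d * d - c * c) / 2)%R))%C).
  { intros x; apply is_CInt_unique, is_CInt_plus; [apply is_CInt_const|].
    apply is_CInt_scal; split; simpl; [|apply Hid].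
    apply (is_RInt_const (V:=R_NormedModule)). }
  unfold rint; rewrite !Hh, !Hv.
  apply injective_projections; simpl; field.
Qed.

(** * Goursat's theorem *)

Lemma pow_half_small (L d : R) : 0 < d -> exists n, L * (1 / 2) ^ n < d.
Proof.
  intros Hd.
  destruct (pow_lt_1_zero (1 / 2)) with (y := d / (Rabs L + 1)) as [n Hn].
  - rewrite Rabs_pos_eq; lra.
  - pose proof (Rabs_pos L); apply Rdiv_lt_0_compat; lra.
  - exists n; specialize (Hn n (le_n n)).
    pose proof (Rabs_pos L); pose proof (Rle_abs L).
    assert (0 < (1 / 2) ^ n) by (apply pow_lt; lra).
    rewrite Rabs_pos_eq in Hn by lra.
    apply Rmult_lt_compat_r with (r := Rabs L + 1) in Hn; [|lra].
    replace (d / (Rabs L + 1) * (Rabs L + 1)) with d in Hn by (field; lra).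
    nra.
Qed.

Lemma nested_intervals (u v : nat -> R) :
  (forall n, u n <= v n) -> (forall n, u n <= u (S n)) -> (forall n, v (S n) <= v n) ->
  exists x, forall n, u n <= x <= v n.
Proof.
  intros Huv Hu Hv.
  assert (Hum : forall n k, u n <= u (n + k)%nat).
  { intros n k; induction k as [|k IH]; [rewrite Nat.add_0_r; lra|].
    rewrite Nat.add_succ_r; eapply Rle_trans; [exact IH|apply Hu]. }
  assert (Hvm : forall n k, v (n + k)%nat <= v n).
  { intros n k; induction k as [|k IH]; [rewrite Nat.add_0_r; lra|].
    rewrite Nat.add_succ_r; eapply Rle_trans; [apply Hv|exact IH]. }
  assert (Hc : forall n m, u n <= v m).
  { intros n m; eapply Rle_trans; [apply (Hum n m)|].
    eapply Rle_trans; [apply Huv|].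
    rewrite Nat.add_comm; apply Hvm. }
  destruct (completeness (fun x => exists n, x = u n)) as [x [H1 H2]].
  - exists (v 0%nat); intros y [n ->]; apply Hc.
  - exists (u 0%nat); now exists 0%nat.
  - exists x; intros n; split.
    + apply H1; now exists n.
    + apply H2; intros y [m ->]; apply Hc.
Qed.

Section Bisection.
Variable P : R -> R -> R -> R -> Prop.
Variables a b c d : R.
Hypothesis Hab : a <= b.
Hypothesis Hcd : c <= d.
Hypothesis glue : forall x y z t, a <= x <= y -> y <= b -> c <= z <= t -> t <= d ->
  P x ((x + y) / 2) z ((z + t) / 2) -> P ((x + y) / 2) y z ((z + t) / 2) ->
  P x ((x + y) / 2) ((z + t) / 2) t -> P ((x + y) / 2) y ((z + t) / 2) t -> P x y z t.
Hypothesis local : forall u v, a <= u <= b -> c <= v <= d ->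
  exists e, 0 < e /\ forall x y z t, a <= x <= u -> u <= y <= b ->
    c <= z <= v -> v <= t <= d -> y - x < e -> t - z < e -> P x y z t.

Let bad (s : (R * R) * (R * R)) : Prop :=
  let '((x, y), (z, t)) := s in
  a <= x <= y /\ y <= b /\ c <= z <= t /\ t <= d /\ ~ P x y z t.

Let half (s s' : (R * R) * (R * R)) : Prop :=
  let '((x, y), (z, t)) := s in
  let '((x', y'), (z', t')) := s' in
  x <= x' /\ y' <= y /\ z <= z' /\ t' <= t /\
  y' - x' = (y - x) / 2 /\ t' - z' = (t - z) / 2.

Lemma bad_step s : bad s -> exists s', bad s' /\ half s s'.
Proof.
  destruct s as [[x y] [z t]]; intros (Hx & Hy & Hz & Ht & HP).
  apply NNPP; intros HN; apply HP, glue; try tauto;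
    apply NNPP; intros HQ; apply HN;
    [exists ((x, (x + y) / 2), (z, (z + t) / 2))|
     exists (((x + y) / 2, y), (z, (z + t) / 2))|
     exists ((x, (x + y) / 2), ((z + t) / 2, t))|
     exists (((x + y) / 2, y), ((z + t) / 2, t))];
    (split; [unfold bad; repeat split; try lra; exact HQ|unfold half; repeat split; lra]).
Qed.

(** If [P] failed, repeated quartering would give nested failing rectangles shrinking to a point (u,
    v), where [local] contradicts the failure. This is the form in which compactness is used, both
    for boundedness and for Goursat's estimate. *)
Lemma rectangle_bisection : P a b c d.
Proof.
  apply NNPP; intros HP.
  assert (H0 : bad ((a, b), (c, d))) by (unfold bad; repeat split; auto; lra).
  (* Choosing a failing quarter is made a function on the failing rectangles, so that the nested
     sequence is an iteration. *)
  pose (next := fun s : {s | bad s} =>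
    let (s', H) := constructive_indefinite_description _ (bad_step (proj1_sig s) (proj2_sig s)) in
    exist bad s' (proj1 H)).
  assert (Hnext : forall s, half (proj1_sig s) (proj1_sig (next s))).
  { intros s; unfold next.
    destruct (constructive_indefinite_description _ _) as [s' [H1 H2]]; exact H2. }
  pose (sq := fun n => Nat.iter n next (exist bad _ H0)).
  assert (Hsq : forall n, bad (proj1_sig (sq n))) by (intros n; exact (proj2_sig (sq n))).
  assert (Hstep : forall n, half (proj1_sig (sq n)) (proj1_sig (sq (S n))))
    by (intros n; apply Hnext).
  pose (x := fun n => fst (fst (proj1_sig (sq n)))).
  pose (y := fun n => snd (fst (proj1_sig (sq n)))).
  pose (z := fun n => fst (snd (proj1_sig (sq n)))).
  pose (t := fun n => snd (snd (proj1_sig (sq n)))).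
  assert (HB : forall n, a <= x n <= y n /\ y n <= b /\ c <= z n <= t n /\ t n <= d
     /\ ~ P (x n) (y n) (z n) (t n)).
  { intros n; specialize (Hsq n); unfold x, y, z, t.
    destruct (proj1_sig (sq n)) as [[? ?] [? ?]]; exact Hsq. }
  assert (HH : forall n, x n <= x (S n) /\ y (S n) <= y n /\ z n <= z (S n) /\ t (S n) <= t n
     /\ y (S n) - x (S n) = (y n - x n) / 2 /\ t (S n) - z (S n) = (t n - z n) / 2).
  { intros n; specialize (Hstep n); unfold x, y, z, t.
    destruct (proj1_sig (sq n)) as [[? ?] [? ?]].
    destruct (proj1_sig (sq (S n))) as [[? ?] [? ?]]; exact Hstep. }
  assert (Hlen : forall n, y n - x n = (b - a) * (1 / 2) ^ n /\ t n - z n = (d - c) * (1 / 2) ^ n).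
  { induction n as [|n [IH1 IH2]].
    - unfold x, y, z, t; simpl; lra.
    - destruct (HH n) as (_ & _ & _ & _ & -> & ->); rewrite IH1, IH2; simpl; lra. }
  destruct (nested_intervals x y) as [u Hu]; try (intros n; apply HB || apply HH).
  destruct (nested_intervals z t) as [v Hv]; try (intros n; apply HB || apply HH).
  assert (Hu0 : a <= u <= b).
  { destruct (HB 0%nat) as (? & ? & _); specialize (Hu 0%nat); lra. }
  assert (Hv0 : c <= v <= d).
  { destruct (HB 0%nat) as (_ & _ & ? & ? & _); specialize (Hv 0%nat); lra. }
  destruct (local u v Hu0 Hv0) as [e [He Hloc]].
  destruct (pow_half_small ((b - a) + (d - c)) e He) as [n Hn].
  assert (0 < (1 / 2) ^ n) by (apply pow_lt; lra).
  destruct (HB n) as (? & ? & ? & ? & HQ); apply HQ; apply Hloc;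
    try (specialize (Hu n); lra); try (specialize (Hv n); lra);
    destruct (Hlen n) as [E1 E2]; (rewrite E1 || rewrite E2); nra.
Qed.
End Bisection.

Definition rdiff (f : C -> C) (a b c d : R) : Prop :=
  forall w : C, a <= fst w <= b -> c <= snd w <= d -> cdiff f w.

Lemma rdiff_bounded f a b c d : a <= b -> c <= d -> rdiff f a b c d ->
  exists M, forall w : C, a <= fst w <= b -> c <= snd w <= d -> Cmod (f w) <= M.
Proof.
  intros Hab Hcd Hf.
  apply (rectangle_bisection (fun a b c d => exists M, forall w : C,
    a <= fst w <= b -> c <= snd w <= d -> Cmod (f w) <= M) a b c d Hab Hcd).
  - intros x y z t _ _ _ _ [M1 H1] [M2 H2] [M3 H3] [M4 H4].
    exists (Rmax (Rmax M1 M2) (Rmax M3 M4)); intros w Hw1 Hw2.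
    pose proof (Rmax_l M1 M2); pose proof (Rmax_r M1 M2).
    pose proof (Rmax_l M3 M4); pose proof (Rmax_r M3 M4).
    pose proof (Rmax_l (Rmax M1 M2) (Rmax M3 M4)); pose proof (Rmax_r (Rmax M1 M2) (Rmax M3 M4)).
    destruct (Rle_dec (fst w) ((x + y) / 2)), (Rle_dec (snd w) ((z + t) / 2));
      [assert (Cmod (f w) <= M1) by (apply H1; lra)|assert (Cmod (f w) <= M3) by (apply H3; lra)|
       assert (Cmod (f w) <= M2) by (apply H2; lra)|assert (Cmod (f w) <= M4) by (apply H4; lra)]; lra.
  - intros u v Hu Hv.
    destruct (cdiff_continuous f (u, v) (Hf (u, v) Hu Hv) 1 Rlt_0_1) as [e [He H]].
    exists (e / 2); split; [lra|]; intros x y z t Hx Hy Hz Ht Hxy Hzt.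
    exists (Cmod (f (u, v)) + 1); intros w Hw1 Hw2.
    assert (Hd : Cmod (w - (u, v)) < e).
    { eapply Rle_lt_trans; [apply Cmod_le_abs|]; simpl.
      assert (Rabs (fst w + - u) < e / 2) by (apply Rabs_def1; lra).
      assert (Rabs (snd w + - v) < e / 2) by (apply Rabs_def1; lra). lra. }
    specialize (H w Hd).
    pose proof (Cmod_triangle_rev (f w) (f (u, v))); lra.
Qed.

(** The bound 4 eps L^2, with L the half perimeter, is shaped to be glued exactly: the four quarters
    have half perimeter L / 2, and their bounds add up to the one of the whole. On a small rectangle
    around p, f differs from its affine approximation, whose integral is 0, by at most eps L. *)
Lemma goursat f a b c d : a <= b -> c <= d -> rdiff f a b c d -> rint f a b c d = 0%C.
Proof.
  intros Hab Hcd Hf.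
  assert (HE : forall eps, 0 < eps -> Cmod (rint f a b c d) <= 4 * eps * ((b - a) + (d - c)) ^ 2).
  { intros eps Heps.
    apply (rectangle_bisection (fun a b c d =>
      Cmod (rint f a b c d) <= 4 * eps * ((b - a) + (d - c)) ^ 2) a b c d Hab Hcd).
    - intros x y z t Hx Hy Hz Ht H1 H2 H3 H4.
      rewrite (rint_split_x f x ((x + y) / 2) y z t);
        [|lra|intros; apply Hf; simpl; lra|intros; apply Hf; simpl; lra].
      rewrite (rint_split_y f x ((x + y) / 2) z ((z + t) / 2) t);
        [|lra|intros; apply Hf; simpl; lra|intros; apply Hf; simpl; lra].
      rewrite (rint_split_y f ((x + y) / 2) y z ((z + t) / 2) t);
        [|lra|intros; apply Hf; simpl; lra|intros; apply Hf; simpl; lra].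
      eapply Rle_trans; [apply Cmod_triangle|].
      eapply Rle_trans; [apply Rplus_le_compat; apply Cmod_triangle|].
      replace (4 * eps * (y - x + (t - z)) ^ 2) with
        (4 * eps * ((x + y) / 2 - x + ((z + t) / 2 - z)) ^ 2 +
         4 * eps * (y - (x + y) / 2 + ((z + t) / 2 - z)) ^ 2 +
         4 * eps * ((x + y) / 2 - x + (t - (z + t) / 2)) ^ 2 +
         4 * eps * (y - (x + y) / 2 + (t - (z + t) / 2)) ^ 2) by field.
      lra.
    - intros u v Hu Hv.
      destruct (Hf (u, v) Hu Hv) as [l Hl].
      destruct (Hl eps Heps) as [e [He H]].
      exists (e / 2); split; [lra|]; intros x y z t Hx Hy Hz Ht Hxy Hzt.
      set (p := (u, v) : C) in *.
      pose (A := fun w : C => ((f p - l * p) + l * w)%C).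
      pose (g := fun w : C => (f w + (- (1)) * A w)%C).
      assert (HA : forall w, cdiff A w).
      { intros w; apply cdiff_plus; [apply cdiff_const|].
        apply cdiff_mult; [apply cdiff_const|apply cdiff_id]. }
      assert (Hfw : forall w, on_bd x y z t w -> cdiff f w).
      { intros w (? & ? & _); apply Hf; lra. }
      assert (E : rint f x y z t = rint g x y z t).
      { unfold g; rewrite rint_linear; auto; try lra.
        unfold A; rewrite rint_affine; ring. }
      rewrite E.
      replace (4 * eps * (y - x + (t - z)) ^ 2)
        with (4 * (eps * (y - x + (t - z))) * ((y - x) + (t - z))) by ring.
      apply Cmod_rint_le; try lra.
      + intros w Hw; apply cdiff_plus; [auto|apply cdiff_mult; auto using cdiff_const].
      + intros w (Hw1 & Hw2 & _).
        assert (Hd : Cmod (w - p) <= (y - x) + (t - z)).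
        { eapply Rle_trans; [apply Cmod_le_abs|]; simpl.
          assert (Rabs (fst w + - u) <= y - x) by (apply Rabs_le; lra).
          assert (Rabs (snd w + - v) <= t - z) by (apply Rabs_le; lra). lra. }
        replace (g w) with (f w - f p - l * (w - p))%C by (unfold g, A; ring).
        eapply Rle_trans; [apply H; lra|].
        apply Rmult_le_compat_l; lra. }
  apply Cmod_eq_0, Rle_antisym; [|apply Cmod_ge_0].
  apply le_epsilon; intros eps Heps; rewrite Rplus_0_l.
  set (L := ((b - a) + (d - c)) ^ 2) in *.
  assert (HL : 0 <= L) by (unfold L; apply pow2_ge_0).
  eapply Rle_trans; [apply (HE (eps / (4 * (L + 1))))|].
  - apply Rdiv_lt_0_compat; lra.
  - replace (4 * (eps / (4 * (L + 1))) * L) with (eps * (L / (L + 1))) by (field; lra).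
    assert (L / (L + 1) <= 1) by (apply Rle_div_l; lra). nra.
Qed.

(** * Cauchy's formula *)

(* Goursat leaves only a small square around z, on which the quotient
   (f w - f z) / (w - z) is bounded. *)
Lemma cauchy_rint f a b c d (z : C) :
  a < fst z < b -> c < snd z < d -> rdiff f a b c d ->
  rint (fun w => f w * / (w - z))%C a b c d
  = (f z * rint (fun w => / (w - z))%C a b c d)%C.
Proof.
  intros Hx Hy Hf.
  assert (Hinv : forall w, w <> z -> cdiff (fun w => / (w - z))%C w).
  { intros w Hw; apply (cdiff_inv (fun w => w - z)%C).
    - apply cdiff_minus; [apply cdiff_id|apply cdiff_const].
    - intros E; apply Hw; replace w with ((w - z) + z)%C by ring; rewrite E; ring. }
  pose (g := fun w : C => ((f w + (- (1)) * f z) * / (w - z))%C).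
  assert (Hg : forall w : C, a <= fst w <= b -> c <= snd w <= d -> w <> z -> cdiff g w).
  { intros w H1 H2 Hw; apply cdiff_mult; [|now apply Hinv].
    apply cdiff_plus; [now apply Hf|apply cdiff_const]. }
  assert (Hbd : forall w, on_bd a b c d w -> w <> z).
  { intros w (_ & _ & H) ->; lra. }
  assert (H0 : rint g a b c d = 0%C).
  { apply Cmod_eq_0, Rle_antisym; [|apply Cmod_ge_0].
    apply le_epsilon; intros eps Heps; rewrite Rplus_0_l.
    destruct (Hf z ltac:(lra) ltac:(lra)) as [l Hl].
    destruct (Hl 1 Rlt_0_1) as [e [He H]].
    pose proof (Cmod_ge_0 l) as Hl0.
    set (m := Rmin (Rmin (fst z - a) (b - fst z)) (Rmin (snd z - c) (d - snd z))).
    assert (Hm : 0 < m /\ m <= fst z - a /\ m <= b - fst z /\ m <= snd z - c /\ m <= d - snd z).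
    { unfold m; repeat split.
      - repeat apply Rmin_glb_lt; lra.
      - eapply Rle_trans; [apply Rmin_l|apply Rmin_l].
      - eapply Rle_trans; [apply Rmin_l|apply Rmin_r].
      - eapply Rle_trans; [apply Rmin_r|apply Rmin_l].
      - eapply Rle_trans; [apply Rmin_r|apply Rmin_r]. }
    (* [m] keeps the small square inside the rectangle and e / 4 keeps it inside the disc where f is
       close to its linearisation. The half perimeter 4 r and the factor 4 of [Cmod_rint_le] give
       the 16. *)
    set (r := Rmin (Rmin m (e / 4)) (eps / (16 * (Cmod l + 1)))).
    assert (Hr : 0 < r /\ r <= m /\ r <= e / 4 /\ r <= eps / (16 * (Cmod l + 1))).
    { unfold r; repeat split.
      - repeat apply Rmin_glb_lt; try lra; apply Rdiv_lt_0_compat; lra.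
      - eapply Rle_trans; [apply Rmin_l|apply Rmin_l].
      - eapply Rle_trans; [apply Rmin_l|apply Rmin_r].
      - apply Rmin_r. }
    clearbody m r; destruct z as [x y]; simpl in *.
    assert (Hgo : forall a' b' c' d', a <= a' <= b' -> b' <= b -> c <= c' <= d' -> d' <= d ->
       (x < a' \/ b' < x \/ y < c' \/ d' < y) -> rint g a' b' c' d' = 0%C).
    { intros; apply goursat; try lra; intros w Hw1 Hw2; apply Hg; try lra.
      intros ->; simpl in *; lra. }
    (* The left, right, lower and upper pieces avoid z and contribute 0 by Goursat; the square of
       half side r around z remains. *)
    rewrite (rint_split_x g a (x - r) b c d); try lra;
      try (intros; apply Hg; simpl; try lra; intros E; injection E; lra).
    rewrite (rint_split_x g (x - r) (x + r) b c d); try lra;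
      try (intros; apply Hg; simpl; try lra; intros E; injection E; lra).
    rewrite (rint_split_y g (x - r) (x + r) c (y - r) d); try lra;
      try (intros; apply Hg; simpl; try lra; intros E; injection E; lra).
    rewrite (rint_split_y g (x - r) (x + r) (y - r) (y + r) d); try lra;
      try (intros; apply Hg; simpl; try lra; intros E; injection E; lra).
    rewrite !(Hgo a), !(Hgo (x + r)), (Hgo (x - r) (x + r) c (y - r)), (Hgo (x - r) (x + r) (y + r) d) by lra.
    match goal with |- Cmod ?u <= _ => replace u with (rint g (x - r) (x + r) (y - r) (y + r)) by ring end.
    assert (Hb : forall w, on_bd (x - r) (x + r) (y - r) (y + r) w -> w <> (x, y)).
    { intros w (_ & _ & Hw) ->; simpl in Hw; lra. }
    eapply Rle_trans; [apply Cmod_rint_le with (M := Cmod l + 1); try lra|].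
    - intros w Hw; apply Hg; [| |now apply Hb]; destruct Hw as (? & ? & _); lra.
    - intros w Hw; pose proof (Hb w Hw) as Hwz; destruct Hw as (Hw1 & Hw2 & _).
      assert (Hwz' : (w - (x, y))%C <> 0%C).
      { intros E; apply Hwz; replace w with ((w - (x, y)) + (x, y))%C by ring; rewrite E; ring. }
      assert (Hd : Cmod (w - (x, y)) < e).
      { eapply Rle_lt_trans; [apply Cmod_le_abs|]; simpl.
        assert (Rabs (fst w + - x) <= r) by (apply Rabs_le; lra).
        assert (Rabs (snd w + - y) <= r) by (apply Rabs_le; lra). lra. }
      specialize (H w Hd); unfold g.
      rewrite Cmod_mult, Cmod_inv by exact Hwz'.
      pose proof (proj1 (Cmod_gt_0 _) Hwz') as Hp.
      apply Rle_div_l; [exact Hp|].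
      replace (f w + - (1) * f (x, y))%C
        with ((f w - f (x, y) - l * (w - (x, y))) + l * (w - (x, y)))%C by ring.
      eapply Rle_trans; [apply Cmod_triangle|]; rewrite Cmod_mult; lra.
    - destruct Hr as (? & _ & _ & Hr).
      apply Rle_div_r in Hr; [|lra]. nra. }
  transitivity (rint (fun w => g w + f z * / (w - z))%C a b c d).
  - symmetry; apply rint_ext; try lra.
    + intros w Hw; pose proof (Hbd w Hw); destruct Hw as (? & ? & _).
      apply cdiff_plus; [now apply Hg|]; apply cdiff_mult; [apply cdiff_const|now apply Hinv].
    + intros w Hw; unfold g; ring.
  - rewrite rint_linear; try lra.
    + rewrite H0; ring.
    + intros w Hw; pose proof (Hbd w Hw); destruct Hw as (? & ? & _); now apply Hg.
    + intros w Hw; now apply Hinv, Hbd.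
Qed.

(** Differentiation under the integral sign: a remainder of the integrand that is quadratic in z' -
    z, uniformly in w, integrates to a quadratic remainder. *)
Lemma rint_param_deriv (G : C -> C -> C) (G' : C -> C) (z : C) a b c d e M :
  a <= b -> c <= d -> 0 < e ->
  (forall z' w, Cmod (z' - z) < e -> on_bd a b c d w -> cdiff (G z') w) ->
  (forall w, on_bd a b c d w -> cdiff G' w) ->
  (forall z' w, Cmod (z' - z) < e -> on_bd a b c d w ->
     Cmod (G z' w - G z w - (z' - z) * G' w) <= M * (Cmod (z' - z) * Cmod (z' - z))) ->
  cderiv (fun z => rint (G z) a b c d) z (rint G' a b c d).
Proof.
  intros Hab Hcd He HG HG' HM.
  apply cderiv_quadratic with (d := e) (M := 4 * M * ((b - a) + (d - c))); [exact He|].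
  intros z' Hz'.
  assert (Hz : Cmod (z - z) < e) by (replace (z - z)%C with (RtoC 0) by ring; now rewrite Cmod_0).
  assert (HGz : forall w, on_bd a b c d w -> cdiff (fun w => G z w + (z' - z) * G' w)%C w).
  { intros w Hw; apply cdiff_plus; [auto|apply cdiff_mult; auto using cdiff_const]. }
  replace (rint (G z') a b c d - rint (G z) a b c d - rint G' a b c d * (z' - z))%C
    with (rint (fun w => G z' w + (- (1)) * (G z w + (z' - z) * G' w))%C a b c d).
  - replace (4 * M * (b - a + (d - c)) * (Cmod (z' - z) * Cmod (z' - z)))
      with (4 * (M * (Cmod (z' - z) * Cmod (z' - z))) * ((b - a) + (d - c))) by ring.
    apply Cmod_rint_le; auto.
    + intros w Hw; apply cdiff_plus; [auto|]; apply cdiff_mult; [apply cdiff_const|auto].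
    + intros w Hw.
      replace (G z' w + - (1) * (G z w + (z' - z) * G' w))%C
        with (G z' w - G z w - (z' - z) * G' w)%C by ring; auto.
  - rewrite rint_linear, rint_linear by auto; ring.
Qed.

Lemma Cmod_inv_le (u : C) r : 0 < r -> r <= Cmod u -> Cmod (/ u) <= / r.
Proof.
  intros Hr Hu; rewrite Cmod_inv by (apply Cmod_gt_0; lra).
  now apply Rinv_le_contravar.
Qed.

Lemma Cmod_prod4_le (f p q r s : C) M A : 0 <= A ->
  Cmod f <= M -> Cmod p <= A -> Cmod q <= A -> Cmod r <= A -> Cmod s <= A ->
  Cmod (f * (p * q * (r * s))) <= M * (A * A * (A * A)).
Proof.
  intros HA Hf Hp Hq Hr Hs; rewrite !Cmod_mult.
  repeat apply Rmult_le_compat; auto; repeat apply Rmult_le_pos; apply Cmod_ge_0.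
Qed.

Section CauchyKernels.
Variables (f : C -> C) (a b c d M r : R) (z : C).
Hypothesis Hab : a <= b.
Hypothesis Hcd : c <= d.
Hypothesis Hf : forall w, on_bd a b c d w -> cdiff f w.
Hypothesis HM : forall w, on_bd a b c d w -> Cmod (f w) <= M.
Hypothesis Hr : 0 < r.
Hypothesis Hz : forall w, on_bd a b c d w -> r <= Cmod (w - z).

Let away z' w : Cmod (z' - z) < r / 2 -> on_bd a b c d w ->
  r / 2 <= Cmod (w - z') /\ (w - z')%C <> 0%C /\ (w - z)%C <> 0%C.
Proof.
  intros Hz' Hw; pose proof (Hz w Hw).
  pose proof (Cmod_triangle_rev (w - z) (w - z')) as Ht.
  replace (w - z - (w - z'))%C with (z' - z)%C in Ht by ring.
  split; [lra|split; apply Cmod_gt_0; lra].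
Qed.

Let kernel_cdiff z' w k : Cmod (z' - z) < r / 2 -> on_bd a b c d w ->
  cdiff (fun w => f w * (/ (w - z')) ^ k)%C w.
Proof.
  intros Hz' Hw; apply cdiff_mult; [auto|].
  apply cdiff_pow, (cdiff_inv (fun w => w - z')%C).
  - apply cdiff_minus; [apply cdiff_id|apply cdiff_const].
  - now apply (away z' w).
Qed.

Let Hzz : Cmod (z - z) < r / 2.
Proof. replace (z - z)%C with (RtoC 0) by ring; rewrite Cmod_0; lra. Qed.

(** The remainder of 1 / (w - z) is (z' - z)^2 / ((w - z)^2 (w - z')). It is padded by a factor 1 to
    four factors, so that [Cmod_prod4_le] serves both kernels; this is why [A] is taken at least
    1. *)
Lemma cauchy_kernel_deriv1 :
  cderiv (fun z => rint (fun w => f w * (/ (w - z)) ^ 1)%C a b c d) z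
         (rint (fun w => f w * (/ (w - z)) ^ 2)%C a b c d).
Proof.
  set (A := Rmax 1 (/ (r / 2))).
  assert (HA1 : 1 <= A) by apply Rmax_l.
  assert (HA2 : / (r / 2) <= A) by apply Rmax_r.
  apply rint_param_deriv with (e := r / 2) (M := M * (A * A * (A * A))); auto; [lra|].
  intros z' w Hz' Hw; destruct (away z' w Hz' Hw) as (H1 & H2 & H3).
  pose proof (Hz w Hw).
  replace (f w * (/ (w - z')) ^ 1 - f w * (/ (w - z)) ^ 1
           - (z' - z) * (f w * (/ (w - z)) ^ 2))%C
    with (f w * (/ (w - z) * / (w - z) * (/ (w - z') * 1)) * ((z' - z) * (z' - z)))%C
    by (simpl; field; auto).
  rewrite Cmod_mult, (Cmod_mult (z' - z)).
  apply Rmult_le_compat_r; [apply Rmult_le_pos; apply Cmod_ge_0|].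
  apply Cmod_prod4_le; auto; try lra; try (rewrite Cmod_1; lra);
    (eapply Rle_trans; [apply Cmod_inv_le with (r := r / 2); lra|lra]).
Qed.

Lemma cauchy_kernel_deriv2 :
  cderiv (fun z => rint (fun w => f w * (/ (w - z)) ^ 2)%C a b c d) z
         (rint (fun w => (2 * f w) * (/ (w - z)) ^ 3)%C a b c d).
Proof.
  set (A := Rmax 1 (/ (r / 2))).
  assert (HA1 : 1 <= A) by apply Rmax_l.
  assert (HA2 : / (r / 2) <= A) by apply Rmax_r.
  (* The remainder of the squared kernel is one product of four inverses plus twice another, hence
     the factor 3. *)
  apply rint_param_deriv with (e := r / 2) (M := 3 * (M * (A * A * (A * A)))); auto; [lra| |].
  - intros w Hw; apply cdiff_mult; [apply cdiff_mult; [apply cdiff_const|auto]|].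
    apply cdiff_pow, (cdiff_inv (fun w => w - z)%C).
    + apply cdiff_minus; [apply cdiff_id|apply cdiff_const].
    + now apply (away z w).
  - intros z' w Hz' Hw; destruct (away z' w Hz' Hw) as (H1 & H2 & H3).
    pose proof (Hz w Hw).
    replace (f w * (/ (w - z')) ^ 2 - f w * (/ (w - z)) ^ 2
             - (z' - z) * (2 * f w * (/ (w - z)) ^ 3))%C
      with ((f w * (/ (w - z) * / (w - z) * (/ (w - z') * / (w - z')))
             + 2 * (f w * (/ (w - z) * / (w - z) * (/ (w - z) * / (w - z')))))
             * ((z' - z) * (z' - z)))%C
      by (simpl; field; auto).
    rewrite Cmod_mult, (Cmod_mult (z' - z)).
    apply Rmult_le_compat_r; [apply Rmult_le_pos; apply Cmod_ge_0|].
    eapply Rle_trans; [apply Cmod_triangle|]; rewrite (Cmod_mult 2), Cmod_R, Rabs_pos_eq by lra.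
    assert (Hk : forall u : C, r / 2 <= Cmod u -> Cmod (/ u) <= A).
    { intros u Hu; eapply Rle_trans; [apply Cmod_inv_le with (r := r / 2); lra|lra]. }
    assert (Cmod (f w * (/ (w - z) * / (w - z) * (/ (w - z') * / (w - z')))) <= M * (A * A * (A * A))).
    { apply Cmod_prod4_le; auto; try lra; apply Hk; lra. }
    assert (Cmod (f w * (/ (w - z) * / (w - z) * (/ (w - z) * / (w - z')))) <= M * (A * A * (A * A))).
    { apply Cmod_prod4_le; auto; try lra; apply Hk; lra. }
    lra.
Qed.
End CauchyKernels.

Lemma is_CInt_snd_ge g a b l m : a <= b -> is_CInt g a b l ->
  (forall t, a <= t <= b -> m <= snd (g t)) -> (b - a) * m <= snd l.
Proof.
  intros Hab [_ H] Hm.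
  apply (is_RInt_le (fun _ => m) (fun t => snd (g t)) a b); auto.
  - apply (is_RInt_const (V:=R_NormedModule)).
  - intros t Ht; apply Hm; lra.
Qed.

Lemma is_CInt_fst_ge g a b l m : a <= b -> is_CInt g a b l ->
  (forall t, a <= t <= b -> m <= fst (g t)) -> (b - a) * m <= fst l.
Proof.
  intros Hab [H _] Hm.
  apply (is_RInt_le (fun _ => m) (fun t => fst (g t)) a b); auto.
  - apply (is_RInt_const (V:=R_NormedModule)).
  - intros t Ht; apply Hm; lra.
Qed.

Lemma square_kernel_bound s t : 0 < s -> - s <= t <= s -> / (2 * s) <= s / (t * t + s * s).
Proof.
  intros Hs Ht.
  apply Rle_div_r; [nra|].
  apply Rmult_le_reg_l with (2 * s); [lra|].
  replace (2 * s * (/ (2 * s) * (t * t + s * s))) with (t * t + s * s) by (field; lra). nra.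
Qed.

Lemma Cinv_fst (x y : R) : fst (/ (x, y) : C)%C = x / (x * x + y * y).
Proof. simpl; f_equal; f_equal; ring. Qed.

Lemma Cinv_snd (x y : R) : snd (/ (x, y) : C)%C = - y / (x * x + y * y).
Proof. simpl; f_equal; f_equal; ring. Qed.

(** The imaginary part is positive: on each side its integrand is s / (t^2 + s^2) with |t| <= s, at
    least 1 / (2 s), so each of the four sides of length 2 s contributes at least 1. *)
Lemma rint_inv_square_neq_0 (x y s : R) : 0 < s ->
  rint (fun w => / (w - (x, y)))%C (x - s) (x + s) (y - s) (y + s) <> 0%C.
Proof.
  intros Hs.
  set (f := fun w : C => (/ (w - (x, y)))%C).
  assert (Hf : forall w, on_bd (x - s) (x + s) (y - s) (y + s) w -> cdiff f w).
  { intros w Hw; apply (cdiff_inv (fun w => w - (x, y))%C).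
    - apply cdiff_minus; [apply cdiff_id|apply cdiff_const].
    - intros E; assert (w = (x, y)) as ->.
      { replace w with ((w - (x, y)) + (x, y))%C by ring; rewrite E; ring. }
      destruct Hw as (_ & _ & Hw); simpl in Hw; lra. }
  assert (B1 : (x + s - (x - s)) * / (2 * s) <= snd (hint f (y - s) (x - s) (x + s))).
  { apply is_CInt_snd_ge with (fun t => f (t, y - s)); [lra| |].
    - apply hint_correct; [lra|]; intros t Ht; apply Hf; unfold on_bd; simpl; intuition lra.
    - intros t Ht; unfold f.
      replace (Cminus (t, y - s) (x, y)) with ((t - x, - s) : C)
        by (apply injective_projections; simpl; ring).
      rewrite Cinv_snd.
      eapply Rle_trans; [apply (square_kernel_bound s (t - x)); lra|].
      right; f_equal; [ring|f_equal; ring]. }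
  assert (B2 : (x + s - (x - s)) * / (2 * s) <= - snd (hint f (y + s) (x - s) (x + s))).
  { replace (- snd (hint f (y + s) (x - s) (x + s)))
      with (snd (- (1) * hint f (y + s) (x - s) (x + s))%C) by (simpl; ring).
    apply is_CInt_snd_ge with (fun t => (- (1) * f (t, (y + s)%R))%C); [lra| |].
    - apply is_CInt_scal, hint_correct; [lra|]; intros t Ht; apply Hf; unfold on_bd; simpl; intuition lra.
    - intros t Ht; unfold f.
      replace (Cminus (t, y + s) (x, y)) with ((t - x, s) : C)
        by (apply injective_projections; simpl; ring).
      replace (snd (- (1) * / ((t - x)%R, s))%C) with (- snd (/ ((t - x)%R, s) : C)%C) by (simpl; ring).
      rewrite Cinv_snd.
      eapply Rle_trans; [apply (square_kernel_bound s (t - x)); lra|].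
      right; field; pose proof (Rmult_lt_0_compat s s Hs Hs); pose proof (Rle_0_sqr (t - x)) as Hq; unfold Rsqr in Hq; lra. }
  assert (B3 : (y + s - (y - s)) * / (2 * s) <= fst (vint f (x + s) (y - s) (y + s))).
  { apply is_CInt_fst_ge with (fun t => f (x + s, t)); [lra| |].
    - apply vint_correct; [lra|]; intros t Ht; apply Hf; unfold on_bd; simpl; intuition lra.
    - intros t Ht; unfold f.
      replace (Cminus (x + s, t) (x, y)) with ((s, t - y) : C)
        by (apply injective_projections; simpl; ring).
      rewrite Cinv_fst.
      eapply Rle_trans; [apply (square_kernel_bound s (t - y)); lra|].
      right; f_equal; ring. }
  assert (B4 : (y + s - (y - s)) * / (2 * s) <= - fst (vint f (x - s) (y - s) (y + s))).
  { replace (- fst (vint f (x - s) (y - s) (y + s)))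
      with (fst (- (1) * vint f (x - s) (y - s) (y + s))%C) by (simpl; ring).
    apply is_CInt_fst_ge with (fun t => (- (1) * f ((x - s)%R, t))%C); [lra| |].
    - apply is_CInt_scal, vint_correct; [lra|]; intros t Ht; apply Hf; unfold on_bd; simpl; intuition lra.
    - intros t Ht; unfold f.
      replace (Cminus (x - s, t) (x, y)) with ((- s, t - y) : C)
        by (apply injective_projections; simpl; ring).
      replace (fst (- (1) * / ((- s)%R, (t - y)%R))%C) with (- fst (/ ((- s)%R, (t - y)%R) : C)%C) by (simpl; ring).
      rewrite Cinv_fst.
      eapply Rle_trans; [apply (square_kernel_bound s (t - y)); lra|].
      right; field; pose proof (Rmult_lt_0_compat s s Hs Hs); pose proof (Rle_0_sqr (t - y)) as Hq; unfold Rsqr in Hq; lra. }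
  replace ((x + s - (x - s)) * / (2 * s)) with 1 in B1, B2 by (field; lra).
  replace ((y + s - (y - s)) * / (2 * s)) with 1 in B3, B4 by (field; lra).
  intros E; apply (f_equal snd) in E; unfold rint in E.
  set (h1 := hint _ _ _ _) in *; set (h2 := hint _ (y + s) _ _) in *.
  set (v1 := vint _ _ _ _) in *; set (v2 := vint _ (x - s) _ _) in *.
  clearbody h1 h2 v1 v2; simpl in E; lra.
Qed.

(* Cauchy's formula reads f = I f / I 1, where I g z is the integral of
   g w / (w - z) over the boundary; both integrals are twice differentiable in z,
   and the value 2 pi i of I 1 is not needed, only that it is nonzero at the
   centre. *)
Lemma cdiff_derive_square f (x y s : R) : 0 < s ->
  rdiff f (x - s) (x + s) (y - s) (y + s) -> cdiff (C_derive f) (x, y).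
Proof.
  intros Hs Hf.
  set (z0 := (x, y) : C).
  set (a := x - s) in *; set (b := x + s) in *; set (c := y - s) in *; set (d := y + s) in *.
  assert (Hab : a <= b) by (unfold a, b; lra).
  assert (Hcd : c <= d) by (unfold c, d; lra).
  assert (Hfb : forall w, on_bd a b c d w -> cdiff f w) by (intros w (? & ? & _); now apply Hf).
  destruct (rdiff_bounded f a b c d Hab Hcd Hf) as [M HM].
  assert (HMb : forall w, on_bd a b c d w -> Cmod (f w) <= M) by (intros w (? & ? & _); now apply HM).
  assert (Hfar : forall z, Cmod (z - z0) < s / 2 -> forall w, on_bd a b c d w -> s / 2 <= Cmod (w - z)).
  { intros z Hz w (Hw1 & Hw2 & Hw).
    assert (s <= Cmod (w - z0)).
    { pose proof (fst_le_Cmod (w - z0)%C) as H1; pose proof (snd_le_Cmod (w - z0)%C) as H2.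
      simpl in H1, H2; unfold a, b, c, d in Hw.
      pose proof (Rle_abs (fst w + - x)); pose proof (Rle_abs (- (fst w + - x))).
      pose proof (Rle_abs (snd w + - y)); pose proof (Rle_abs (- (snd w + - y))).
      rewrite !Rabs_Ropp in *. lra. }
    pose proof (Cmod_triangle_rev (w - z0) (w - z)) as Ht.
    replace (w - z0 - (w - z))%C with (z - z0)%C in Ht by ring; lra. }
  assert (Hin : forall z, Cmod (z - z0) < s / 2 -> a < fst z < b /\ c < snd z < d).
  { intros z Hz.
    pose proof (fst_le_Cmod (z - z0)%C) as H1; pose proof (snd_le_Cmod (z - z0)%C) as H2.
    simpl in H1, H2; unfold a, b, c, d.
    pose proof (Rle_abs (fst z + - x)); pose proof (Rle_abs (- (fst z + - x))).
    pose proof (Rle_abs (snd z + - y)); pose proof (Rle_abs (- (snd z + - y))).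
    rewrite !Rabs_Ropp in *. lra. }
  pose (I := fun (g : C -> C) k z => rint (fun w => g w * (/ (w - z)) ^ k)%C a b c d).
  pose (one := fun _ : C => RtoC 1).
  assert (H1b : forall w, on_bd a b c d w -> cdiff one w) by (intros; apply cdiff_const).
  assert (H1M : forall w, on_bd a b c d w -> Cmod (one w) <= 1) by (intros; unfold one; rewrite Cmod_1; lra).
  assert (Hs2 : 0 < s / 2) by lra.
  assert (Hf1 : forall z, Cmod (z - z0) < s / 2 -> cderiv (I f 1%nat) z (I f 2%nat z)).
  { intros z Hz; exact (cauchy_kernel_deriv1 f a b c d M (s / 2) z Hab Hcd Hfb HMb Hs2 (Hfar z Hz)). }
  assert (Hf2 : forall z, Cmod (z - z0) < s / 2 -> cdiff (I f 2%nat) z).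
  { intros z Hz; eexists; exact (cauchy_kernel_deriv2 f a b c d M (s / 2) z Hab Hcd Hfb HMb Hs2 (Hfar z Hz)). }
  assert (Hw1 : forall z, Cmod (z - z0) < s / 2 -> cderiv (I one 1%nat) z (I one 2%nat z)).
  { intros z Hz; exact (cauchy_kernel_deriv1 one a b c d 1 (s / 2) z Hab Hcd H1b H1M Hs2 (Hfar z Hz)). }
  assert (Hw2 : forall z, Cmod (z - z0) < s / 2 -> cdiff (I one 2%nat) z).
  { intros z Hz; eexists; exact (cauchy_kernel_deriv2 one a b c d 1 (s / 2) z Hab Hcd H1b H1M Hs2 (Hfar z Hz)). }
  assert (Hinv : forall z w, Cmod (z - z0) < s / 2 -> on_bd a b c d w -> cdiff (fun w => (/ (w - z)))%C w).
  { intros z w Hz Hw; apply (cdiff_inv (fun w => w - z)%C).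
    - apply cdiff_minus; [apply cdiff_id|apply cdiff_const].
    - apply Cmod_gt_0; pose proof (Hfar z Hz w Hw); lra. }
  assert (HI1 : forall z, Cmod (z - z0) < s / 2 ->
     I one 1%nat z = rint (fun w => / (w - z))%C a b c d).
  { intros z Hz; unfold I; symmetry; apply rint_ext; auto.
    intros w Hw; unfold one; simpl; ring. }
  assert (Hrep : forall z, Cmod (z - z0) < s / 2 -> I f 1%nat z = (f z * I one 1%nat z)%C).
  { intros z Hz; rewrite HI1 by exact Hz.
    rewrite <- cauchy_rint by (try apply Hin; auto).
    unfold I; symmetry; apply rint_ext; auto.
    - intros w Hw; apply cdiff_mult; auto.
    - intros w Hw; simpl; ring. }
  assert (Hz0 : Cmod (z0 - z0) < s / 2)
    by (replace (z0 - z0)%C with (RtoC 0) by ring; rewrite Cmod_0; lra).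
  assert (HW0 : I one 1%nat z0 <> 0%C) by (rewrite HI1 by exact Hz0; now apply rint_inv_square_neq_0).
  destruct (cdiff_continuous (I one 1%nat) z0 (ex_intro _ _ (Hw1 z0 Hz0))
    (Cmod (I one 1%nat z0))) as [e [He HWc]]; [now apply Cmod_gt_0|].
  assert (HW : forall z, Cmod (z - z0) < e -> I one 1%nat z <> 0%C).
  { intros z Hz E; specialize (HWc z Hz); rewrite E in HWc.
    replace (0 - I one 1%nat z0)%C with (- I one 1%nat z0)%C in HWc by ring.
    rewrite Cmod_opp in HWc; lra. }
  set (r := Rmin (s / 2) e).
  assert (Hr : 0 < r /\ r <= s / 2 /\ r <= e).
  { unfold r; repeat split; [apply Rmin_glb_lt; lra|apply Rmin_l|apply Rmin_r]. }
  (* The quotient rule applied to f = I f 1 / I one 1. All four integrals on the right are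
     differentiable at z0, hence so is the derivative of f. *)
  assert (Hd : forall z, Cmod (z - z0) < r -> C_derive f z =
    ((I f 2%nat z * I one 1%nat z - I f 1%nat z * I one 2%nat z) * / (I one 1%nat z * I one 1%nat z))%C).
  { intros z Hz; apply cderiv_unique.
    apply cderiv_ext_loc with (fun z => I f 1%nat z * / I one 1%nat z)%C (r - Cmod (z - z0)); [lra| |].
    - intros w Hw.
      assert (Hw' : Cmod (w - z0) < r).
      { replace (w - z0)%C with ((w - z) + (z - z0))%C by ring.
        eapply Rle_lt_trans; [apply Cmod_triangle|lra]. }
      rewrite Hrep by lra; field; apply HW; lra.
    - eapply cderiv_eq.
      + apply cderiv_mult; [apply Hf1; lra|].
        apply (cderiv_comp (fun w => / w)%C (I one 1%nat)); [apply cderiv_inv, HW; lra|apply Hw1; lra].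
      + simpl; field; apply HW; lra. }
  apply cdiff_ext_loc with (fun z =>
    ((I f 2%nat z * I one 1%nat z - I f 1%nat z * I one 2%nat z) * / (I one 1%nat z * I one 1%nat z))%C) r;
    [lra| |].
  - intros z Hz; symmetry; now apply Hd.
  - assert (cdiff (I f 1%nat) z0) by (eexists; now apply Hf1).
    assert (cdiff (I one 1%nat) z0) by (eexists; now apply Hw1).
    apply cdiff_mult.
    + apply cdiff_minus; apply cdiff_mult; auto.
    + apply (cdiff_inv (fun z => I one 1%nat z * I one 1%nat z)%C); [apply cdiff_mult; auto|].
      now apply Cmult_neq_0.
Qed.

Lemma holo_cdiff f z : holo f -> UHP z -> cdiff f z.
Proof. intros Hf Hz; now apply cdiff_ex_derive, Hf. Qed.

Lemma cdiff_holo f : (forall z, UHP z -> cdiff f z) -> holo f.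
Proof. intros Hf z Hz; now apply cdiff_ex_derive, Hf. Qed.

Lemma holo_C_derive f : holo f -> holo (C_derive f).
Proof.
  intros Hf; apply cdiff_holo; intros [x y] Hz; unfold UHP in Hz; simpl in Hz.
  (* The square around (x, y) of half side y / 2 stays in the half plane. *)
  apply cdiff_derive_square with (y / 2); [lra|].
  intros w Hw1 Hw2; apply holo_cdiff; [exact Hf|]; unfold UHP, Im; lra.
Qed.

(** * Power series in the nome *)

Definition cexp (z : C) : C := (exp (fst z) * cos (snd z), exp (fst z) * sin (snd z)).

Lemma cexp_plus (z w : C) : cexp (z + w) = (cexp z * cexp w)%C.
Proof.
  unfold cexp; apply injective_projections; simpl;
    rewrite exp_plus; [rewrite cos_plus|rewrite sin_plus]; ring.
Qed.

Lemma Cmod_cexp (z : C) : Cmod (cexp z) = exp (fst z).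
Proof.
  unfold cexp, Cmod; simpl.
  replace (exp (fst z) * cos (snd z) * (exp (fst z) * cos (snd z) * 1) +
           exp (fst z) * sin (snd z) * (exp (fst z) * sin (snd z) * 1))
    with (exp (fst z) * exp (fst z) * (Rsqr (sin (snd z)) + Rsqr (cos (snd z))))
    by (unfold Rsqr; ring).
  rewrite sin2_cos2, Rmult_1_r; apply sqrt_square; left; apply exp_pos.
Qed.

Lemma derivable_pt_lim_remainder f x l : derivable_pt_lim f x l ->
  forall eps, 0 < eps -> exists d, 0 < d /\ forall h, Rabs h < d ->
    Rabs (f (x + h) - f x - l * h) <= eps * Rabs h.
Proof.
  intros H eps Heps; destruct (H eps Heps) as [d Hd].
  exists d; split; [apply cond_pos|]; intros h Hh.
  destruct (Req_dec h 0) as [->|Hh0].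
  - rewrite Rplus_0_r; replace (f x - f x - l * 0) with 0 by ring.
    rewrite Rabs_R0; lra.
  - specialize (Hd h Hh0 Hh).
    replace (f (x + h) - f x - l * h) with (((f (x + h) - f x) / h - l) * h) by (field; auto).
    rewrite Rabs_mult; apply Rmult_le_compat_r; [apply Rabs_pos|lra].
Qed.

Lemma Rabs_mult_le a b A B : Rabs a <= A -> Rabs b <= B -> Rabs (a * b) <= A * B.
Proof. intros; rewrite Rabs_mult; apply Rmult_le_compat; auto using Rabs_pos. Qed.

Lemma cderiv_cexp_0 : cderiv cexp 0%C 1%C.
Proof.
  intros eps Heps.
  (* For w = u + i v and h = |w|, the real remainder (e^u - 1 - u) cos v + (1 + u) (cos v - 1) is at
     most 3 e h and the imaginary one, (e^u - 1) sin v + (sin v - v), at most 5 e h; this explains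
     the 8. *)
  set (e := Rmin 1 (eps / 8)).
  assert (He : 0 < e /\ e <= 1 /\ e <= eps / 8).
  { unfold e; repeat split; [apply Rmin_glb_lt; lra|apply Rmin_l|apply Rmin_r]. }
  clearbody e.
  destruct (derivable_pt_lim_remainder exp 0 1 derivable_pt_lim_exp_0 e (proj1 He)) as [d1 [Hd1 H1]].
  pose proof (derivable_pt_lim_cos 0) as Hc; rewrite sin_0, Ropp_0 in Hc.
  destruct (derivable_pt_lim_remainder cos 0 0 Hc e (proj1 He)) as [d2 [Hd2 H2]].
  pose proof (derivable_pt_lim_sin 0) as Hs; rewrite cos_0 in Hs.
  destruct (derivable_pt_lim_remainder sin 0 1 Hs e (proj1 He)) as [d3 [Hd3 H3]].
  exists (Rmin e (Rmin d1 (Rmin d2 d3))); split.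
  { repeat apply Rmin_glb_lt; lra. }
  intros w; replace (w - 0)%C with w by ring; intros Hw.
  assert (Hw' : Cmod w < e /\ Cmod w < d1 /\ Cmod w < d2 /\ Cmod w < d3).
  { pose proof (Rmin_l e (Rmin d1 (Rmin d2 d3))); pose proof (Rmin_r e (Rmin d1 (Rmin d2 d3))).
    pose proof (Rmin_l d1 (Rmin d2 d3)); pose proof (Rmin_r d1 (Rmin d2 d3)).
    pose proof (Rmin_l d2 d3); pose proof (Rmin_r d2 d3); repeat split; lra. }
  pose proof (fst_le_Cmod w) as Hu; pose proof (snd_le_Cmod w) as Hv.
  destruct w as [u v]; simpl in Hu, Hv.
  specialize (H1 u ltac:(lra)); specialize (H2 v ltac:(lra)); specialize (H3 v ltac:(lra)).
  rewrite Rplus_0_l in H1, H2, H3.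
  replace (exp u - exp 0 - 1 * u) with (exp u - 1 - u) in H1 by (rewrite exp_0; ring).
  replace (cos v - cos 0 - 0 * v) with (cos v - 1) in H2 by (rewrite cos_0; ring).
  replace (sin v - sin 0 - 1 * v) with (sin v - v) in H3 by (rewrite sin_0; ring).
  set (h := Cmod (u, v)) in *.
  eapply Rle_trans; [apply Cmod_le_abs|].
  assert (E1 : fst (cexp (u, v) - cexp 0 - 1 * (u, v))%C
    = (exp u - 1 - u) * cos v + (1 + u) * (cos v - 1)).
  { unfold cexp; simpl; rewrite exp_0, cos_0; ring. }
  assert (E2 : snd (cexp (u, v) - cexp 0 - 1 * (u, v))%C
    = (exp u - 1) * sin v + (sin v - v)).
  { unfold cexp; simpl; rewrite exp_0, sin_0; ring. }
  rewrite E1, E2.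
  pose proof (Rabs_pos u); pose proof (Rabs_pos v).
  assert (Rabs (cos v) <= 1) by (apply Rabs_le; apply COS_bound).
  assert (Rabs (1 + u) <= 2) by (eapply Rle_trans; [apply Rabs_triang|]; rewrite Rabs_R1; lra).
  assert (Hh : Rabs u <= h /\ Rabs v <= h /\ h < e) by (repeat split; lra).
  assert (B1 : e * Rabs u <= 1 * Rabs u) by (apply Rmult_le_compat_r; lra).
  assert (B2 : e * Rabs v <= 1 * Rabs v) by (apply Rmult_le_compat_r; lra).
  assert (B3 : e * Rabs u <= e * h) by (apply Rmult_le_compat_l; lra).
  assert (B4 : e * Rabs v <= e * h) by (apply Rmult_le_compat_l; lra).
  assert (A1 : Rabs ((exp u - 1 - u) * cos v) <= e * h).
  { eapply Rle_trans; [eapply Rabs_mult_le; eassumption|]; lra. }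
  assert (A2 : Rabs ((1 + u) * (cos v - 1)) <= 2 * (e * h)).
  { eapply Rle_trans; [eapply Rabs_mult_le; eassumption|]; lra. }
  assert (A3 : Rabs (exp u - 1) <= 2 * e).
  { replace (exp u - 1) with ((exp u - 1 - u) + u) by ring.
    eapply Rle_trans; [apply Rabs_triang|]; lra. }
  assert (A4 : Rabs (sin v) <= 2 * h).
  { replace (sin v) with ((sin v - v) + v) by ring.
    eapply Rle_trans; [apply Rabs_triang|]; lra. }
  assert (A5 : Rabs ((exp u - 1) * sin v) <= 4 * (e * h)).
  { eapply Rle_trans; [eapply Rabs_mult_le; eassumption|]; lra. }
  pose proof (Rabs_triang ((exp u - 1 - u) * cos v) ((1 + u) * (cos v - 1))).
  pose proof (Rabs_triang ((exp u - 1) * sin v) (sin v - v)).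
  assert (e * h <= eps / 8 * h) by (apply Rmult_le_compat_r; lra). lra.
Qed.

Lemma cderiv_cexp (z : C) : cderiv cexp z (cexp z).
Proof.
  apply cderiv_ext with (fun w => cexp z * cexp (w - z))%C.
  - intros w; rewrite <- cexp_plus; f_equal; ring.
  - eapply cderiv_eq.
    + apply cderiv_scal, (cderiv_comp cexp (fun w => w - z)%C).
      * replace (z - z)%C with (RtoC 0) by ring; apply cderiv_cexp_0.
      * apply cderiv_minus; [apply cderiv_id|apply cderiv_const].
    + ring.
Qed.

Definition nome (z : C) : C := cexp (RtoC (2 * PI) * Ci * z).

Lemma qpow_nome n z : qpow n z = (nome z ^ n)%C.
Proof.
  induction n as [|n IH].
  - unfold qpow; apply injective_projections; simpl;
      rewrite !Rmult_0_r, !Rmult_0_l, Ropp_0, exp_0; [rewrite cos_0|rewrite sin_0]; ring.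
  - rewrite Cpow_S, <- IH; unfold nome, qpow, cexp, Re, Im; rewrite S_INR.
    set (x := fst z); set (y := snd z).
    replace (fst (RtoC (2 * PI) * Ci * z)%C) with (- (2 * PI * y)) by (unfold y; simpl; ring).
    replace (snd (RtoC (2 * PI) * Ci * z)%C) with (2 * PI * x) by (unfold x; simpl; ring).
    replace (- (2 * PI * (INR n + 1) * y)) with (- (2 * PI * y) + - (2 * PI * INR n * y)) by ring.
    replace (2 * PI * (INR n + 1) * x) with (2 * PI * x + 2 * PI * INR n * x) by ring.
    rewrite exp_plus, cos_plus, sin_plus.
    apply injective_projections; simpl; ring.
Qed.

Lemma Cmod_nome z : Cmod (nome z) = exp (- (2 * PI * Im z)).
Proof. unfold nome; rewrite Cmod_cexp; f_equal; unfold Im; simpl; ring. Qed.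

Lemma Cmod_nome_lt_1 z : UHP z -> Cmod (nome z) < 1.
Proof.
  intros Hz; rewrite Cmod_nome, <- exp_0; apply exp_increasing.
  pose proof PI_RGT_0; unfold UHP in Hz; nra.
Qed.

Lemma cderiv_nome z : cderiv nome z (RtoC (2 * PI) * Ci * nome z)%C.
Proof.
  eapply cderiv_eq.
  - apply (cderiv_comp cexp (fun z => RtoC (2 * PI) * Ci * z)%C); [apply cderiv_cexp|].
    apply cderiv_scal, cderiv_id.
  - unfold nome; ring.
Qed.

Definition is_CSeries (u : nat -> C) (l : C) : Prop :=
  is_series (fun n => fst (u n)) (fst l) /\ is_series (fun n => snd (u n)) (snd l).

Lemma is_CSeries_unique u l : is_CSeries u l -> CSeries u = l.
Proof.
  intros [H1 H2]; apply injective_projections; simpl; now apply is_series_unique.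
Qed.

Lemma is_CSeries_plus u v l m : is_CSeries u l -> is_CSeries v m ->
  is_CSeries (fun n => u n + v n)%C (l + m)%C.
Proof.
  intros [H1 H2] [H3 H4]; split.
  - exact (is_series_plus (V:=R_NormedModule) _ _ _ _ H1 H3).
  - exact (is_series_plus (V:=R_NormedModule) _ _ _ _ H2 H4).
Qed.

Lemma is_CSeries_scal (k : C) u l : is_CSeries u l ->
  is_CSeries (fun n => k * u n)%C (k * l)%C.
Proof.
  intros [H1 H2]; split; simpl.
  - apply (is_series_minus (V:=R_NormedModule) (fun n => fst k * fst (u n)) (fun n => snd k * snd (u n)));
      now apply (is_series_scal (V:=R_NormedModule)).
  - apply (is_series_plus (V:=R_NormedModule) (fun n => fst k * snd (u n)) (fun n => snd k * fst (u n)));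
      now apply (is_series_scal (V:=R_NormedModule)).
Qed.

Lemma is_CSeries_ext u v l : (forall n, u n = v n) -> is_CSeries u l -> is_CSeries v l.
Proof.
  intros E [H1 H2]; split; [apply is_series_ext with (fun n => fst (u n))|
    apply is_series_ext with (fun n => snd (u n))]; auto; intros n; now rewrite E.
Qed.

Lemma CSeries_correct_abs u (s : nat -> R) :
  (forall n, Cmod (u n) <= s n) -> ex_series s -> is_CSeries u (CSeries u).
Proof.
  intros Hs He; split; apply Series_correct;
    apply (ex_series_le (V:=R_CompleteNormedModule)) with s; auto; intros n;
    (eapply Rle_trans; [|apply Hs]); [apply fst_le_Cmod|apply snd_le_Cmod].
Qed.

Lemma is_CSeries_Cmod_le u l (s : nat -> R) :
  is_CSeries u l -> (forall n, Cmod (u n) <= s n) -> ex_series s -> Cmod l <= 2 * Series s.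
Proof.
  intros [H1 H2] Hs He.
  assert (B : forall a : nat -> R, (forall n, Rabs (a n) <= s n) -> Rabs (Series a) <= Series s).
  { intros a Ha; eapply Rle_trans; [apply Series_Rabs|].
    - apply (ex_series_le (V:=R_CompleteNormedModule)) with s; auto.
      intros n; unfold norm; simpl; unfold abs; simpl; now rewrite Rabs_Rabsolu.
    - apply Series_le; auto; intros n; split; [apply Rabs_pos|auto]. }
  eapply Rle_trans; [apply Cmod_le_abs|].
  rewrite <- (is_series_unique _ _ H1), <- (is_series_unique _ _ H2).
  pose proof (B (fun n => fst (u n)) (fun n => Rle_trans _ _ _ (fst_le_Cmod _) (Hs n))).
  pose proof (B (fun n => snd (u n)) (fun n => Rle_trans _ _ _ (snd_le_Cmod _) (Hs n))).
  unfold Re, Im in *; lra.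
Qed.

(** This condition holds for divisor sums, passes from a_n to n a_n as differentiation demands, and
    gives absolute convergence on the unit disc. The base [INR n + 1] keeps the majorant nonzero at
    n = 0, as the ratio test requires. *)
Definition polygrowth (a : nat -> R) : Prop :=
  exists M p, forall n, Rabs (a n) <= M * (INR n + 1) ^ p.

Lemma INR_pos1 n : 1 <= INR n + 1.
Proof. pose proof (pos_INR n); lra. Qed.

Lemma ex_series_pow_geom p r : 0 < r < 1 -> ex_series (fun n => (INR n + 1) ^ p * r ^ n).
Proof.
  intros Hr.
  assert (Hpos : forall n, 0 < (INR n + 1) ^ p * r ^ n).
  { intros n; pose proof (INR_pos1 n); apply Rmult_lt_0_compat; apply pow_lt; lra. }
  apply ex_series_ext with (fun n => Rabs ((INR n + 1) ^ p * r ^ n)).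
  { intros n; apply Rabs_pos_eq; left; apply Hpos. }
  apply ex_series_DAlembert with r; [lra|intros n; apply Rgt_not_eq, Hpos|].
  apply is_lim_seq_ext with (fun n => (1 + / (INR n + 1)) ^ p * r).
  { intros n; pose proof (Hpos n); pose proof (Hpos (S n)).
    rewrite Rabs_pos_eq by (left; now apply Rdiv_lt_0_compat).
    pose proof (INR_pos1 n).
    assert (r ^ n <> 0) by (apply pow_nonzero; lra).
    assert ((INR n + 1) ^ p <> 0) by (apply pow_nonzero; lra).
    rewrite S_INR.
    replace (INR n + 1 + 1) with ((1 + / (INR n + 1)) * (INR n + 1)) by (field; lra).
    rewrite Rpow_mult_distr; simpl; field; auto. }
  assert (Hinv : is_lim_seq (fun n => / (INR n + 1)) 0).
  { replace (Finite 0) with (Rbar_inv p_infty) by reflexivity.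
    apply is_lim_seq_inv; [|discriminate].
    apply is_lim_seq_ext with (fun n => INR (S n)); [intros n; apply S_INR|].
    apply -> is_lim_seq_incr_1; apply is_lim_seq_INR. }
  assert (H1 : is_lim_seq (fun n => 1 + / (INR n + 1)) 1).
  { replace (Finite 1) with (Finite (1 + 0)) by (f_equal; ring).
    apply is_lim_seq_plus'; [apply is_lim_seq_const|exact Hinv]. }
  assert (H2 : is_lim_seq (fun n => (1 + / (INR n + 1)) ^ p) 1).
  { induction p as [|p IH].
    - apply is_lim_seq_const.
    - simpl; replace (Finite 1) with (Finite (1 * 1)) by (f_equal; ring).
      apply is_lim_seq_mult'; [exact H1|].
      apply IH; intros n; pose proof (INR_pos1 n); apply Rmult_lt_0_compat; apply pow_lt; lra. }
  replace (Finite r) with (Finite (1 * r)) by (f_equal; ring).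
  apply is_lim_seq_mult'; [exact H2|apply is_lim_seq_const].
Qed.

Lemma polygrowth_ex_series a k r : polygrowth a -> 0 < r < 1 ->
  ex_series (fun n => Rabs (a n) * (INR n) ^ k * r ^ n).
Proof.
  intros [M [p H]] Hr.
  apply (ex_series_le (V:=R_CompleteNormedModule))
    with (fun n => scal M ((INR n + 1) ^ (p + k) * r ^ n)).
  - intros n; pose proof (pos_INR n).
    assert (0 <= r ^ n) by (apply pow_le; lra).
    assert (Hk : 0 <= INR n ^ k <= (INR n + 1) ^ k).
    { split; [now apply pow_le|apply pow_incr; lra]. }
    change (Rabs (Rabs (a n) * INR n ^ k * r ^ n) <= M * ((INR n + 1) ^ (p + k) * r ^ n)).
    rewrite Rabs_pos_eq.
    + rewrite pow_add, <- !Rmult_assoc; apply Rmult_le_compat_r; auto.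
      apply Rmult_le_compat; try apply Hk; auto; apply Rabs_pos.
    + repeat apply Rmult_le_pos; auto; [apply Rabs_pos|apply Hk].
  - apply (ex_series_scal (V:=R_NormedModule)), ex_series_pow_geom; auto.
Qed.

Lemma polygrowth_mul_n a : polygrowth a -> polygrowth (fun n => INR n * a n).
Proof.
  intros [M [p H]]; exists M, (S p); intros n; rewrite Rabs_mult.
  pose proof (pos_INR n); rewrite Rabs_pos_eq by auto.
  specialize (H n); pose proof (Rabs_pos (a n)); simpl.
  replace (M * ((INR n + 1) * (INR n + 1) ^ p)) with ((INR n + 1) * (M * (INR n + 1) ^ p)) by ring.
  apply Rmult_le_compat; lra.
Qed.

Definition psum (a : nat -> R) (q : C) : C := CSeries (fun n => RtoC (a n) * q ^ n)%C.

Lemma psum_abs a q : polygrowth a -> Cmod q < 1 -> exists s, ex_series s /\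
  forall n, Cmod (RtoC (a n) * q ^ n) <= s n.
Proof.
  intros Ha Hq.
  pose proof (Cmod_ge_0 q).
  exists (fun n => Rabs (a n) * (INR n) ^ 0 * ((Cmod q + 1) / 2) ^ n); split.
  - apply polygrowth_ex_series; auto; lra.
  - intros n; rewrite Cmod_mult, Cmod_R, Cmod_pow; simpl; rewrite Rmult_1_r.
    apply Rmult_le_compat_l; [apply Rabs_pos|]; apply pow_incr; lra.
Qed.

Lemma psum_correct a q : polygrowth a -> Cmod q < 1 ->
  is_CSeries (fun n => RtoC (a n) * q ^ n)%C (psum a q).
Proof.
  intros Ha Hq; destruct (psum_abs a q Ha Hq) as [s [H1 H2]].
  now apply CSeries_correct_abs with s.
Qed.

(** The estimate n^2 r^(n-2) |h|^2 for the second-order remainder, multiplied by r^2 to avoid the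
    exponent n - 2. The remainders satisfy T_(n+1) = (q + h) T_n + n q^(n-1) h^2, and n^2 + n <= (n
    + 1)^2. *)
Lemma pow_remainder (q h : C) r n : 0 < r -> Cmod q <= r -> Cmod (q + h) <= r ->
  r * r * Cmod ((q + h) ^ n - q ^ n - RtoC (INR n) * q ^ (pred n) * h)
   <= INR n * INR n * r ^ n * (Cmod h * Cmod h).
Proof.
  intros Hr Hq Hqh.
  pose proof (Cmod_ge_0 h) as Hh.
  induction n as [|n IH].
  - simpl; replace (1 - 1 - RtoC 0 * 1 * h)%C with (RtoC 0) by ring; rewrite Cmod_0; lra.
  - set (T := ((q + h) ^ n - q ^ n - RtoC (INR n) * q ^ pred n * h)%C) in *.
    assert (E : ((q + h) ^ S n - q ^ S n - RtoC (INR (S n)) * q ^ pred (S n) * h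
       = (q + h) * T + RtoC (INR n) * (q ^ pred n * (h * h)))%C).
    { unfold T; rewrite S_INR, RtoC_plus, !Cpow_S; simpl pred.
      destruct n as [|n]; [simpl; ring|]; simpl pred; rewrite !Cpow_S; ring. }
    rewrite E.
    assert (Hp : r * r * (INR n * (Cmod q ^ pred n * (Cmod h * Cmod h)))
       <= INR n * r ^ S n * (Cmod h * Cmod h)).
    { destruct n as [|n]; [simpl; lra|]; simpl pred.
      assert (Cmod q ^ n <= r ^ n) by (apply pow_incr; split; [apply Cmod_ge_0|auto]).
      pose proof (pos_INR (S n)).
      replace (r * r * (INR (S n) * (Cmod q ^ n * (Cmod h * Cmod h))))
        with ((INR (S n) * (r * r) * (Cmod h * Cmod h)) * Cmod q ^ n) by ring.
      replace (INR (S n) * r ^ S (S n) * (Cmod h * Cmod h))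
        with ((INR (S n) * (r * r) * (Cmod h * Cmod h)) * r ^ n) by (simpl; ring).
      apply Rmult_le_compat_l; auto; repeat apply Rmult_le_pos; lra. }
    apply Rle_trans with (r * (r * r * Cmod T) + r * r * (INR n * (Cmod q ^ pred n * (Cmod h * Cmod h)))).
    + eapply Rle_trans; [apply Rmult_le_compat_l; [nra|apply Cmod_triangle]|].
      rewrite !Cmod_mult, Cmod_R, Rabs_pos_eq, Cmod_pow by apply pos_INR.
      assert (Cmod (q + h) * Cmod T <= r * Cmod T) by (apply Rmult_le_compat_r; auto; apply Cmod_ge_0).
      assert (0 < r * r) by nra. nra.
    + assert (r * (r * r * Cmod T) <= r * (INR n * INR n * r ^ n * (Cmod h * Cmod h)))
        by (apply Rmult_le_compat_l; lra).
      rewrite S_INR.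
      assert (0 <= r ^ S n * (Cmod h * Cmod h)) by (apply Rmult_le_pos; [apply pow_le; lra|nra]).
      pose proof (pos_INR n); simpl in *; nra.
Qed.

(** The remainders of [pow_remainder] are summed at a radius r between |q| and 1, against the
    convergent series of |a_n| n^2 r^n. At n = 0 the truncated exponent [pred n] is harmless because
    its coefficient is 0. *)
Lemma psum_cderiv a q : polygrowth a -> Cmod q < 1 ->
  cderiv (psum a) q (CSeries (fun n => RtoC (INR n * a n) * q ^ pred n)%C).
Proof.
  intros Ha Hq.
  pose proof (Cmod_ge_0 q) as Hq0.
  set (r := (Cmod q + 1) / 2).
  assert (Hr : 0 < r < 1 /\ Cmod q < r) by (unfold r; lra).
  set (s := fun n => Rabs (a n) * INR n ^ 2 * r ^ n).
  assert (Hs : ex_series s) by (apply polygrowth_ex_series; tauto).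
  set (s' := fun n => / r * (Rabs (a n) * INR n ^ 1 * r ^ n)).
  assert (Hs' : ex_series s').
  { apply (ex_series_scal (V:=R_NormedModule)), polygrowth_ex_series; tauto. }
  assert (HD : is_CSeries (fun n => RtoC (INR n * a n) * q ^ pred n)%C
                (CSeries (fun n => RtoC (INR n * a n) * q ^ pred n)%C)).
  { apply CSeries_correct_abs with s'; auto; intros n; unfold s'.
    rewrite Cmod_mult, Cmod_R, Rabs_mult, Cmod_pow, (Rabs_pos_eq (INR n)) by apply pos_INR.
    destruct n as [|n]; [simpl; lra|]; simpl pred.
    replace (/ r * (Rabs (a (S n)) * INR (S n) ^ 1 * r ^ S n))
      with (INR (S n) * Rabs (a (S n)) * r ^ n) by (simpl; field; lra).
    apply Rmult_le_compat_l; [apply Rmult_le_pos; [apply pos_INR|apply Rabs_pos]|].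
    apply pow_incr; lra. }
  apply cderiv_quadratic with (d := r - Cmod q) (M := 2 * (/ (r * r) * Series s)); [lra|].
  intros w Hw.
  set (h := (w - q)%C) in *.
  assert (Ew : w = (q + h)%C) by (unfold h; ring).
  assert (Hwr : Cmod (q + h) < r) by (eapply Rle_lt_trans; [apply Cmod_triangle|lra]).
  assert (HR : is_CSeries (fun n => RtoC (a n) *
      ((q + h) ^ n - q ^ n - RtoC (INR n) * q ^ pred n * h))%C
      (psum a w - psum a q - CSeries (fun n => RtoC (INR n * a n) * q ^ pred n) * h)%C).
  { replace (psum a w - psum a q - CSeries (fun n => RtoC (INR n * a n) * q ^ pred n) * h)%C
      with (psum a w + (- (1) * psum a q + - h * CSeries (fun n => RtoC (INR n * a n) * q ^ pred n)))%C by ring.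
    eapply is_CSeries_ext; [|apply is_CSeries_plus; [apply psum_correct|apply is_CSeries_plus;
      [apply is_CSeries_scal, psum_correct|apply is_CSeries_scal, HD]]]; auto.
    - intros n; simpl; rewrite Ew, RtoC_mult; ring.
    - rewrite Ew; lra. }
  replace (2 * (/ (r * r) * Series s) * (Cmod h * Cmod h))
    with (2 * Series (fun n => (Cmod h * Cmod h * / (r * r)) * s n)).
  - eapply is_CSeries_Cmod_le; [exact HR| |apply (ex_series_scal (V:=R_NormedModule)); exact Hs].
    intros n; cbv beta; rewrite Cmod_mult, Cmod_R; unfold s.
    pose proof (pow_remainder q h r n ltac:(lra) ltac:(lra) ltac:(lra)) as HP.
    replace (Cmod h * Cmod h * / (r * r) * (Rabs (a n) * INR n ^ 2 * r ^ n))
      with (Rabs (a n) * (/ (r * r) * (INR n * INR n * r ^ n * (Cmod h * Cmod h)))) by ring.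
    apply Rmult_le_compat_l; [apply Rabs_pos|].
    apply Rmult_le_reg_l with (r * r); [nra|].
    rewrite <- (Rmult_assoc (r * r) (/ (r * r))), Rinv_r by nra. lra.
  - rewrite Series_scal_l; ring.
Qed.

(** The chain rule produces 2 pi i q d/dq, and the factor q raises q^(n-1) to q^n. After the
    division by 2 pi i in [qderiv], the n-th coefficient is multiplied by n. *)
Lemma psum_nome_cderiv a z : polygrowth a -> UHP z ->
  cderiv (fun z => psum a (nome z)) z
    (RtoC (2 * PI) * Ci * psum (fun n => INR n * a n)%R (nome z))%C.
Proof.
  intros Ha Hz; pose proof (Cmod_nome_lt_1 z Hz) as Hq.
  eapply cderiv_eq.
  - apply (cderiv_comp (psum a) nome); [now apply psum_cderiv|apply cderiv_nome].
  - rewrite <- Cmult_assoc; f_equal.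
    pose proof (psum_correct _ _ (polygrowth_mul_n a Ha) Hq) as H.
    assert (E : nome z <> 0%C).
    { apply Cmod_gt_0; rewrite Cmod_nome; apply exp_pos. }
    assert (is_CSeries (fun n => RtoC (INR n * a n) * nome z ^ pred n)%C
       (/ nome z * psum (fun n => INR n * a n)%R (nome z))%C) as HD.
    { eapply is_CSeries_ext; [|apply is_CSeries_scal, H].
      intros [|n]; simpl pred; [simpl; rewrite Rmult_0_l; ring|].
      rewrite Cpow_S; field; auto. }
    rewrite (is_CSeries_unique _ _ HD); field; auto.
Qed.

(** * Eisenstein series *)

Definition conv (a b : nat -> R) (n : nat) : R :=
  sum_f_R0 (fun k => a k * b (n - k)%nat) n.

(** Cauchy products are taken for the real series formed with the real and imaginary parts of the
    powers of q; q^n = q^k q^(n-k) recombines the four of them. *)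
Lemma psum_mult a b q : polygrowth a -> polygrowth b -> Cmod q < 1 ->
  is_CSeries (fun n => RtoC (conv a b n) * q ^ n)%C (psum a q * psum b q)%C.
Proof.
  intros Ha Hb Hq.
  assert (HR : forall c, polygrowth c ->
    is_series (fun n => c n * fst (q ^ n)%C) (fst (psum c q)) /\
    is_series (fun n => c n * snd (q ^ n)%C) (snd (psum c q)) /\
    ex_series (fun n => Rabs (c n * fst (q ^ n)%C)) /\
    ex_series (fun n => Rabs (c n * snd (q ^ n)%C))).
  { intros c Hc.
    destruct (psum_correct c q Hc Hq) as [H1 H2].
    destruct (psum_abs c q Hc Hq) as [s [Hs1 Hs2]].
    assert (E1 : forall n, fst (RtoC (c n) * q ^ n)%C = c n * fst (q ^ n)%C) by (intros n; simpl; ring).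
    assert (E2 : forall n, snd (RtoC (c n) * q ^ n)%C = c n * snd (q ^ n)%C) by (intros n; simpl; ring).
    repeat split.
    - eapply is_series_ext; [exact E1|exact H1].
    - eapply is_series_ext; [exact E2|exact H2].
    - apply (ex_series_le (V:=R_CompleteNormedModule)) with s; auto; intros n.
      rewrite <- E1; change (Rabs (Rabs (fst (RtoC (c n) * q ^ n)%C)) <= s n).
      rewrite Rabs_Rabsolu; eapply Rle_trans; [apply fst_le_Cmod|apply Hs2].
    - apply (ex_series_le (V:=R_CompleteNormedModule)) with s; auto; intros n.
      rewrite <- E2; change (Rabs (Rabs (snd (RtoC (c n) * q ^ n)%C)) <= s n).
      rewrite Rabs_Rabsolu; eapply Rle_trans; [apply snd_le_Cmod|apply Hs2]. }
  destruct (HR a Ha) as (A1 & A2 & A3 & A4); destruct (HR b Hb) as (B1 & B2 & B3 & B4).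
  assert (Hsplit : forall n k, (k <= n)%nat -> (q ^ n = q ^ k * q ^ (n - k))%C).
  { intros n k Hk; rewrite <- Cpow_add_r; f_equal; lia. }
  split; simpl.
  - eapply is_series_ext; [|apply (is_series_minus (V:=R_NormedModule));
      [exact (is_series_mult _ _ _ _ A1 B1 A3 B3)|exact (is_series_mult _ _ _ _ A2 B2 A4 B4)]].
    intros n; cbv beta.
    unfold minus, plus, opp; simpl.
    transitivity (fst (q ^ n)%C * conv a b n); [|ring].
    unfold conv; rewrite scal_sum.
    match goal with |- ?x + - ?y = _ => change (x - y = sum_f_R0 (fun i => a i * b (n - i)%nat * fst (q ^ n)%C) n) end.
    rewrite <- minus_sum; apply sum_eq; intros k Hk.
    rewrite (Hsplit n k Hk); simpl; ring.
  - eapply is_series_ext; [|apply (is_series_plus (V:=R_NormedModule));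
      [exact (is_series_mult _ _ _ _ A1 B2 A3 B4)|exact (is_series_mult _ _ _ _ A2 B1 A4 B3)]].
    intros n; cbv beta.
    unfold plus; simpl.
    transitivity (snd (q ^ n)%C * conv a b n); [|ring].
    unfold conv; rewrite scal_sum.
    rewrite <- plus_sum; apply sum_eq; intros k Hk.
    rewrite (Hsplit n k Hk); simpl; ring.
Qed.

Lemma sigma_bound k n : 0 <= Defs.sigma k n <= (INR n + 1) ^ S k.
Proof.
  assert (H : forall l, (forall d, In d l -> (d <= n)%nat) ->
    0 <= fold_right Rplus 0 (map (fun d => if Nat.eqb (n mod d) 0 then INR d ^ k else 0) l)
      <= INR (length l) * INR n ^ k).
  { induction l as [|d l IH]; intros Hl; [simpl; lra|].
    cbn [map fold_right length].
    specialize (IH (fun d Hd => Hl d (or_intror Hd))).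
    assert (Hd : 0 <= INR d ^ k <= INR n ^ k).
    { pose proof (pos_INR d); split; [now apply pow_le|].
      apply pow_incr; split; auto; apply le_INR, Hl; now left. }
    rewrite S_INR; destruct (Nat.eqb (n mod d) 0); lra. }
  destruct (H (seq 1 n)) as [H1 H2].
  - intros d Hd; apply in_seq in Hd; lia.
  - split; [exact H1|]; eapply Rle_trans; [exact H2|].
    rewrite length_seq; simpl; pose proof (pos_INR n).
    apply Rmult_le_compat; auto; [now apply pow_le|lra|apply pow_incr; lra].
Qed.

Definition ecoef (c : R) (k n : nat) : R := if Nat.eqb n 0 then 1 else c * Defs.sigma k n.

Lemma ecoef_growth c k : polygrowth (ecoef c k).
Proof.
  exists (Rabs c + 1), (S k); intros n; unfold ecoef.
  assert (1 <= (INR n + 1) ^ S k) by (apply pow_R1_Rle, INR_pos1).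
  pose proof (Rabs_pos c).
  destruct n as [|n]; simpl Nat.eqb; cbv iota.
  - rewrite Rabs_R1; nra.
  - rewrite Rabs_mult; destruct (sigma_bound k (S n)) as [H1 H2].
    rewrite (Rabs_pos_eq _ H1). nra.
Qed.

Lemma is_series_zero : is_series (fun _ : nat => 0) 0.
Proof.
  change (is_lim_seq (sum_n (fun _ => 0)) 0).
  apply (is_lim_seq_ext (fun _ => 0)); [|apply is_lim_seq_const].
  intros n; symmetry; rewrite sum_n_const; ring.
Qed.

Lemma is_CSeries_head : is_CSeries (fun n => if Nat.eqb n 0 then RtoC 1 else 0%C) 1%C.
Proof.
  split; simpl.
  - apply (is_series_decr_1 (V:=R_NormedModule)).
    match goal with |- is_series _ ?l => replace l with 0 by (unfold plus, opp; simpl; ring) end.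
    apply is_series_ext with (fun _ => 0); [reflexivity|apply is_series_zero].
  - apply is_series_ext with (fun _ => 0); [intros [|n]; reflexivity|apply is_series_zero].
Qed.

Lemma Eis_psum c k z : UHP z -> Eis c k z = psum (ecoef c k) (nome z).
Proof.
  intros Hz; unfold Eis, psum; symmetry; apply is_CSeries_unique.
  assert (Hs : polygrowth (Defs.sigma k)).
  { exists 1, (S k); intros n; destruct (sigma_bound k n) as [H1 H2].
    rewrite (Rabs_pos_eq _ H1), Rmult_1_l; exact H2. }
  pose proof (psum_correct _ _ Hs (Cmod_nome_lt_1 z Hz)) as H.
  set (u := fun n => (RtoC (Defs.sigma k n) * nome z ^ n)%C) in H.
  (* [seq 1 0] is empty, so the divisor sum at 0 is 0 and the series of [Eis], which begins with
     q^1, may be indexed from 0. *)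
  assert (Hu0 : u 0%nat = 0%C) by (unfold u, Defs.sigma; simpl; ring).
  assert (E : CSeries (fun n => RtoC (Defs.sigma k (S n)) * qpow (S n) z)%C = psum (Defs.sigma k) (nome z)).
  { apply is_CSeries_unique, is_CSeries_ext with (fun n => u (S n)).
    - intros n; unfold u; now rewrite qpow_nome.
    - destruct H as [H1 H2]; split.
      + apply (is_series_incr_1 (V:=R_NormedModule) (fun n => fst (u n))).
        rewrite Hu0; unfold plus; simpl; now rewrite Rplus_0_r.
      + apply (is_series_incr_1 (V:=R_NormedModule) (fun n => snd (u n))).
        rewrite Hu0; unfold plus; simpl; now rewrite Rplus_0_r. }
  rewrite E.
  eapply is_CSeries_ext; [|apply is_CSeries_plus; [apply is_CSeries_head|apply is_CSeries_scal, H]].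
  intros [|n]; unfold ecoef; simpl Nat.eqb; cbv beta iota.
  - rewrite Hu0; simpl; ring.
  - unfold u; rewrite RtoC_mult; ring.
Qed.

Lemma UHP_nbhd z w : UHP z -> Cmod (w - z) < Im z -> UHP w.
Proof.
  unfold UHP, Im; intros Hz Hw; pose proof (snd_le_Cmod (w - z)%C) as H; simpl in H.
  pose proof (Rle_abs (- (snd w + - snd z))); rewrite Rabs_Ropp in *; lra.
Qed.

Lemma cderiv_Eis c k z : UHP z ->
  cderiv (Eis c k) z
    (RtoC (2 * PI) * Ci * psum (fun n => INR n * ecoef c k n)%R (nome z))%C.
Proof.
  intros Hz.
  apply cderiv_ext_loc with (fun z => psum (ecoef c k) (nome z)) (Im z); [exact Hz| |].
  - intros w Hw; symmetry; apply Eis_psum; now apply UHP_nbhd with z.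
  - apply psum_nome_cderiv; auto; apply ecoef_growth.
Qed.

Lemma holo_Eis c k : holo (Eis c k).
Proof. apply cdiff_holo; intros z Hz; eexists; now apply cderiv_Eis. Qed.

Lemma two_pi_i_neq_0 : (RtoC (2 * PI) * Ci)%C <> 0%C.
Proof.
  apply Cmult_neq_0.
  - intros E; apply RtoC_inj in E; pose proof PI_RGT_0; lra.
  - intros E; apply (f_equal snd) in E; simpl in E; lra.
Qed.

Lemma qderiv_Eis c k z : UHP z ->
  is_CSeries (fun n => RtoC (INR n * ecoef c k n) * nome z ^ n)%C (qderiv (Eis c k) z).
Proof.
  intros Hz; unfold qderiv; rewrite (cderiv_unique _ _ _ (cderiv_Eis c k z Hz)).
  replace (RtoC (2 * PI) * Ci * psum (fun n => INR n * ecoef c k n)%R (nome z) / (RtoC (2 * PI) * Ci))%C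
    with (psum (fun n => INR n * ecoef c k n)%R (nome z)).
  - apply psum_correct; [apply polygrowth_mul_n, ecoef_growth|now apply Cmod_nome_lt_1].
  - field; split; [|intros E; apply RtoC_inj in E; pose proof PI_RGT_0; lra].
    intros E; apply (f_equal snd) in E; simpl in E; lra.
Qed.

Lemma Eis_mult c k c' k' z : UHP z ->
  is_CSeries (fun n => RtoC (conv (ecoef c k) (ecoef c' k') n) * nome z ^ n)%C
    (Eis c k z * Eis c' k' z)%C.
Proof.
  intros Hz; rewrite !Eis_psum by exact Hz.
  apply psum_mult; try apply ecoef_growth; now apply Cmod_nome_lt_1.
Qed.

Lemma Eis_series c k z : UHP z ->
  is_CSeries (fun n => RtoC (ecoef c k n) * nome z ^ n)%C (Eis c k z).
Proof.
  intros Hz; rewrite Eis_psum by exact Hz.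
  apply psum_correct; [apply ecoef_growth|now apply Cmod_nome_lt_1].
Qed.

Lemma ramanujan_E4_of_coef
  (H : forall n, 3 * (INR n * ecoef 240 3 n) = conv (ecoef (-24) 1) (ecoef 240 3) n - ecoef (-504) 5 n) z :
  UHP z -> (3 * qderiv E4 z = E2 z * E4 z - E6 z)%C.
Proof.
  intros Hz; pose proof (is_CSeries_unique _ _ (is_CSeries_scal 3 _ _ (qderiv_Eis 240 3 z Hz))) as HE.
  fold E4 in HE; rewrite <- HE.
  apply is_CSeries_unique.
  replace (E2 z * E4 z - E6 z)%C with (E2 z * E4 z + - (1) * E6 z)%C by ring.
  eapply is_CSeries_ext; [|apply is_CSeries_plus; [now apply Eis_mult|now apply is_CSeries_scal, Eis_series]].
  intros n; cbv beta; replace (3 * (RtoC (INR n * ecoef 240 3 n) * nome z ^ n))%C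
    with (RtoC (3 * (INR n * ecoef 240 3 n)) * nome z ^ n)%C by (rewrite (RtoC_mult 3); ring).
  rewrite H, RtoC_minus; ring.
Qed.

Lemma ramanujan_E6_of_coef
  (H : forall n, 2 * (INR n * ecoef (-504) 5 n)
      = conv (ecoef (-24) 1) (ecoef (-504) 5) n - conv (ecoef 240 3) (ecoef 240 3) n) z :
  UHP z -> (2 * qderiv E6 z = E2 z * E6 z - E4 z * E4 z)%C.
Proof.
  intros Hz; pose proof (is_CSeries_unique _ _ (is_CSeries_scal 2 _ _ (qderiv_Eis (-504) 5 z Hz))) as HE.
  fold E6 in HE; rewrite <- HE.
  apply is_CSeries_unique.
  replace (E2 z * E6 z - E4 z * E4 z)%C with (E2 z * E6 z + - (1) * (E4 z * E4 z))%C by ring.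
  eapply is_CSeries_ext; [|apply is_CSeries_plus; [now apply Eis_mult|now apply is_CSeries_scal, Eis_mult]].
  intros n; cbv beta; replace (2 * (RtoC (INR n * ecoef (-504) 5 n) * nome z ^ n))%C
    with (RtoC (2 * (INR n * ecoef (-504) 5 n)) * nome z ^ n)%C by (rewrite (RtoC_mult 2); ring).
  rewrite H, RtoC_minus; ring.
Qed.

(** * Convolution sums of divisor functions *)

Definition lsum {A : Type} (f : A -> R) (l : list A) : R := fold_right Rplus 0 (map f l).

Lemma lsum_ext {A} (f g : A -> R) l : (forall x, In x l -> f x = g x) -> lsum f l = lsum g l.
Proof.
  unfold lsum; induction l as [|x l IH]; intros H; simpl; [reflexivity|].
  rewrite H by (now left); rewrite IH; auto using in_cons.
Qed.

Lemma lsum_plus {A} (f g : A -> R) l : lsum (fun x => f x + g x) l = lsum f l + lsum g l.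
Proof. unfold lsum; induction l as [|x l IH]; simpl; lra. Qed.

Lemma lsum_scal {A} c (f : A -> R) l : lsum (fun x => c * f x) l = c * lsum f l.
Proof. unfold lsum; induction l as [|x l IH]; simpl; lra. Qed.

Lemma lsum_zero {A} (l : list A) : lsum (fun _ => 0) l = 0.
Proof. unfold lsum; induction l as [|x l IH]; simpl; lra. Qed.

Lemma lsum_app {A} (f : A -> R) l l' : lsum f (l ++ l') = lsum f l + lsum f l'.
Proof. unfold lsum; induction l as [|x l IH]; simpl; lra. Qed.

Lemma lsum_filter {A} (f : A -> R) p l :
  lsum f (filter p l) = lsum (fun x => if p x then f x else 0) l.
Proof.
  unfold lsum; induction l as [|x l IH]; simpl; [reflexivity|].
  destruct (p x); simpl; lra.
Qed.

Lemma lsum_perm {A} (f : A -> R) l l' : Permutation l l' -> lsum f l = lsum f l'.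
Proof. unfold lsum; induction 1; simpl; lra. Qed.

Lemma lsum_map {A B} (h : A -> B) (f : B -> R) l : lsum f (map h l) = lsum (fun x => f (h x)) l.
Proof. unfold lsum; now rewrite map_map. Qed.

Lemma lsum_bij {A B} (h : A -> B) (f : A -> R) (g : B -> R) l l' :
  NoDup l -> NoDup l' -> (forall x, In x l -> In (h x) l') ->
  (forall x y, In x l -> In y l -> h x = h y -> x = y) ->
  (forall y, In y l' -> exists x, In x l /\ h x = y) ->
  (forall x, In x l -> f x = g (h x)) -> lsum f l = lsum g l'.
Proof.
  intros Hl Hl' Hin Hinj Hsurj E.
  rewrite (lsum_ext f (fun x => g (h x))), <- lsum_map by exact E.
  apply lsum_perm, NoDup_Permutation; auto.
  - apply FinFun.Injective_map_NoDup_in; auto.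
  - intros y; rewrite in_map_iff; split.
    + intros [x [<- Hx]]; auto.
    + intros Hy; destruct (Hsurj y Hy) as [x [H1 H2]]; now exists x.
Qed.

Lemma lsum_fiber {A} (key : A -> nat) (f : A -> R) l L : NoDup L ->
  (forall x, In x l -> In (key x) L) ->
  lsum f l = lsum (fun m => lsum f (filter (fun x => Nat.eqb (key x) m) l)) L.
Proof.
  intros HL; induction l as [|x l IH]; intros H.
  - symmetry; apply lsum_zero.
  - transitivity (f x + lsum f l); [reflexivity|].
    rewrite IH by (intros; apply H; now right).
    assert (Hx : In (key x) L) by (apply H; now left); clear H IH.
    assert (E : f x = lsum (fun m => if Nat.eqb (key x) m then f x else 0) L).
    { induction HL as [|m L Hm HL IH]; [easy|].
      unfold lsum in *; cbn [map fold_right]; destruct (Nat.eqb_spec (key x) m) as [<-|Hne].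
      - fold (lsum (fun m => if Nat.eqb (key x) m then f x else 0) L).
        rewrite (lsum_ext _ (fun _ => 0)), lsum_zero; [lra|].
        intros m' Hm'; destruct (Nat.eqb_spec (key x) m'); [now subst|reflexivity].
      - destruct Hx as [Hx|Hx]; [congruence|]. rewrite <- IH by exact Hx; lra. }
    rewrite E at 1; rewrite <- lsum_plus; apply lsum_ext; intros m _; simpl.
    destruct (Nat.eqb (key x) m); unfold lsum; simpl; lra.
Qed.

Lemma NoDup_list_prod {A B} (l : list A) (l' : list B) :
  NoDup l -> NoDup l' -> NoDup (list_prod l l').
Proof.
  intros Hl Hl'; induction Hl as [|x l Hx Hl IH]; simpl; [constructor|].
  apply NoDup_app; auto.
  - apply FinFun.Injective_map_NoDup; auto; intros u v E; now injection E.
  - intros [u v] H1 H2; apply in_map_iff in H1; destruct H1 as [w [E _]].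
    injection E as <- <-; apply in_prod_iff in H2; tauto.
Qed.

Lemma lsum_list_prod {A B} (f : A -> R) (g : B -> R) l l' :
  lsum (fun u => f (fst u) * g (snd u)) (list_prod l l') = lsum f l * lsum g l'.
Proof.
  induction l as [|x l IH]; simpl.
  - unfold lsum; simpl; ring.
  - rewrite lsum_app, IH, lsum_map; simpl; rewrite lsum_scal; unfold lsum; simpl; ring.
Qed.

(** * Divisors and the solutions of a x + b y = n *)

Definition divisors (n : nat) : list nat := filter (fun d => Nat.eqb (n mod d) 0) (seq 1 n).

Lemma divisors_NoDup n : NoDup (divisors n).
Proof. apply NoDup_filter, seq_NoDup. Qed.

Lemma in_divisors n d : (0 < n)%nat -> In d (divisors n) <-> exists e, n = (d * e)%nat.
Proof.
  intros Hn; unfold divisors; rewrite filter_In, in_seq, Nat.eqb_eq; split.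
  - intros [Hd H]; apply Nat.Div0.mod_divides in H; exact H.
  - intros [[|e] ->]; [lia|destruct d as [|d]; [lia|]]; split; [nia|].
    rewrite Nat.mul_comm; apply Nat.Div0.mod_mul.
Qed.

Lemma sigma_lsum k n : Defs.sigma k n = lsum (fun d => INR d ^ k) (divisors n).
Proof. unfold divisors; rewrite lsum_filter; reflexivity. Qed.

(* The positive solutions ((a, b), (x, y)) of a x + b y = n. *)
Definition sols (n : nat) : list ((nat * nat) * (nat * nat)) :=
  filter (fun s => Nat.eqb (fst (fst s) * fst (snd s) + snd (fst s) * snd (snd s)) n)
    (list_prod (list_prod (seq 1 n) (seq 1 n)) (list_prod (seq 1 n) (seq 1 n))).

Lemma sols_NoDup n : NoDup (sols n).
Proof. apply NoDup_filter; repeat apply NoDup_list_prod; apply seq_NoDup. Qed.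

Lemma in_sols n a b x y : In ((a, b), (x, y)) (sols n) <->
  (0 < a /\ 0 < b /\ 0 < x /\ 0 < y /\ a * x + b * y = n)%nat.
Proof.
  unfold sols; rewrite filter_In, !in_prod_iff, !in_seq, Nat.eqb_eq; simpl; nia.
Qed.

Definition sel (P : nat -> nat -> nat -> nat -> bool) n :=
  filter (fun s => P (fst (fst s)) (snd (fst s)) (fst (snd s)) (snd (snd s))) (sols n).

Lemma sel_NoDup P n : NoDup (sel P n).
Proof. apply NoDup_filter, sols_NoDup. Qed.

Lemma in_sel P n a b x y : In ((a, b), (x, y)) (sel P n) <->
  (0 < a /\ 0 < b /\ 0 < x /\ 0 < y /\ a * x + b * y = n)%nat /\ P a b x y = true.
Proof. unfold sel; rewrite filter_In, in_sols; reflexivity. Qed.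

(* The hypotheses say that k is invariant under the hexagonal symmetries of the
   quadratic form u^2 + u v + v^2. *)
Section LiouvilleIdentity.
Variable k : R -> R -> R.
Variable n : nat.
Hypothesis k_sym : forall u v, k u v = k v u.
Hypothesis k_rot : forall u v, k (u - v) v = k (v - u) u.

Let kab (s : (nat * nat) * (nat * nat)) := k (INR (fst (fst s))) (INR (snd (fst s))).
Let pab (s : (nat * nat) * (nat * nat)) :=
  k (INR (fst (fst s)) - INR (snd (fst s))) (INR (snd (fst s))).
Let swap (s : (nat * nat) * (nat * nat)) :=
  ((snd (fst s), fst (fst s)), (snd (snd s), fst (snd s))).
Let shear (s : (nat * nat) * (nat * nat)) :=
  let '((a, b), (x, y)) := s in ((a - b, b)%nat, (x, x + y)%nat).

Lemma lsum_trichotomy (f : (nat * nat) * (nat * nat) -> R) (u v : nat -> nat -> nat -> nat -> nat) :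
  lsum f (sols n) = lsum f (sel (fun a b x y => Nat.ltb (v a b x y) (u a b x y)) n)
    + lsum f (sel (fun a b x y => Nat.ltb (u a b x y) (v a b x y)) n)
    + lsum f (sel (fun a b x y => Nat.eqb (u a b x y) (v a b x y)) n).
Proof.
  unfold sel; rewrite !lsum_filter, <- !lsum_plus; apply lsum_ext.
  intros [[a b] [x y]] _; cbn [fst snd].
  destruct (Nat.ltb_spec (v a b x y) (u a b x y)), (Nat.ltb_spec (u a b x y) (v a b x y)),
    (Nat.eqb_spec (u a b x y) (v a b x y)); try lia; lra.
Qed.

(* The shear (a, b, x, y) -> (a - b, b, x, x + y) is a bijection from the
   solutions with b < a to those with x < y. *)
Lemma lsum_shear :
  lsum pab (sel (fun a b x y => Nat.ltb b a) n) = lsum kab (sel (fun a b x y => Nat.ltb x y) n).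
Proof.
  apply lsum_bij with shear; auto using sel_NoDup.
  - intros [[a b] [x y]]; unfold shear; rewrite !in_sel, !Nat.ltb_lt; intros H.
    repeat split; try lia; nia.
  - intros [[a b] [x y]] [[a' b'] [x' y']]; rewrite !in_sel, !Nat.ltb_lt; unfold shear.
    intros H H' E; injection E as E1 E2 E3 E4; repeat f_equal; lia.
  - intros [[a b] [x y]]; rewrite in_sel, Nat.ltb_lt; intros H.
    exists ((a + b, b)%nat, (x, y - x)%nat); rewrite in_sel, Nat.ltb_lt; split.
    + repeat split; try lia; nia.
    + unfold shear; repeat f_equal; lia.
  - intros [[a b] [x y]]; rewrite in_sel, Nat.ltb_lt; intros H.
    unfold pab, kab, shear; cbn [fst snd]; rewrite minus_INR by lia; reflexivity.
Qed.

Lemma lsum_swap_k :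
  lsum kab (sel (fun a b x y => Nat.ltb y x) n) = lsum kab (sel (fun a b x y => Nat.ltb x y) n).
Proof.
  apply lsum_bij with swap; auto using sel_NoDup.
  - intros [[a b] [x y]]; unfold swap; cbn [fst snd]; rewrite !in_sel, !Nat.ltb_lt; lia.
  - intros [[a b] [x y]] [[a' b'] [x' y']] _ _; unfold swap; cbn [fst snd]; congruence.
  - intros [[a b] [x y]]; rewrite in_sel, Nat.ltb_lt; intros H.
    exists ((b, a), (y, x)); rewrite in_sel, Nat.ltb_lt; split; [lia|reflexivity].
  - intros s _; unfold kab, swap; cbn [fst snd]; apply k_sym.
Qed.

Lemma lsum_swap_p :
  lsum pab (sel (fun a b x y => Nat.ltb a b) n) = lsum pab (sel (fun a b x y => Nat.ltb b a) n).
Proof.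
  apply lsum_bij with swap; auto using sel_NoDup.
  - intros [[a b] [x y]]; unfold swap; cbn [fst snd]; rewrite !in_sel, !Nat.ltb_lt; lia.
  - intros [[a b] [x y]] [[a' b'] [x' y']] _ _; unfold swap; cbn [fst snd]; congruence.
  - intros [[a b] [x y]]; rewrite in_sel, Nat.ltb_lt; intros H.
    exists ((b, a), (y, x)); rewrite in_sel, Nat.ltb_lt; split; [lia|reflexivity].
  - intros s _; unfold pab, swap; cbn [fst snd]; apply k_rot.
Qed.

(** For x = y the equation reads (a + b) x = n, so d = a + b is a divisor and a runs through 1, ...,
    d - 1. *)
Lemma lsum_diag_k : (0 < n)%nat ->
  lsum kab (sel (fun a b x y => Nat.eqb x y) n)
  = lsum (fun d => lsum (fun a => k (INR a) (INR d - INR a)) (seq 1 (d - 1))) (divisors n).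
Proof.
  intros Hn.
  rewrite (lsum_fiber (fun s => (fst (fst s) + snd (fst s))%nat) kab _ (divisors n)).
  - apply lsum_ext; intros d Hd; apply in_divisors in Hd; [|exact Hn]; destruct Hd as [e He].
    apply lsum_bij with (fun s => fst (fst s)).
    + apply NoDup_filter, sel_NoDup.
    + apply seq_NoDup.
    + intros [[a b] [x y]]; rewrite filter_In, in_sel, !Nat.eqb_eq, in_seq; cbn [fst snd]; lia.
    + intros [[a b] [x y]] [[a' b'] [x' y']]; rewrite !filter_In, !in_sel, !Nat.eqb_eq; cbn [fst snd].
      intros H H' <-; assert (b = b') as <- by lia.
      assert (x = x') by (destruct H as [[H ->] _], H' as [[H' ->] _]; nia).
      repeat f_equal; lia.
    + intros a; rewrite in_seq; intros H.
      exists ((a, d - a)%nat, (e, e)); rewrite filter_In, in_sel, !Nat.eqb_eq; cbn [fst snd].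
      repeat split; try lia; nia.
    + intros [[a b] [x y]]; rewrite filter_In, in_sel, !Nat.eqb_eq; cbn [fst snd]; intros [_ <-].
      unfold kab; cbn [fst snd]; rewrite plus_INR; f_equal; ring.
  - apply divisors_NoDup.
  - intros [[a b] [x y]]; rewrite in_sel, Nat.eqb_eq, in_divisors by exact Hn; cbn [fst snd].
    intros [H ->]; exists y; nia.
Qed.

(** For a = b = d the equation reads d (x + y) = n, which leaves n / d - 1 choices of x, all with
    the same summand. *)
Lemma lsum_diag_p : (0 < n)%nat ->
  lsum pab (sel (fun a b x y => Nat.eqb a b) n)
  = lsum (fun d => (INR n / INR d - 1) * k 0 (INR d)) (divisors n).
Proof.
  intros Hn.
  rewrite (lsum_fiber (fun s => fst (fst s)) pab _ (divisors n)).
  - apply lsum_ext; intros d Hd; apply in_divisors in Hd; [|exact Hn]; destruct Hd as [e He].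
    assert (Hd : (0 < d /\ 0 < e)%nat) by nia.
    transitivity (lsum (fun _ => k 0 (INR d)) (seq 1 (e - 1))).
    + apply lsum_bij with (fun s => fst (snd s)).
      * apply NoDup_filter, sel_NoDup.
      * apply seq_NoDup.
      * intros [[a b] [x y]]; rewrite filter_In, in_sel, !Nat.eqb_eq, in_seq; cbn [fst snd].
        intros [[H ->] ->]; nia.
      * intros [[a b] [x y]] [[a' b'] [x' y']]; rewrite !filter_In, !in_sel, !Nat.eqb_eq; cbn [fst snd].
        intros [[H ->] ->] [[H' ->] ->] <-.
        assert (y = y') by nia; congruence.
      * intros x; rewrite in_seq; intros H.
        exists ((d, d)%nat, (x, e - x)%nat); rewrite filter_In, in_sel, !Nat.eqb_eq; cbn [fst snd].
        repeat split; try lia; nia.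
      * intros [[a b] [x y]]; rewrite filter_In, in_sel, !Nat.eqb_eq; cbn [fst snd]; intros [[_ ->] ->].
        unfold pab; cbn [fst snd]; f_equal; ring.
    + assert (E : forall m s, lsum (fun _ : nat => k 0 (INR d)) (seq s m) = INR m * k 0 (INR d)).
      { induction m as [|m IH]; intros s; [unfold lsum; simpl; ring|].
        transitivity (k 0 (INR d) + lsum (fun _ : nat => k 0 (INR d)) (seq (S s) m)); [reflexivity|].
        rewrite IH, S_INR; ring. }
      rewrite E, minus_INR by lia; f_equal; rewrite He, mult_INR; simpl.
      field; apply not_0_INR; lia.
  - apply divisors_NoDup.
  - intros [[a b] [x y]]; rewrite in_sel, Nat.eqb_eq, in_divisors by exact Hn; cbn [fst snd].
    intros [H ->]; exists (x + y)%nat; nia.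
Qed.

(** The sum of k(a, b) is split by comparing x with y, that of k(a - b, b) by comparing a with b. In
    each, the swap of the two pairs equates the two strict parts, and the shear carries the strict
    part of one sum to that of the other. These cancel, and the diagonals x = y and a = b remain. *)
Lemma liouville_identity : (0 < n)%nat ->
  lsum (fun s => k (INR (fst (fst s))) (INR (snd (fst s)))
               - k (INR (fst (fst s)) - INR (snd (fst s))) (INR (snd (fst s)))) (sols n)
  = lsum (fun d => lsum (fun a => k (INR a) (INR d - INR a)) (seq 1 (d - 1))
                 - (INR n / INR d - 1) * k 0 (INR d)) (divisors n).
Proof.
  intros Hn.
  transitivity (lsum kab (sols n) + (-1) * lsum pab (sols n)).
  { rewrite <- lsum_scal, <- lsum_plus; apply lsum_ext; intros s _; unfold kab, pab; ring. }
  rewrite (lsum_trichotomy kab (fun a b x y => y) (fun a b x y => x)).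
  rewrite (lsum_trichotomy pab (fun a b x y => a) (fun a b x y => b)).
  rewrite lsum_swap_k, lsum_swap_p, lsum_shear, lsum_diag_p by exact Hn.
  assert (E : sel (fun a b x y => Nat.eqb y x) n = sel (fun a b x y => Nat.eqb x y) n).
  { unfold sel; apply filter_ext; intros s; apply Nat.eqb_sym. }
  rewrite E, lsum_diag_k by exact Hn.
  rewrite (lsum_ext (fun d => lsum (fun a => k (INR a) (INR d - INR a)) (seq 1 (d - 1))
                 - (INR n / INR d - 1) * k 0 (INR d)) (fun d =>
      lsum (fun a => k (INR a) (INR d - INR a)) (seq 1 (d - 1))
                 + (-1) * ((INR n / INR d - 1) * k 0 (INR d)))) by (intros; ring).
  rewrite (lsum_plus (fun d => lsum (fun a => k (INR a) (INR d - INR a)) (seq 1 (d - 1)))), lsum_scal.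
  ring.
Qed.
End LiouvilleIdentity.

(** * Evaluation of the convolution sums *)

Lemma lsum_telescope (f : R -> R) (F : R -> R) m : F 0 = 0 ->
  (forall x, F (x + 1) = F x + f (x + 1)) ->
  lsum (fun a => f (INR a)) (seq 1 m) = F (INR m).
Proof.
  intros H0 HS; induction m as [|m IH]; [symmetry; exact H0|].
  rewrite seq_S, lsum_app, IH, S_INR, HS; unfold lsum; cbn [map fold_right].
  replace (1 + m)%nat with (S m) by lia; rewrite S_INR; ring.
Qed.

(** With m = a x, a solution of a x + b y = n amounts to a divisor a of m together with a divisor b
    of n - m. *)
Lemma conv_sigma i j n : (0 < n)%nat ->
  lsum (fun m => Defs.sigma i m * Defs.sigma j (n - m)) (seq 1 (n - 1))
  = lsum (fun s => INR (fst (fst s)) ^ i * INR (snd (fst s)) ^ j) (sols n).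
Proof.
  intros Hn.
  rewrite (lsum_fiber (fun s => (fst (fst s) * fst (snd s))%nat) _ _ (seq 1 (n - 1))).
  - apply lsum_ext; intros m Hm; apply in_seq in Hm.
    rewrite !sigma_lsum, <- lsum_list_prod; symmetry.
    apply lsum_bij with fst.
    + apply NoDup_filter, sols_NoDup.
    + apply NoDup_list_prod; apply divisors_NoDup.
    + intros [[a b] [x y]]; rewrite filter_In, in_sols, Nat.eqb_eq; cbn [fst snd]; intros [H E].
      apply in_prod_iff; rewrite !in_divisors by lia; split; [exists x|exists y]; lia.
    + intros [[a b] [x y]] [[a' b'] [x' y']]; rewrite !filter_In, !in_sols, !Nat.eqb_eq; cbn [fst snd].
      intros [H1 H2] [H3 H4] E; injection E as <- <-.
      assert (x = x') as <- by nia; assert (y = y') as <- by nia; reflexivity.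
    + intros [a b]; rewrite in_prod_iff, !in_divisors by lia; intros [[x Hx] [y Hy]].
      exists ((a, b), (x, y)); rewrite filter_In, in_sols, Nat.eqb_eq; cbn [fst snd].
      split; [|reflexivity]; split; [|lia].
      assert (a <> 0 /\ x <> 0 /\ b <> 0 /\ y <> 0)%nat by (repeat split; intros ->; lia). lia.
    + reflexivity.
  - apply seq_NoDup.
  - intros [[a b] [x y]]; rewrite in_sols, in_seq; cbn [fst snd]; nia.
Qed.

Lemma sum_f_R0_lsum f n : sum_f_R0 f n = lsum f (seq 0 (S n)).
Proof.
  induction n as [|n IH]; [unfold lsum; simpl; ring|].
  rewrite seq_S, lsum_app, <- IH; unfold lsum; simpl; ring.
Qed.

Lemma conv_ecoef c i c' j n : (0 < n)%nat ->
  conv (ecoef c i) (ecoef c' j) n = c * Defs.sigma i n + c' * Defs.sigma j n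
   + c * c' * lsum (fun s => INR (fst (fst s)) ^ i * INR (snd (fst s)) ^ j) (sols n).
Proof.
  intros Hn; rewrite <- conv_sigma, <- lsum_scal by exact Hn.
  unfold conv; rewrite sum_f_R0_lsum.
  destruct n as [|n]; [lia|].
  replace (S n - 1)%nat with n by lia.
  rewrite seq_S; cbn [seq]; rewrite lsum_app.
  change (lsum (fun k => ecoef c i k * ecoef c' j (S n - k)) (0%nat :: seq 1 n))
    with (ecoef c i 0 * ecoef c' j (S n) + lsum (fun k => ecoef c i k * ecoef c' j (S n - k)) (seq 1 n)).
  rewrite (lsum_ext _ (fun x => c * c' * (Defs.sigma i x * Defs.sigma j (S n - x))) (seq 1 n)).
  - unfold lsum at 2; cbn [map fold_right Nat.add]; rewrite Nat.sub_diag.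
    unfold ecoef; cbn [Nat.eqb]; ring.
  - intros m Hm; apply in_seq in Hm; unfold ecoef.
    destruct (Nat.eqb_spec m 0), (Nat.eqb_spec (S n - m) 0); try lia; ring.
Qed.

Lemma lsum_sols_swap i j n :
  lsum (fun s => INR (fst (fst s)) ^ i * INR (snd (fst s)) ^ j) (sols n)
  = lsum (fun s => INR (fst (fst s)) ^ j * INR (snd (fst s)) ^ i) (sols n).
Proof.
  apply lsum_bij with (fun s => ((snd (fst s), fst (fst s)), (snd (snd s), fst (snd s))));
    auto using sols_NoDup.
  - intros [[a b] [x y]]; cbn [fst snd]; rewrite !in_sols; lia.
  - intros [[a b] [x y]] [[a' b'] [x' y']] _ _; cbn [fst snd]; congruence.
  - intros [[a b] [x y]]; rewrite in_sols; intros H.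
    exists ((b, a), (y, x)); rewrite in_sols; split; [lia|reflexivity].
  - intros s _; cbn [fst snd]; ring.
Qed.

(** The norm form of the Eisenstein integers, the quadratic invariant of the symmetries demanded of
    [k]. *)
Definition qf (u v : R) : R := u * u + u * v + v * v.

Lemma divisor_INR n d : (0 < n)%nat -> In d (divisors n) -> 0 < INR d /\ INR (d - 1) = INR d - 1.
Proof.
  intros Hn Hd; apply in_divisors in Hd; [|exact Hn]; destruct Hd as [e He].
  assert (0 < d)%nat by (destruct d; lia).
  split; [now apply lt_0_INR|]; now rewrite minus_INR by lia.
Qed.

(** For k = qf^2 the difference k(a, b) - k(a - b, b) is 4 a^3 b + 4 a b^3, and both monomials have
    the same sum over the solutions. *)
Lemma conv_sigma_1_3 n : (0 < n)%nat ->
  240 * lsum (fun s => INR (fst (fst s)) ^ 1 * INR (snd (fst s)) ^ 3) (sols n)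
  = 10 * Defs.sigma 3 n - Defs.sigma 1 n + 21 * Defs.sigma 5 n - 30 * (INR n * Defs.sigma 3 n).
Proof.
  intros Hn.
  pose proof (liouville_identity (fun u v => qf u v ^ 2) n
    ltac:(intros; unfold qf; ring) ltac:(intros; unfold qf; ring) Hn) as H.
  rewrite (lsum_ext _ (fun s => 4 * (INR (fst (fst s)) ^ 3 * INR (snd (fst s)) ^ 1)
     + 4 * (INR (fst (fst s)) ^ 1 * INR (snd (fst s)) ^ 3)) (sols n)) in H
    by (intros; unfold qf; ring).
  rewrite lsum_plus, !lsum_scal, (lsum_sols_swap 3 1) in H.
  rewrite (lsum_ext _ (fun d => 1 / 3 * INR d ^ 3 + (- / 30 * INR d ^ 1
     + (7 / 10 * INR d ^ 5 + (- INR n) * INR d ^ 3))) (divisors n)) in H.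
  - rewrite !lsum_plus, !lsum_scal, <- !sigma_lsum in H. lra.
  - intros d Hd; destruct (divisor_INR n d Hn Hd) as [H1 H2].
    set (D := INR d) in *.
    (* Since qf(a, D - a) = a^2 - a D + D^2, its square is summed by the closed forms of the power
       sums up to exponent 4. *)
    rewrite (lsum_telescope (fun a => qf a (D - a) ^ 2) (fun m =>
      m * (m + 1) * (2 * m + 1) * (3 * m * m + 3 * m - 1) / 30
      - 2 * D * (m * m * (m + 1) * (m + 1) / 4)
      + 3 * D ^ 2 * (m * (m + 1) * (2 * m + 1) / 6)
      - 2 * D ^ 3 * (m * (m + 1) / 2) + D ^ 4 * m)).
    + rewrite H2; unfold qf; field; lra.
    + field.
    + intros x; unfold qf; field.
Qed.

(** The constants 12096 = 24 * 504 and 57600 = 240^2 are those of E2 E6 and E4^2. In Liouville's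
    difference qf^3 yields 6 a^5 b + 14 a^3 b^3 + 6 a b^5 and (u v (u + v))^2 yields 4 a^3 b^3, with
    14 * 1008 - 4 * 17928 = -57600. In this combination the seventh powers of the divisors cancel as
    well. *)
Lemma conv_sigma_1_5_3_3 n : (0 < n)%nat ->
  12096 * lsum (fun s => INR (fst (fst s)) ^ 1 * INR (snd (fst s)) ^ 5) (sols n)
  - 57600 * lsum (fun s => INR (fst (fst s)) ^ 3 * INR (snd (fst s)) ^ 3) (sols n)
  = 24 * Defs.sigma 1 n + 480 * Defs.sigma 3 n + 504 * Defs.sigma 5 n
    - 1008 * (INR n * Defs.sigma 5 n).
Proof.
  intros Hn.
  (* 17928 is chosen so that the two sextic invariants combine to the wanted
     multiples of sigma_1 * sigma_5 and sigma_3 * sigma_3. *)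
  pose proof (liouville_identity (fun u v => 1008 * qf u v ^ 3 - 17928 * (u * v * (u + v)) ^ 2) n
    ltac:(intros; unfold qf; ring) ltac:(intros; unfold qf; ring) Hn) as H.
  rewrite (lsum_ext _ (fun s => 6048 * (INR (fst (fst s)) ^ 5 * INR (snd (fst s)) ^ 1)
     + (6048 * (INR (fst (fst s)) ^ 1 * INR (snd (fst s)) ^ 5)
     + (-57600) * (INR (fst (fst s)) ^ 3 * INR (snd (fst s)) ^ 3))) (sols n)) in H
    by (intros; unfold qf; ring).
  rewrite !lsum_plus, !lsum_scal, (lsum_sols_swap 5 1) in H.
  rewrite (lsum_ext _ (fun d => 24 * INR d ^ 1 + (480 * INR d ^ 3
     + (504 * INR d ^ 5 + (- 1008 * INR n) * INR d ^ 5))) (divisors n)) in H.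
  - rewrite !lsum_plus, !lsum_scal, <- !sigma_lsum in H. lra.
  - intros d Hd; destruct (divisor_INR n d Hn Hd) as [H1 H2].
    set (D := INR d) in *.
    set (s1 := fun m : R => m * (m + 1) / 2).
    set (s2 := fun m : R => m * (m + 1) * (2 * m + 1) / 6).
    set (s3 := fun m : R => m * m * (m + 1) * (m + 1) / 4).
    set (s4 := fun m : R => m * (m + 1) * (2 * m + 1) * (3 * m * m + 3 * m - 1) / 30).
    set (s5 := fun m : R => m * m * (m + 1) * (m + 1) * (2 * m * m + 2 * m - 1) / 12).
    set (s6 := fun m : R => m * (m + 1) * (2 * m + 1) * (3 * m ^ 4 + 6 * m ^ 3 - 3 * m + 1) / 42).
    rewrite (lsum_telescope (fun a => 1008 * qf a (D - a) ^ 3 - 17928 * (a * (D - a) * (a + (D - a))) ^ 2)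
      (fun m =>
      1008 * (s6 m - 3 * D * s5 m + 6 * D ^ 2 * s4 m - 7 * D ^ 3 * s3 m + 6 * D ^ 4 * s2 m
        - 3 * D ^ 5 * s1 m + D ^ 6 * m)
      - 17928 * (D ^ 4 * s2 m - 2 * D ^ 3 * s3 m + D ^ 2 * s4 m))).
    + rewrite H2; unfold qf, s1, s2, s3, s4, s5, s6; field; lra.
    + unfold s1, s2, s3, s4, s5, s6; field.
    + intros x; unfold qf, s1, s2, s3, s4, s5, s6; field.
Qed.

Lemma E4_coef_identity n : 3 * (INR n * ecoef 240 3 n)
  = conv (ecoef (-24) 1) (ecoef 240 3) n - ecoef (-504) 5 n.
Proof.
  destruct n as [|n]; [unfold conv, ecoef; simpl; ring|].
  rewrite conv_ecoef by lia; pose proof (conv_sigma_1_3 (S n) ltac:(lia)).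
  unfold ecoef; cbn [Nat.eqb]; lra.
Qed.

Lemma E6_coef_identity n : 2 * (INR n * ecoef (-504) 5 n)
  = conv (ecoef (-24) 1) (ecoef (-504) 5) n - conv (ecoef 240 3) (ecoef 240 3) n.
Proof.
  destruct n as [|n]; [unfold conv, ecoef; simpl; ring|].
  rewrite !conv_ecoef by lia; pose proof (conv_sigma_1_5_3_3 (S n) ltac:(lia)).
  unfold ecoef; cbn [Nat.eqb]; lra.
Qed.

Lemma ramanujan_identity_E4 z : UHP z -> (3 * qderiv E4 z = E2 z * E4 z - E6 z)%C.
Proof. apply ramanujan_E4_of_coef, E4_coef_identity. Qed.

Lemma ramanujan_identity_E6 z : UHP z -> (2 * qderiv E6 z = E2 z * E6 z - E4 z * E4 z)%C.
Proof. apply ramanujan_E6_of_coef, E6_coef_identity. Qed.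

(** * The spanning property *)

(** The half plane is open, so derivatives respect the equality of H, which compares values only
    there. *)
Lemma C_derive_eq_UHP f g z : UHP z -> cdiff f z -> (forall w, UHP w -> f w = g w) ->
  C_derive g z = C_derive f z.
Proof.
  intros Hz Hf E; apply cderiv_unique, (cderiv_ext_loc f g z _ (Im z) Hz); [|now apply cdiff_correct].
  intros w Hw; apply E; now apply UHP_nbhd with z.
Qed.

Lemma Dk_eq_UHP k f g z : UHP z -> cdiff f z -> (forall w, UHP w -> f w = g w) ->
  Dk k g z = Dk k f z.
Proof.
  intros Hz Hf E; unfold Dk, qderiv; now rewrite (C_derive_eq_UHP f g z Hz Hf E), E.
Qed.

Lemma holo_mult f g : holo f -> holo g -> holo (fun z => f z * g z)%C.
Proof. intros Hf Hg; apply cdiff_holo; intros z Hz; apply cdiff_mult; now apply holo_cdiff. Qed.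

Lemma holo_plus f g : holo f -> holo g -> holo (fun z => f z + g z)%C.
Proof. intros Hf Hg; apply cdiff_holo; intros z Hz; apply cdiff_plus; now apply holo_cdiff. Qed.

Lemma holo_const a : holo (fun _ => a).
Proof. apply cdiff_holo; intros z Hz; apply cdiff_const. Qed.

Lemma holo_qderiv f : holo f -> holo (qderiv f).
Proof.
  intros Hf; apply (holo_mult (C_derive f) (fun _ => / (RtoC (2 * PI) * Ci))%C);
    [now apply holo_C_derive|apply holo_const].
Qed.

Lemma holo_Dk k f : holo f -> holo (Dk k f).
Proof.
  intros Hf; apply cdiff_holo; intros z Hz; unfold Dk.
  apply cdiff_minus; [now apply holo_cdiff; [apply holo_qderiv|]|].
  apply cdiff_mult; [|now apply holo_cdiff].
  apply cdiff_mult; [apply cdiff_const|apply holo_cdiff; [apply holo_Eis|exact Hz]].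
Qed.

Lemma qderiv_plus f g z : cdiff f z -> cdiff g z ->
  qderiv (fun w => f w + g w)%C z = (qderiv f z + qderiv g z)%C.
Proof.
  intros Hf Hg; unfold qderiv.
  rewrite (cderiv_unique _ _ _ (cderiv_plus _ _ _ _ _ (cdiff_correct _ _ Hf) (cdiff_correct _ _ Hg))).
  unfold Cdiv; ring.
Qed.

Lemma qderiv_mult f g z : cdiff f z -> cdiff g z ->
  qderiv (fun w => f w * g w)%C z = (qderiv f z * g z + f z * qderiv g z)%C.
Proof.
  intros Hf Hg; unfold qderiv.
  rewrite (cderiv_unique _ _ _ (cderiv_mult _ _ _ _ _ (cdiff_correct _ _ Hf) (cdiff_correct _ _ Hg))).
  unfold Cdiv; ring.
Qed.

Lemma qderiv_const a z : qderiv (fun _ => a) z = 0%C.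
Proof. unfold qderiv; rewrite (cderiv_unique _ _ _ (cderiv_const a z)); unfold Cdiv; ring. Qed.

Lemma Dk_plus k f g z : cdiff f z -> cdiff g z ->
  Dk k (fun w => f w + g w)%C z = (Dk k f z + Dk k g z)%C.
Proof. intros Hf Hg; unfold Dk; rewrite qderiv_plus by auto; ring. Qed.

Lemma Dk_scal k a f z : cdiff f z -> Dk k (fun w => a * f w)%C z = (a * Dk k f z)%C.
Proof.
  intros Hf; unfold Dk; rewrite (qderiv_mult (fun _ => a)) by auto using cdiff_const.
  rewrite qderiv_const; ring.
Qed.

(** Raising the weight by 4 adds (4 / 12) E2 E4 f to the subtracted term, and this cancels the E2
    part of E4' = (E2 E4 - E6) / 3. For E6 the same happens with 6 / 12 = 1 / 2. *)
Lemma Dk_E4 k f z : UHP z -> cdiff f z ->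
  Dk (k + 4) (fun w => E4 w * f w)%C z = (E4 z * Dk k f z + - (1 / 3) * (E6 z * f z))%C.
Proof.
  intros Hz Hf; unfold Dk; rewrite qderiv_mult; auto.
  2: { apply holo_cdiff; [apply holo_Eis|exact Hz]. }
  pose proof (ramanujan_identity_E4 z Hz) as H.
  replace (qderiv E4 z) with ((E2 z * E4 z - E6 z) / 3)%C by (rewrite <- H; field).
  replace ((k + 4) / 12) with (k / 12 + 1 / 3) by field.
  rewrite RtoC_plus, !RtoC_div by lra; field.
Qed.

Lemma Dk_E6 k f z : UHP z -> cdiff f z ->
  Dk (k + 6) (fun w => E6 w * f w)%C z
  = (E6 z * Dk k f z + - (1 / 2) * (E4 z * (E4 z * f z)))%C.
Proof.
  intros Hz Hf; unfold Dk; rewrite qderiv_mult; auto.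
  2: { apply holo_cdiff; [apply holo_Eis|exact Hz]. }
  pose proof (ramanujan_identity_E6 z Hz) as H.
  replace (qderiv E6 z) with ((E2 z * E6 z - E4 z * E4 z) / 2)%C by (rewrite <- H; field).
  replace ((k + 6) / 12) with (k / 12 + 1 / 2) by field.
  rewrite RtoC_plus, !RtoC_div by lra; field.
Qed.

(** * The generators as operators on H and their commutation *)

Lemma inH_delta F : inH F -> inH (delta F).
Proof.
  intros [[l Hl] HF]; split.
  - exists (map (fun m => m + 2) l); intros m Hm z Hz; unfold delta.
    assert (E : forall w, UHP w -> RtoC 0 = F (m - 2) w).
    { intros w Hw; symmetry; apply Hl; auto; intros HI; apply Hm.
      apply in_map_iff; exists (m - 2); split; [ring|exact HI]. }
    rewrite (Dk_eq_UHP _ (fun _ => RtoC 0) _ z Hz (cdiff_const _ _) E).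
    unfold Dk; rewrite qderiv_const; ring.
  - intros m; apply holo_Dk, HF.
Qed.

Lemma inH_shift_mul (g : C -> C) (s : R) F : holo g -> inH F ->
  inH (fun m z => g z * F (m - s)%R z)%C.
Proof.
  intros Hg [[l Hl] HF]; split.
  - exists (map (fun m => m + s) l); intros m Hm z Hz; rewrite Hl; auto; [ring|].
    intros HI; apply Hm, in_map_iff; exists (m - s); split; [ring|exact HI].
  - intros m; now apply holo_mult.
Qed.

Lemma inH_e4 F : inH F -> inH (e4 F).
Proof. apply (inH_shift_mul E4), holo_Eis. Qed.

Lemma inH_e6 F : inH F -> inH (e6 F).
Proof. apply (inH_shift_mul E6), holo_Eis. Qed.

Lemma inH_plus F G : inH F -> inH G -> inH (fun m z => F m z + G m z)%C.
Proof.
  intros [[l Hl] HF] [[l' Hl'] HG]; split.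
  - exists (l ++ l'); intros m Hm z Hz; rewrite Hl, Hl'; auto; [ring| |];
      intros HI; apply Hm, in_or_app; auto.
  - intros m; now apply holo_plus.
Qed.

Lemma inH_scal a F : inH F -> inH (fun m z => a * F m z)%C.
Proof.
  intros [[l Hl] HF]; split.
  - exists l; intros m Hm z Hz; rewrite Hl; auto; ring.
  - intros m; apply holo_mult; auto using holo_const.
Qed.

Lemma inH_zero : inH (fun _ _ => 0%C).
Proof. split; [now exists nil|intros m; apply holo_const]. Qed.

Lemma inH_eqH F G : eqH F G -> inH F -> inH G.
Proof.
  intros E [[l Hl] HF]; split.
  - exists l; intros m Hm z Hz; rewrite <- E; auto.
  - intros m; apply cdiff_holo; intros z Hz.
    apply (cdiff_ext_loc (F m) (G m) z (Im z) Hz); [|now apply holo_cdiff].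
    intros w Hw; apply E; now apply UHP_nbhd with z.
Qed.

Lemma inH_cdiff F m z : inH F -> UHP z -> cdiff (F m) z.
Proof. intros [_ HF] Hz; apply holo_cdiff; auto. Qed.

Lemma delta_eqH F G : inH F -> eqH F G -> eqH (delta F) (delta G).
Proof.
  intros HF E m z Hz; unfold delta; symmetry; apply Dk_eq_UHP; auto.
  now apply inH_cdiff.
Qed.

Lemma e4_eqH F G : eqH F G -> eqH (e4 F) (e4 G).
Proof. intros E m z Hz; unfold e4; now rewrite E. Qed.

Lemma e6_eqH F G : eqH F G -> eqH (e6 F) (e6 G).
Proof. intros E m z Hz; unfold e6; now rewrite E. Qed.

Lemma delta_e4 F : inH F ->
  eqH (delta (e4 F)) (fun m z => e4 (delta F) m z + - (1 / 3) * e6 F m z)%C.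
Proof.
  intros HF m z Hz; unfold delta, e4, e6.
  replace (m - 2 - 4) with (m - 6) by ring.
  replace (m - 4 - 2) with (m - 6) by ring.
  replace (m - 2) with (m - 6 + 4) by ring.
  apply Dk_E4; auto; now apply inH_cdiff.
Qed.

Lemma delta_e6 F : inH F ->
  eqH (delta (e6 F)) (fun m z => e6 (delta F) m z + - (1 / 2) * e4 (e4 F) m z)%C.
Proof.
  intros HF m z Hz; unfold delta, e4, e6.
  replace (m - 2 - 6) with (m - 8) by ring.
  replace (m - 6 - 2) with (m - 8) by ring.
  replace (m - 4 - 4) with (m - 8) by ring.
  replace (m - 2) with (m - 8 + 6) by ring.
  apply Dk_E6; auto; now apply inH_cdiff.
Qed.

(** Closure under [opeq] is built in because the commutation relations hold only on H. Working with
    closure rules postpones the bookkeeping of coefficients to [span_lincomb]. *)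
Inductive span : Op -> Prop :=
  | span_basis i j k : span (basis_el i j k)
  | span_zero : span opzero
  | span_add T S : span T -> span S -> span (opadd T S)
  | span_scale a T : span T -> span (opscale a T)
  | span_opeq T S : span T -> opeq T S -> span S.

Lemma inR_oppow T n : inR T -> inR (oppow T n).
Proof. intros HT; induction n as [|n IH]; [apply inR_id|exact (inR_comp _ _ HT IH)]. Qed.

Lemma inR_basis_el i j k : inR (basis_el i j k).
Proof.
  apply inR_comp; [|apply inR_comp]; apply inR_oppow; [apply inR_e4|apply inR_e6|apply inR_delta].
Qed.

Lemma inR_inH T : inR T -> forall F, inH F -> inH (T F).
Proof.
  intros H; induction H as [| | | |T S _ IHT _ IHS|a T _ IHT|T S _ IHT _ IHS]; intros F HF.
  - exact HF.
  - now apply inH_delta.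
  - now apply inH_e4.
  - now apply inH_e6.
  - apply inH_plus; auto.
  - apply inH_scal; auto.
  - now apply IHT, IHS.
Qed.

Lemma span_inH T : span T -> forall F, inH F -> inH (T F).
Proof.
  intros H; induction H as [i j k| |T S _ IHT _ IHS|a T _ IHT|T S _ IHT E]; intros F HF.
  - apply inR_inH; auto using inR_basis_el.
  - apply inH_zero.
  - apply inH_plus; auto.
  - apply inH_scal; auto.
  - apply inH_eqH with (T F); auto.
Qed.

Lemma span_comp_linear L :
  (forall F G, inH F -> eqH F G -> eqH (L F) (L G)) ->
  (forall F G, inH F -> inH G ->
     eqH (fun m z => L F m z + L G m z)%C (L (fun m z => F m z + G m z)%C)) ->
  (forall a F, inH F -> eqH (fun m z => a * L F m z)%C (L (fun m z => a * F m z)%C)) ->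
  (forall i j k, span (opcomp L (basis_el i j k))) ->
  forall T, span T -> span (opcomp L T).
Proof.
  intros HE HP HS HB T HT; induction HT as [i j k| |T S HT IHT HS' IHS|a T HT IHT|T S HT IHT E].
  - apply HB.
  - apply span_opeq with (opscale 0 (opcomp L opzero)).
    + apply span_opeq with (opzero); [constructor|].
      intros F HF m z Hz; unfold opscale, opzero; ring.
    + intros F HF m z Hz.
      transitivity (L (fun m z => 0 * opzero F m z)%C m z); [apply (HS 0%C (opzero F)); auto; apply inH_zero|].
      apply HE; auto; [apply inH_scal, inH_zero|].
      intros m' z' Hz'; unfold opzero; ring.
  - apply span_opeq with (opadd (opcomp L T) (opcomp L S)); [now constructor|].
    intros F HF; apply HP; now apply span_inH.
  - apply span_opeq with (opscale a (opcomp L T)); [now constructor|].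
    intros F HF; apply HS; now apply span_inH.
  - apply span_opeq with (opcomp L T); auto.
    intros F HF; apply HE; [now apply span_inH|now apply E].
Qed.

Lemma span_e4 T : span T -> span (opcomp e4 T).
Proof.
  apply span_comp_linear.
  - intros F G _; apply e4_eqH.
  - intros F G _ _ m z _; unfold e4; ring.
  - intros a F _ m z _; unfold e4; ring.
  - intros i j k; exact (span_basis (S i) j k).
Qed.

Lemma e6_oppow_e4 i F : eqH (oppow e4 i (e6 F)) (e6 (oppow e4 i F)).
Proof.
  induction i as [|i IH]; [now intros m z _|].
  intros m z Hz; change (e4 (oppow e4 i (e6 F)) m z = e6 (e4 (oppow e4 i F)) m z).
  rewrite (e4_eqH _ _ IH m z Hz); unfold e4, e6.
  replace (m - 6 - 4) with (m - 4 - 6) by ring; ring.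
Qed.

Lemma span_e6 T : span T -> span (opcomp e6 T).
Proof.
  apply span_comp_linear.
  - intros F G _; apply e6_eqH.
  - intros F G _ _ m z _; unfold e6; ring.
  - intros a F _ m z _; unfold e6; ring.
  - intros i j k; apply span_opeq with (basis_el i (S j) k); [constructor|].
    intros F _; exact (e6_oppow_e4 i (oppow e6 j (oppow delta k F))).
Qed.

Lemma span_delta T : span T -> span (opcomp delta T).
Proof.
  apply span_comp_linear.
  - apply delta_eqH.
  - intros F G HF HG m z Hz; unfold delta; symmetry; apply Dk_plus; now apply inH_cdiff.
  - intros a F HF m z Hz; unfold delta; symmetry; apply Dk_scal; now apply inH_cdiff.
  - intros i j k; induction i as [|i IHi]; [induction j as [|j IHj]|].
    + exact (span_basis 0 0 (S k)).
    + apply span_opeq with (opadd (opcomp e6 (opcomp delta (basis_el 0 j k)))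
        (opscale (- (1 / 2))%C (opcomp e4 (opcomp e4 (basis_el 0 j k))))).
      * apply span_add; [now apply span_e6|]; apply span_scale, span_e4, span_e4, span_basis.
      * intros F HF m z Hz; symmetry.
        exact (delta_e6 (basis_el 0 j k F) (inR_inH _ (inR_basis_el 0 j k) F HF) m z Hz).
    + apply span_opeq with (opadd (opcomp e4 (opcomp delta (basis_el i j k)))
        (opscale (- (1 / 3))%C (opcomp e6 (basis_el i j k)))).
      * apply span_add; [now apply span_e4|]; apply span_scale, span_e6, span_basis.
      * intros F HF m z Hz; symmetry.
        exact (delta_e4 (basis_el i j k F) (inR_inH _ (inR_basis_el i j k) F HF) m z Hz).
Qed.

(** The span is stable under left composition with the whole algebra; as it contains the identity
    [basis_el 0 0 0], it contains the algebra. Quantifying over [S] is what makes the case of a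
    composition go through. *)
Lemma span_comp T : inR T -> forall S, span S -> span (opcomp T S).
Proof.
  intros H; induction H as [| | | |T T' _ IHT _ IHT'|a T _ IHT|T T' _ IHT _ IHT']; intros S HS.
  - exact HS.
  - now apply span_delta.
  - now apply span_e4.
  - now apply span_e6.
  - exact (span_add _ _ (IHT S HS) (IHT' S HS)).
  - exact (span_scale a _ (IHT S HS)).
  - exact (IHT _ (IHT' S HS)).
Qed.

Lemma inR_span T : inR T -> span T.
Proof. intros HT; exact (span_comp T HT _ (span_basis 0 0 0)). Qed.

(** * Linear combinations as triple sums *)

Definition csum {A : Type} (f : A -> C) (l : list A) : C := fold_right Cplus 0%C (map f l).

Lemma csum_ext {A} (f g : A -> C) l : (forall x, In x l -> f x = g x) -> csum f l = csum g l.
Proof.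
  unfold csum; induction l as [|x l IH]; intros H; simpl; [reflexivity|].
  rewrite H by (now left); rewrite IH; auto using in_cons.
Qed.

Lemma csum_plus {A} (f g : A -> C) l : csum (fun x => f x + g x)%C l = (csum f l + csum g l)%C.
Proof. unfold csum; induction l as [|x l IH]; simpl; [ring|rewrite IH; ring]. Qed.

Lemma csum_scal {A} a (f : A -> C) l : csum (fun x => a * f x)%C l = (a * csum f l)%C.
Proof. unfold csum; induction l as [|x l IH]; simpl; [ring|rewrite IH; ring]. Qed.

Lemma csum_zero {A} (f : A -> C) l : (forall x, In x l -> f x = 0%C) -> csum f l = 0%C.
Proof.
  intros H; rewrite (csum_ext f (fun _ => 0 * 0)%C) by (intros; rewrite H; auto; ring).
  rewrite csum_scal; ring.
Qed.

Lemma csum_single (f : nat -> C) i N : (i < N)%nat ->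
  (forall x, (x < N)%nat -> x <> i -> f x = 0%C) -> csum f (seq 0 N) = f i.
Proof.
  intros Hi H0.
  assert (H : forall l, NoDup l -> In i l -> (forall x, In x l -> x <> i -> f x = 0%C) ->
    csum f l = f i).
  { induction 1 as [|x l Hx Hl IH]; intros Hin H; [easy|].
    transitivity (f x + csum f l)%C; [reflexivity|].
    destruct Hin as [->|Hin].
    - rewrite (csum_zero f l); [ring|]; intros y Hy; apply H; [now right|now intros ->].
    - rewrite IH, H; [ring|now left|intros ->; auto|exact Hin|intros y Hy; apply H; now right]. }
  apply H; [apply seq_NoDup|apply in_seq; lia|].
  intros x Hx; apply H0; apply in_seq in Hx; lia.
Qed.

Lemma opsum_app l l' F m z : opsum (l ++ l') F m z = (opsum l F m z + opsum l' F m z)%C.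
Proof.
  induction l as [|T l IH]; simpl; unfold opadd, opzero; [ring|].
  fold (opsum (l ++ l')); rewrite IH; unfold opsum; ring.
Qed.

Lemma opsum_flat_map {A} (f : A -> list Op) l F m z :
  opsum (flat_map f l) F m z = csum (fun x => opsum (f x) F m z) l.
Proof.
  induction l as [|x l IH]; simpl; [reflexivity|].
  rewrite opsum_app, IH; reflexivity.
Qed.

Lemma opsum_map {A} (f : A -> Op) l F m z :
  opsum (map f l) F m z = csum (fun x => f x F m z) l.
Proof.
  induction l as [|x l IH]; [reflexivity|].
  change (f x F m z + opsum (map f l) F m z = f x F m z + csum (fun x => f x F m z) l)%C.
  now rewrite IH.
Qed.

Lemma lincomb_csum N c F m z : lincomb N c F m z =
  csum (fun i => csum (fun j => csum (fun k => c i j k * basis_el i j k F m z)%C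
    (seq 0 N)) (seq 0 N)) (seq 0 N).
Proof.
  unfold lincomb; rewrite opsum_flat_map; apply csum_ext; intros i _.
  rewrite opsum_flat_map; apply csum_ext; intros j _; apply opsum_map.
Qed.

(* Quantifying over all M >= N makes sums of such representations immediate. *)
Lemma span_lincomb T : span T ->
  exists N c, forall M, (N <= M)%nat -> opeq T (lincomb M c).
Proof.
  intros H; induction H as [i j k| |T S _ (N & c & IH) _ (N' & c' & IH')|a T _ (N & c & IH)|T S _ (N & c & IH) E].
  - exists (S (i + j + k)), (fun i' j' k' =>
      if (Nat.eqb i' i && Nat.eqb j' j && Nat.eqb k' k)%bool then RtoC 1 else 0%C).
    intros M HM F HF m z Hz; rewrite lincomb_csum.
    rewrite (csum_single _ i); [|lia|].
    + rewrite (csum_single _ j); [|lia|].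
      * rewrite (csum_single _ k); [|lia|].
        -- rewrite !Nat.eqb_refl; simpl; ring.
        -- intros x _ Hx; apply Nat.eqb_neq in Hx; rewrite Hx, Bool.andb_false_r; ring.
      * intros x _ Hx; apply csum_zero; intros y _; apply Nat.eqb_neq in Hx.
        rewrite Hx, Bool.andb_false_r; simpl; ring.
    + intros x _ Hx; apply csum_zero; intros y _; apply csum_zero; intros t _; apply Nat.eqb_neq in Hx.
      rewrite Hx; simpl; ring.
  - exists 0%nat, (fun _ _ _ => 0%C); intros M _ F HF m z Hz; rewrite lincomb_csum.
    symmetry; do 3 (apply csum_zero; intros ? _); ring.
  - exists (Nat.max N N'), (fun i j k => c i j k + c' i j k)%C; intros M HM F HF m z Hz.
    unfold opadd; rewrite (IH M), (IH' M), !lincomb_csum, <- csum_plus by (auto; lia).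
    apply csum_ext; intros i _; rewrite <- csum_plus.
    apply csum_ext; intros j _; rewrite <- csum_plus.
    apply csum_ext; intros k _; ring.
  - exists N, (fun i j k => a * c i j k)%C; intros M HM F HF m z Hz.
    unfold opscale; rewrite (IH M), !lincomb_csum, <- csum_scal by (auto; lia).
    apply csum_ext; intros i _; rewrite <- csum_scal.
    apply csum_ext; intros j _; rewrite <- csum_scal.
    apply csum_ext; intros k _; ring.
  - exists N, c; intros M HM F HF m z Hz; rewrite <- (E F HF m z Hz); now apply IH.
Qed.

(** * Linear independence *)

Lemma Cmult_integral_r (a b : C) : a <> 0%C -> (a * b)%C = 0%C -> b = 0%C.
Proof.
  intros Ha E; replace b with (/ a * (a * b))%C by (field; auto); rewrite E; ring.
Qed.

(** Every component has a zero of order at least p at z0, and [v m], possibly 0, is its coefficient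
    of (z - z0)^p. A holomorphic cofactor replaces Taylor expansions. *)
Definition vanishes (z0 : C) (p : nat) (F : Hx) (v : R -> C) : Prop :=
  forall m, exists g, holo g /\
    (forall z, UHP z -> F m z = ((z - z0) ^ p * g z)%C) /\ g z0 = v m.

(** Differentiating the power lowers the order by one and multiplies the leading coefficient by (p +
    1) / (2 pi i). Everything else, including the E2 term, keeps the factor (z - z0)^(p+1) and does
    not reach the leading coefficient. *)
Lemma vanishes_delta z0 p F v : UHP z0 -> vanishes z0 (S p) F v ->
  vanishes z0 p (delta F)
    (fun m => RtoC (INR (S p)) / (RtoC (2 * PI) * Ci) * v (m - 2)%R)%C.
Proof.
  intros Hz0 H m; destruct (H (m - 2)) as [g (Hg & HF & H0)].
  set (a := (RtoC (INR (S p)) / (RtoC (2 * PI) * Ci))%C).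
  exists (fun z => a * g z + (z - z0) * Dk (m - 2) g z)%C; split; [|split].
  - apply holo_plus; apply holo_mult; auto using holo_const, holo_Dk.
    apply cdiff_holo; intros z _; apply cdiff_minus; [apply cdiff_id|apply cdiff_const].
  - intros z Hz; unfold delta.
    assert (Hp : cderiv (fun w => (w - z0) ^ S p)%C z (RtoC (INR (S p)) * (z - z0) ^ p)%C).
    { eapply cderiv_eq; [apply (cderiv_comp (fun w => w ^ S p)%C (fun w => w - z0)%C)|].
      - apply cderiv_pow.
      - apply cderiv_minus; [apply cderiv_id|apply cderiv_const].
      - ring. }
    assert (Hgz : cdiff g z) by now apply holo_cdiff.
    assert (Hpz : cdiff (fun w => (w - z0) ^ S p)%C z) by (eexists; exact Hp).
    rewrite (Dk_eq_UHP _ (fun w => (w - z0) ^ S p * g w)%C _ z Hz);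
      [|now apply cdiff_mult|intros w Hw; symmetry; now apply HF].
    unfold Dk; rewrite qderiv_mult by auto.
    unfold a, qderiv at 1; rewrite (cderiv_unique _ _ _ Hp), !Cpow_S.
    field; split; [|intros E; apply RtoC_inj in E; pose proof PI_RGT_0; lra].
    intros E; apply (f_equal snd) in E; simpl in E; lra.
  - rewrite H0; replace (z0 - z0)%C with (RtoC 0) by ring; ring.
Qed.

Lemma vanishes_S_eq_0 z0 p F v m : UHP z0 -> vanishes z0 (S p) F v -> F m z0 = 0%C.
Proof.
  intros Hz0 H; destruct (H m) as [g (_ & HF & _)]; rewrite HF, Cpow_S by exact Hz0; ring.
Qed.

(* F is (z - z0)^K placed in weight 0. *)
Lemma delta_probe K z0 : UHP z0 -> exists F, inH F /\
  (forall k m, (k < K)%nat -> oppow delta k F m z0 = 0%C) /\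
  exists a : C, a <> 0%C /\ forall m, oppow delta K F m z0
    = if Req_EM_T m (2 * INR K) then a else 0%C.
Proof.
  intros Hz0.
  set (F := fun (m : R) (z : C) => if Req_EM_T m 0 then ((z - z0) ^ K)%C else RtoC 0).
  assert (HF : inH F).
  { split.
    - exists (0 :: nil); intros m Hm z _; unfold F.
      destruct (Req_EM_T m 0) as [->|]; [exfalso; apply Hm; now left|reflexivity].
    - intros m; apply cdiff_holo; intros z _; unfold F.
      destruct (Req_EM_T m 0); [|apply cdiff_const].
      apply (cdiff_pow K (fun z => z - z0)%C), cdiff_minus; [apply cdiff_id|apply cdiff_const]. }
  (* Each [delta] uses up one order of vanishing and raises the weight by 2, so after k steps only
     the component 2 k has a nonzero leading coefficient. *)
  assert (HV : forall k, (k <= K)%nat -> exists a : C, a <> 0%C /\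
     vanishes z0 (K - k) (oppow delta k F) (fun m => if Req_EM_T m (2 * INR k) then a else 0%C)).
  { induction k as [|k IH]; intros Hk.
    - exists 1%C; split; [intros E; apply (f_equal fst) in E; simpl in E; lra|].
      rewrite Nat.sub_0_r; intros m; exists (fun _ => if Req_EM_T m 0 then RtoC 1 else RtoC 0); split; [|split].
      + apply holo_const.
      + intros z _; unfold oppow, opid, F; simpl; destruct (Req_EM_T m 0); ring.
      + simpl; rewrite Rmult_0_r; reflexivity.
    - destruct IH as [a [Ha HV]]; [lia|].
      replace (K - k)%nat with (S (K - S k)) in HV by lia.
      exists (RtoC (INR (S (K - S k))) / (RtoC (2 * PI) * Ci) * a)%C; split.
      + repeat apply Cmult_neq_0; auto.
        * intros E; apply RtoC_inj in E; revert E; apply not_0_INR; lia.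
        * intros E; apply (f_equal (Cmult (RtoC (2 * PI) * Ci))) in E.
          rewrite Cinv_r, Cmult_0_r in E by apply two_pi_i_neq_0.
          apply RtoC_inj in E; lra.
      + apply vanishes_delta in HV; [|exact Hz0].
        intros m; destruct (HV m) as [g (Hg & H1 & H2)]; exists g; split; [exact Hg|split; [exact H1|]].
        rewrite H2, (S_INR k).
        destruct (Req_EM_T (m - 2) (2 * INR k)), (Req_EM_T m (2 * (INR k + 1))); try lra; try reflexivity; ring. }
  exists F; split; [exact HF|split].
  - intros k m Hk; destruct (HV k) as [a [_ H]]; [lia|].
    replace (K - k)%nat with (S (K - k - 1)) in H by lia.
    now apply vanishes_S_eq_0 with (m := m) in H.
  - destruct (HV K (le_n K)) as [a [Ha H]]; exists a; split; [exact Ha|].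
    intros m; destruct (H m) as [g (_ & H1 & H2)]; rewrite H1, Nat.sub_diag by exact Hz0.
    simpl Cpow; rewrite <- H2; ring.
Qed.

Lemma oppow_e4_apply i G m z : oppow e4 i G m z = (E4 z ^ i * G (m - 4 * INR i)%R z)%C.
Proof.
  revert m; induction i as [|i IH]; intros m.
  - simpl; rewrite Rmult_0_r, Rminus_0_r; unfold oppow, opid; simpl; ring.
  - change (oppow e4 (S i) G m z) with (E4 z * oppow e4 i G (m - 4)%R z)%C.
    rewrite IH, Cpow_S, S_INR; replace (m - 4 - 4 * INR i) with (m - 4 * (INR i + 1)) by ring; ring.
Qed.

Lemma oppow_e6_apply i G m z : oppow e6 i G m z = (E6 z ^ i * G (m - 6 * INR i)%R z)%C.
Proof.
  revert m; induction i as [|i IH]; intros m.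
  - simpl; rewrite Rmult_0_r, Rminus_0_r; unfold oppow, opid; simpl; ring.
  - change (oppow e6 (S i) G m z) with (E6 z * oppow e6 i G (m - 6)%R z)%C.
    rewrite IH, Cpow_S, S_INR; replace (m - 6 - 6 * INR i) with (m - 6 * (INR i + 1)) by ring; ring.
Qed.

Lemma basis_el_apply i j k F m z : basis_el i j k F m z
  = (E4 z ^ i * E6 z ^ j * oppow delta k F (m - 4 * INR i - 6 * INR j)%R z)%C.
Proof.
  unfold basis_el, opcomp at 1; rewrite oppow_e4_apply.
  unfold opcomp; rewrite oppow_e6_apply; ring.
Qed.

(** The probe is centred at the very z where the relation is wanted. After [delta] has acted k times
    its value at z sits in weight 2 k, so the component 2 k + w receives exactly the terms with 4 i
    + 6 j = w; smaller exponents of [delta] vanish by the probe, larger ones by hypothesis. *)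
Lemma lincomb_weight_relation N c k w : (k < N)%nat ->
  opeq (lincomb N c) opzero ->
  (forall i j k', (i < N)%nat -> (j < N)%nat -> (k' < N)%nat -> (k < k')%nat -> c i j k' = 0%C) ->
  forall z, UHP z ->
  csum (fun i => csum (fun j => if Nat.eqb (4 * i + 6 * j) w then c i j k * (E4 z ^ i * E6 z ^ j) else 0%C)%C
    (seq 0 N)) (seq 0 N) = 0%C.
Proof.
  intros Hk H0 Htop z Hz.
  destruct (delta_probe k z Hz) as [F [HF [Hlow [a [Ha Hval]]]]].
  specialize (H0 F HF (2 * INR k + INR w) z Hz); rewrite lincomb_csum in H0.
  set (m := 2 * INR k + INR w) in *.
  match goal with |- ?s = _ => assert (E : (a * s)%C = 0%C) end.
  - rewrite <- csum_scal; etransitivity; [|exact H0]; apply csum_ext; intros i Hi; apply in_seq in Hi.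
    rewrite <- csum_scal; apply csum_ext; intros j Hj; apply in_seq in Hj.
    rewrite (csum_single _ k); [|exact Hk|].
    + rewrite basis_el_apply, Hval; unfold m.
      assert (Hw : INR (4 * i + 6 * j) = 4 * INR i + 6 * INR j).
      { rewrite plus_INR, !mult_INR; simpl; ring. }
      destruct (Nat.eqb_spec (4 * i + 6 * j) w) as [E|E].
      * rewrite E in Hw; destruct (Req_EM_T _ _); [ring|lra].
      * destruct (Req_EM_T _ _) as [E'|_]; [|ring].
        exfalso; apply E, INR_eq; lra.
    + intros k' HN Hk'; rewrite basis_el_apply.
      destruct (Nat.lt_ge_cases k' k) as [Hlt|Hge]; [rewrite Hlow by exact Hlt; ring|].
      rewrite Htop by lia; ring.
  - now apply Cmult_integral_r in E.
Qed.

(** * Polynomials with infinitely many roots *)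

Definition peval (l : list C) (x : C) : C := fold_right (fun (b acc : C) => b + x * acc)%C (RtoC 0) l.

Lemma peval_zero (l : list C) x : (forall b, In b l -> b = 0%C) -> peval l x = 0%C.
Proof.
  induction l as [|b l IH]; intros H; [reflexivity|].
  simpl; rewrite IH, (H b); [ring|now left|]; intros b' Hb'; apply H; now right.
Qed.

Lemma peval_factor l r : exists l', length l' = pred (length l) /\
  forall x, peval l x = (peval l r + (x - r) * peval l' x)%C.
Proof.
  induction l as [|b l [l' [Hlen IH]]].
  - exists nil; split; [reflexivity|]; intros x; simpl; ring.
  - destruct l as [|b' l].
    + exists nil; split; [reflexivity|]; intros x; simpl; ring.
    + exists (peval (b' :: l) r :: l'); split; [simpl in *; now rewrite Hlen|].
      intros x; change (peval (b :: b' :: l) x) with (b + x * peval (b' :: l) x)%C.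
      rewrite (IH x).
      change (peval (b :: b' :: l) r) with (b + r * peval (b' :: l) r)%C.
      change (peval (peval (b' :: l) r :: l') x) with (peval (b' :: l) r + x * peval l' x)%C.
      ring.
Qed.

(** Dividing by x - s 0 shortens the list, so by induction the quotient is zero and the polynomial
    vanishes identically. Its constant coefficient is the value at 0, and the remaining list then
    vanishes at all positive integers, so induction applies to it too. *)
Lemma peval_infinitely_many_roots n (l : list C) (s : nat -> R) : length l = n ->
  (forall i j, s i = s j -> i = j) -> (forall i, peval l (RtoC (s i)) = 0%C) ->
  forall b, In b l -> b = 0%C.
Proof.
  revert l s; induction n as [|n IH]; intros l s Hn Hs H; [destruct l; [easy|discriminate]|].
  destruct l as [|b l]; [discriminate|].
  destruct (peval_factor (b :: l) (RtoC (s 0%nat))) as [l' [Hlen Hl']].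
  assert (Hz : forall c, In c l' -> c = 0%C).
  { apply (IH l' (fun i => s (S i))).
    - rewrite Hlen; simpl in *; lia.
    - intros i j E; apply Hs in E; lia.
    - intros i; pose proof (Hl' (RtoC (s (S i)))) as E; rewrite !H in E.
      apply (Cmult_integral_r (RtoC (s (S i)) - RtoC (s 0%nat))%C).
      + rewrite <- RtoC_minus; intros E0; apply RtoC_inj in E0.
        assert (s (S i) = s 0%nat) as E1 by lra; apply Hs in E1; lia.
      + rewrite Cplus_0_l in E; now symmetry. }
  assert (Hall : forall x, peval (b :: l) x = 0%C).
  { intros x; rewrite Hl', H, (peval_zero l' x Hz); ring. }
  assert (Hb : b = 0%C) by (rewrite <- (Hall 0%C); simpl; ring).
  intros c [<-|Hc]; [exact Hb|].
  revert c Hc; apply (IH l (fun i => INR (S i))).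
  - simpl in Hn; lia.
  - intros i j E; apply INR_eq in E; lia.
  - intros i; apply (Cmult_integral_r (RtoC (INR (S i)))).
    + intros E; apply RtoC_inj in E; revert E; apply not_0_INR; lia.
    + rewrite <- (Hall (RtoC (INR (S i)))), Hb; simpl; ring.
Qed.

Lemma csum_peval (b : nat -> C) x a n :
  csum (fun i => b i * x ^ i)%C (seq a n) = (x ^ a * peval (map b (seq a n)) x)%C.
Proof.
  revert a; induction n as [|n IH]; intros a; [simpl; unfold csum; simpl; ring|].
  change (csum (fun i => b i * x ^ i)%C (seq a (S n)))
    with (b a * x ^ a + csum (fun i => b i * x ^ i)%C (seq (S a) n))%C.
  rewrite IH, Cpow_S; simpl; ring.
Qed.

(** * Real q-series on the imaginary axis *)

Definition rsum (a : nat -> R) (q : R) : R := Series (fun n => a n * q ^ n).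

Lemma rsum_ex a q : polygrowth a -> 0 < q < 1 -> ex_series (fun n => a n * q ^ n).
Proof.
  intros Ha Hq; apply (ex_series_le (V:=R_CompleteNormedModule)) with
    (fun n => Rabs (a n) * INR n ^ 0 * q ^ n).
  - intros n; change (Rabs (a n * q ^ n) <= Rabs (a n) * INR n ^ 0 * q ^ n).
    rewrite Rabs_mult, (Rabs_pos_eq (q ^ n)) by (apply pow_le; lra); simpl; lra.
  - now apply polygrowth_ex_series.
Qed.

Lemma psum_real a q : polygrowth a -> 0 < q < 1 -> psum a (RtoC q) = RtoC (rsum a q).
Proof.
  intros Ha Hq; apply is_CSeries_unique.
  apply is_CSeries_ext with (fun n => RtoC (a n * q ^ n)).
  - intros n; now rewrite RtoC_mult, RtoC_pow.
  - split; simpl; [now apply Series_correct, rsum_ex|apply is_series_zero].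
Qed.

(** The linear term increases strictly and the higher ones weakly. The constant term cancels in the
    difference, so its sign is free. *)
Lemma rsum_increasing a q1 q2 : polygrowth a -> (forall n, (0 < n)%nat -> 0 <= a n) -> 0 < a 1%nat ->
  0 < q1 -> q1 < q2 -> q2 < 1 -> rsum a q1 < rsum a q2.
Proof.
  intros Ha Hpos H1 Hq1 Hq Hq2.
  set (u := fun n => a n * q2 ^ n - a n * q1 ^ n).
  assert (E1 : ex_series (fun n => a n * q1 ^ n)) by (apply rsum_ex; auto; lra).
  assert (E2 : ex_series (fun n => a n * q2 ^ n)) by (apply rsum_ex; auto; lra).
  assert (Eu : ex_series u) by exact (ex_series_minus (V:=R_NormedModule) _ _ E2 E1).
  assert (Hu : Series u = rsum a q2 - rsum a q1) by (apply Series_minus; auto).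
  assert (Hn : forall n, (0 < n)%nat -> 0 <= u n).
  { intros n Hn; unfold u; rewrite <- Rmult_minus_distr_l; apply Rmult_le_pos; auto.
    assert (q1 ^ n <= q2 ^ n) by (apply pow_incr; lra). lra. }
  assert (Eu1 : ex_series (fun n => u (S n))) by (now apply -> (ex_series_incr_1 (V:=R_NormedModule) u)).
  assert (Eu2 : ex_series (fun n => u (S (S n))))
    by (now apply -> (ex_series_incr_1 (V:=R_NormedModule) (fun n => u (S n)))).
  rewrite Series_incr_1, (Series_incr_1 (fun n => u (S n))) in Hu by auto.
  assert (0 <= Series (fun n => u (S (S n)))).
  { rewrite <- (is_series_unique _ _ is_series_zero); apply Series_le; auto.
    intros n; split; [lra|apply Hn; lia]. }
  assert (u 0%nat = 0) by (unfold u; simpl; ring).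
  assert (0 < u 1%nat).
  { unfold u; simpl; rewrite !Rmult_1_r, <- Rmult_minus_distr_l; apply Rmult_lt_0_compat; lra. }
  lra.
Qed.

Lemma sigma_1 k : Defs.sigma k 1 = 1.
Proof. unfold Defs.sigma; simpl; rewrite pow1; ring. Qed.

Lemma psum_0 a : psum a 0 = RtoC (a 0%nat).
Proof.
  apply is_CSeries_unique.
  apply is_CSeries_ext with (fun n => RtoC (a 0%nat) * (if Nat.eqb n 0 then RtoC 1 else 0%C))%C.
  - intros [|n]; cbn [Nat.eqb]; rewrite ?Cpow_S; simpl; ring.
  - replace (RtoC (a 0%nat)) with (RtoC (a 0%nat) * 1)%C at 1 by ring.
    apply is_CSeries_scal, is_CSeries_head.
Qed.

(** Continuity at q = 0, where the value is 1. Real powers of the E6 series are taken later, which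
    requires its positivity near the cusp. *)
Lemma rsum_pos_near_0 a : polygrowth a -> a 0%nat = 1 ->
  exists d, 0 < d /\ forall q, 0 < q < d -> q < 1 -> 0 < rsum a q.
Proof.
  intros Ha H0.
  assert (Hc : cdiff (psum a) 0) by (eexists; apply psum_cderiv; [exact Ha|rewrite Cmod_0; lra]).
  destruct (cdiff_continuous _ _ Hc 1 Rlt_0_1) as [d [Hd H]].
  exists d; split; [exact Hd|]; intros q Hq Hq1.
  specialize (H (RtoC q)); rewrite psum_real, psum_0, H0 in H by (auto; lra).
  rewrite <- !RtoC_minus, !Cmod_R, Rminus_0_r, (Rabs_pos_eq q) in H by lra.
  apply Rabs_def2 in H; lra.
Qed.

(** The point i (- ln q) / (2 pi) is chosen so that its nome is q. *)
Lemma Eis_imaginary_axis q c k : 0 < q < 1 ->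
  UHP (0, - ln q / (2 * PI)) /\ Eis c k (0, - ln q / (2 * PI)) = RtoC (rsum (ecoef c k) q).
Proof.
  intros Hq; pose proof PI_RGT_0.
  assert (Hz : UHP (0, - ln q / (2 * PI))).
  { unfold UHP; simpl; apply Rdiv_lt_0_compat; [|lra].
    assert (ln q < ln 1) by (apply ln_increasing; lra); rewrite ln_1 in *; lra. }
  split; [exact Hz|].
  rewrite Eis_psum, <- psum_real by auto using ecoef_growth; f_equal.
  unfold nome, cexp.
  replace (Cmult (RtoC (2 * PI) * Ci) (0, - ln q / (2 * PI))) with ((ln q, 0) : C)
    by (apply injective_projections; simpl; field; lra).
  simpl; rewrite exp_ln, cos_0, sin_0 by lra.
  apply injective_projections; simpl; ring.
Qed.

Lemma E4_E6_monomials_independent N (c : nat -> nat -> C) w :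
  (forall z, UHP z -> csum (fun i => csum (fun j =>
     if Nat.eqb (4 * i + 6 * j) w then c i j * (E4 z ^ i * E6 z ^ j) else 0%C)%C
     (seq 0 N)) (seq 0 N) = 0%C) ->
  forall i j, (i < N)%nat -> (j < N)%nat -> (4 * i + 6 * j = w)%nat -> c i j = 0%C.
Proof.
  intros H i0 j0 Hi Hj Hw.
  pose (x := rsum (ecoef 240 3)); pose (y := rsum (ecoef (-504) 5)).
  destruct (rsum_pos_near_0 _ (ecoef_growth 240 3) eq_refl) as [d1 [Hd1 H1]].
  destruct (rsum_pos_near_0 _ (ecoef_growth (-504) 5) eq_refl) as [d2 [Hd2 H2]].
  set (d := Rmin 1 (Rmin d1 d2)).
  assert (Hd : 0 < d /\ d <= 1 /\ d <= d1 /\ d <= d2).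
  { unfold d; repeat split.
    - repeat apply Rmin_glb_lt; lra.
    - apply Rmin_l.
    - eapply Rle_trans; [apply Rmin_r|apply Rmin_l].
    - eapply Rle_trans; [apply Rmin_r|apply Rmin_r]. }
  clearbody d.
  assert (Hx : forall q, 0 < q < d -> 0 < x q) by (intros; apply H1; lra).
  assert (Hy : forall q, 0 < q < d -> 0 < y q) by (intros; apply H2; lra).
  assert (Hxi : forall q q', 0 < q -> q < q' -> q' < d -> x q < x q').
  { intros q q' Hq Hqq Hq'; apply rsum_increasing; try lra.
    - apply ecoef_growth.
    - intros n Hn; unfold ecoef; destruct (Nat.eqb_spec n 0); [lra|].
      destruct (sigma_bound 3 n); lra.
    - unfold ecoef; simpl Nat.eqb; cbv iota; rewrite sigma_1; lra. }
  assert (Hyi : forall q q', 0 < q -> q < q' -> q' < d -> y q' < y q).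
  { intros q q' Hq Hqq Hq'.
    (* The E6 coefficients are negative from n = 1 on, so monotonicity is applied to -y; its
       constant term -1 is allowed there. *)
    assert (Hneg : forall r, rsum (fun n => (-1) * ecoef (-504) 5 n) r = - y r).
    { intros r; unfold y, rsum; rewrite <- Series_opp; apply Series_ext; intros n; ring. }
    apply Ropp_lt_cancel; rewrite <- !Hneg; apply rsum_increasing; try lra.
    - destruct (ecoef_growth (-504) 5) as [M [p HM]]; exists M, p; intros n.
      rewrite Rabs_mult, Rabs_m1, Rmult_1_l; apply HM.
    - intros n Hn; unfold ecoef; destruct (Nat.eqb_spec n 0); [lia|].
      destruct (sigma_bound 5 n); lra.
    - unfold ecoef; simpl Nat.eqb; cbv iota; rewrite sigma_1; lra. }
  (* On a fixed weight w = 4 i + 6 j one has E4^i E6^j = t^i E6^(w / 6) with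
     t = E4 E6^(-2/3), which is strictly increasing in q on the imaginary axis. *)
  pose (t := fun q => x q * Rpower (y q) (- (2 / 3))).
  assert (Ht : forall q q', 0 < q -> q < q' -> q' < d -> t q < t q').
  { intros q q' Hq Hqq Hq'; unfold t.
    apply Rmult_gt_0_lt_compat.
    - apply exp_pos.
    - apply Hx; lra.
    - now apply Hxi.
    - rewrite !Rpower_Ropp; apply Rinv_lt_contravar.
      + apply Rmult_lt_0_compat; apply exp_pos.
      + apply Rlt_Rpower_l; [lra|]; split; [apply Hy; lra|now apply Hyi]. }
  (* For given i at most one j satisfies 4 i + 6 j = w, so [b i] is a single coefficient or 0. *)
  pose (b := fun i => csum (fun j => if Nat.eqb (4 * i + 6 * j) w then c i j else 0%C) (seq 0 N)).
  assert (Hroot : forall q, 0 < q < d -> csum (fun i => b i * RtoC (t q) ^ i)%C (seq 0 N) = 0%C).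
  { intros q Hq.
    destruct (Eis_imaginary_axis q 240 3 ltac:(lra)) as [Hz HE4].
    destruct (Eis_imaginary_axis q (-504) 5 ltac:(lra)) as [_ HE6].
    specialize (H _ Hz).
    apply (Cmult_integral_r (RtoC (Rpower (y q) (INR w / 6)))).
    { intros E; apply RtoC_inj in E; pose proof (exp_pos (INR w / 6 * ln (y q))); unfold Rpower in E; lra. }
    rewrite <- H, <- csum_scal; apply csum_ext; intros i _.
    unfold b; rewrite Cmult_comm, <- Cmult_assoc, Cmult_comm, <- csum_scal; apply csum_ext; intros j _.
    destruct (Nat.eqb_spec (4 * i + 6 * j) w) as [E|E]; [|ring].
    change E4 with (Eis 240 3); change E6 with (Eis (-504) 5); rewrite HE4, HE6.
    fold (x q) (y q).
    assert (Hyq := Hy q Hq).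
    assert (EE : t q ^ i * Rpower (y q) (INR w / 6) = x q ^ i * y q ^ j).
    { unfold t; rewrite Rpow_mult_distr, <- (Rpower_pow j (y q)) by exact Hyq.
      rewrite <- (Rpower_pow i (Rpower (y q) _)) by apply exp_pos.
      rewrite Rpower_mult, Rmult_assoc, <- Rpower_plus; do 2 f_equal.
      rewrite <- E, plus_INR, !mult_INR; simpl; field. }
    rewrite <- !RtoC_pow, <- !RtoC_mult, EE; ring. }
  assert (Hb : b i0 = 0%C).
  (* The shift by 2 keeps all sample points d / (n + 2) strictly below d, already for n = 0. *)
  { apply (peval_infinitely_many_roots N (map b (seq 0 N)) (fun n => t (d / (INR n + 2)))).
    - now rewrite length_map, length_seq.
    - assert (Hlt : forall i j, (i < j)%nat -> t (d / (INR j + 2)) < t (d / (INR i + 2))).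
      { intros i j Hij; pose proof (pos_INR i); apply lt_INR in Hij.
        apply Ht.
        - apply Rdiv_lt_0_compat; lra.
        - apply Rmult_lt_compat_l; [lra|]; apply Rinv_lt_contravar; [nra|lra].
        - apply Rlt_div_l; nra. }
      intros i j E; destruct (Nat.lt_trichotomy i j) as [L|[L|L]]; auto;
        apply Hlt in L; lra.
    - intros n; pose proof (pos_INR n).
      rewrite <- (Hroot (d / (INR n + 2))), csum_peval; [simpl; ring|].
      split; [apply Rdiv_lt_0_compat; lra|apply Rlt_div_l; nra].
    - apply in_map, in_seq; lia. }
  unfold b in Hb; rewrite (csum_single _ j0) in Hb; [|exact Hj|].
  - now rewrite Hw, Nat.eqb_refl in Hb.
  - intros j _ Hne; destruct (Nat.eqb_spec (4 * i0 + 6 * j) w); [lia|reflexivity].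
Qed.

Lemma lincomb_independent N c : opeq (lincomb N c) opzero ->
  forall i j k, (i < N)%nat -> (j < N)%nat -> (k < N)%nat -> c i j k = 0%C.
Proof.
  intros H0.
  (* Descending induction on k, with [e] bounding N - k: the coefficients at larger exponents of
     [delta] are already known to vanish. *)
  assert (H : forall e i j k, (N - k <= e)%nat -> (i < N)%nat -> (j < N)%nat -> (k < N)%nat -> c i j k = 0%C).
  { induction e as [|e IH]; intros i j k He Hi Hj Hk; [lia|].
    apply (E4_E6_monomials_independent N (fun i j => c i j k) (4 * i + 6 * j)); auto.
    intros z Hz; apply lincomb_weight_relation; auto.
    intros i' j' k' Hi' Hj' Hk' Hlt; apply IH; lia. }
  intros i j k; now apply (H (N - k)%nat).
Qed.

Theorem theorem3p3 :
  (forall i j k : nat, inR (basis_el i j k)) /\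
  (forall (N : nat) (c : nat -> nat -> nat -> C),
      opeq (lincomb N c) opzero ->
      forall i j k : nat, (i < N)%nat -> (j < N)%nat -> (k < N)%nat ->
      c i j k = 0%C) /\
  (forall T : Op, inR T ->
      exists (N : nat) (c : nat -> nat -> nat -> C), opeq T (lincomb N c)).
Proof.
  split; [exact inR_basis_el|split; [exact lincomb_independent|]].
  intros T HT; destruct (span_lincomb T (inR_span T HT)) as (N & c & H).
  exists N, c; now apply H.
Qed.
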